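(* Let $P$ be a distribution for a coherent sequence of permutations $(\pi_n)$ with the property that, for every $n$, conditionally given $\mathrm{rec}(\pi_n)$, the law $P_n$ of $\pi_n$ is uniform (any two permutations in $\mathfrak S_n$ with the same value of $\mathrm{rec}$ have the same probability). Then $\mathrm{rec}(\pi_n)=(r_k)$ satisfies, as $n\to\infty$, $$\frac{r_k}{n}\to\rho_k\quad\text{almost surely}\qquad(k\in\mathbb Z)$$ for some random sequence $(\rho_k)$ with values in $\mathcal S$. Conditionally given $(\rho_k)$, the law of $(\pi_n)$ is the same as for the coherent sequence of permutations generated by ranking the variables $(X_n)$ obtained from $(\rho_k)$ and independent uniform variables by the construction described in the context.
   Context: Permutations of $[n]=\{1,\dots,n\}$ are written $\pi_n=(\pi_{n1},\dots,\pi_{nn})$. The entry $\pi_{nj}$ is a lower record if $\pi_{nj}=\min(\pi_{n1},\dots,\pi_{nj})$, an upper record if $\pi_{nj}=\max(\pi_{n1},\dots,\pi_{nj})$; records with $j\ge2$ are called proper. If $\pi_n$ has $\ell$ proper lower and $u$ proper upper records, $\mathrm{rec}(\pi_n)=(r_{-\ell},\dots,r_{-1},r_0,r_1,\dots,r_u)$ is the increasing sequence of its record values with distinguished center $r_0=\pi_{n1}$; $r_{-\ell},\dots,r_{-1}$ are the proper lower record values and $r_1,\dots,r_u$ the proper upper record values. It is padded by $r_k=1$ for $k<-\ell$ and $r_k=n$ for $k>u$. A sequence $(\pi_n)_{n\ge1}$, $\pi_n\in\mathfrak S_n$, is coherent if for all $m\le n$ the ranking permutation of $(\pi_{n1},\dots,\pi_{nm})$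 (each entry replaced by its rank in increasing order) is $\pi_m$. A coherent sequence is the same as a strict total order $\lhd$ on $\mathbb N=\{1,2,\dots\}$: $j\lhd i$ iff $\pi_{nj}<\pi_{ni}$ for all $n\ge\max(i,j)$. It is determined by its initial ranks $i_n$, where $i_n$ is the rank of $n$ within $\{1,\dots,n\}$ with respect to $\lhd$ (rank $1$ is smallest). $\mathcal S$ is the space of two-sided nondecreasing sequences $(x_k,\,k\in\mathbb Z)$ with $x_k\in[0,1]$, with the product topology. Construction of $(X_n)$. Let $(\rho_k)$ be a random element of $\mathcal S$ and let $(W_n)$ be iid uniform$[0,1]$, independent of $(\rho_k)$. Start with $X_1=\rho_0$ and $\ell=u=0$. Suppose that after step $n$ the values $\rho_{-\ell},\dots,\rho_u$ have been included into $X_1,\dots,X_n$, so that $\rho_u=\max(X_1,\dots,X_n)$ and $\rho_{-\ell}=\min(X_1,\dots,X_n)$. At step $n+1$: let $X_{n+1}=\rho_{u+1}$ (and increase $u$ by $1$) if $W_{n+1}>\rho_u$; let $X_{n+1}=\rho_{-\ell-1}$ (and increase $\ell$ by $1$) if $W_{n+1}<\rho_{-\ell}$; let $X_{n+1}=W_{n+1}$ otherwise. Ranking of $(X_n)$. The order $\lhd$ on $\mathbb N$ is defined by: $i\lhd j$ if (a) $X_i<X_j$, or (b) $i<j$ and $X_i=X_j=\max(X_1,\dots,X_j)$, or (c) $j<i$ and $X_i=X_j=\min(X_1,\dots,X_i)$. If the sequence starts with $m>1$ repetitions $X_1=\dots=X_m\ne X_{m+1}$ (or $m=\infty$), rules (b)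 and (c) are inconsistent among indices $\le m$, and for $2\le j\le m$ one sets instead the initial rank of $j$ to be $i_j=j$ if $X_j$ was introduced at step $j$ because $W_j$ exceeded the current maximum, and $i_j=1$ if it was introduced because $W_j$ was below the current minimum. (Equivalently, almost surely: $i_{n+1}=n+1$ if $W_{n+1}>\rho_u$, $i_{n+1}=1$ if $W_{n+1}<\rho_{-\ell}$, and $i_{n+1}=1+\#\{i\le n:X_i<W_{n+1}\}$ otherwise.) The coherent permutations generated by ranking $(X_n)$ are those corresponding to $\lhd$. *)

(* Defs.v *)
From HB Require Import structures.
From mathcomp Require Import all_boot all_order all_algebra all_fingroup.
From mathcomp Require Import all_classical all_reals all_analysis.

Set Implicit Arguments.
Unset Strict Implicit.
Unset Printing Implicit Defensive.

Import Order.TTheory GRing.Theory Num.Theory.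
Import numFieldNormedType.Exports.

Local Open Scope classical_set_scope.
Local Open Scope ring_scope.

(* Positions and values of ['S_n] start at 0. As a permutation s of {1, ..., n},
   the entry s_j is [(s j').+1], where j' is the ordinal of value j - 1; record
   values are counted from 1. *)

Section Records.
Variables (n : nat) (s : 'S_n).

Definition lower_record (j : 'I_n) : bool :=
  [forall i : 'I_n, (i <= j)%N ==> (s j <= s i)%N].

Definition upper_record (j : 'I_n) : bool :=
  [forall i : 'I_n, (i <= j)%N ==> (s i <= s j)%N].

Definition num_lower : nat := #|[pred j : 'I_n | (0 < j)%N && lower_record j]|.

Definition num_upper : nat := #|[pred j : 'I_n | (0 < j)%N && upper_record j]|.

Definition record_values : seq nat :=
  sort leq [seq (s j).+1 | j <- enum 'I_n & lower_record j || upper_record j].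

(* The distinguished center is given by its index in the increasing sequence,
   which is the number of proper lower records. *)
Definition rec : seq nat * nat := (record_values, num_lower).

Definition padded_rec (k : int) : nat :=
  if k < - num_lower%:Z then 1%N
  else if num_upper%:Z < k then n
  else nth 0%N record_values (absz (k + num_lower%:Z)).

End Records.

(* The permutation whose entry at j is the rank of j for [lt]. It exists and is
   unique when [lt] is a strict total order; otherwise the identity may be
   returned. *)
Definition ranking_perm (n : nat) (lt : rel 'I_n) : 'S_n :=
  odflt 1%g
    [pick s : 'S_n | [forall j, (s j : nat) == #|[pred i : 'I_n | lt i j]|]].

(* The term of index 0 carries no information, as ['S_0] is a singleton. *)
Definition perm_array := forall n : nat, 'S_n.

Definition coherent (p : perm_array) : Prop :=
  forall (m n : nat) (lemn : (m <= n)%N),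
    p m = ranking_perm
      (fun i j : 'I_m =>
         (p n (widen_ord lemn i) < p n (widen_ord lemn j))%N).

HB.instance Definition _ := gen_eqMixin perm_array.
HB.instance Definition _ := gen_choiceMixin perm_array.
HB.instance Definition _ :=
  isPointed.Build perm_array (fun n => 1%g : 'S_n).

Definition perm_array_cylinders : set (set perm_array) :=
  [set A | exists n (s : 'S_n), A = [set p | p n = s]].

(* The product of the discrete sigma-algebras. *)
HB.instance Definition _ :=
  @isMeasurable.Build (sigma_display perm_array_cylinders)
    perm_array <<s perm_array_cylinders >>
    (@sigma_algebra0 _ setT _) (@sigma_algebraC _ _)
    (@sigma_algebra_bigcup _ setT _).

Record monoseq (R : realType) := MonoSeq {
  monoseq_val :> int -> R;
  monoseq_homo : {homo monoseq_val : k l / k <= l};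
  monoseq_itv : forall k, 0 <= monoseq_val k <= 1
}.

Section MonoseqMeasurable.
Variable R : realType.

Let monoseq0_homo : {homo (fun _ : int => 0 : R) : k l / k <= l}.
Proof. by []. Qed.

Let monoseq0_itv (k : int) : 0 <= (0 : R) <= 1.
Proof. by rewrite lexx ler01. Qed.

HB.instance Definition _ := gen_eqMixin (monoseq R).
HB.instance Definition _ := gen_choiceMixin (monoseq R).
HB.instance Definition _ :=
  isPointed.Build (monoseq R) (MonoSeq monoseq0_homo monoseq0_itv).

Definition monoseq_cylinders : set (set (monoseq R)) :=
  [set A | exists (k : int) (B : set R),
     measurable B /\ A = [set x : monoseq R | B (x k)]].

(* This is the Borel sigma-algebra of the product topology, since there are
   countably many coordinates. *)
HB.instance Definition _ :=
  @isMeasurable.Build (sigma_display monoseq_cylinders)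
    (monoseq R) <<s monoseq_cylinders >>
    (@sigma_algebra0 _ setT _) (@sigma_algebraC _ _)
    (@sigma_algebra_bigcup _ setT _).

End MonoseqMeasurable.

(* Sequences X_1, X_2, ... and W_1, W_2, ... are indexed from 0: [Xseq n] is
   X_{n+1} and [w n] is W_{n+1}. The value [w 0] is not used. *)

Section Construction.
Variables (R : realType) (x : int -> R) (w : nat -> R).

(* The pair (l, u) once X_1, ..., X_{n+1} are known. *)
Fixpoint included (n : nat) : nat * nat :=
  if n is m.+1 then
    let: (l, u) := included m in
    if x u%:Z < w m.+1 then (l, u.+1)
    else if w m.+1 < x (- l%:Z) then (l.+1, u)
    else (l, u)
  else (0%N, 0%N).

(* These test how X_{j+1} was introduced; they are false for X_1. *)
Definition introduced_above (j : nat) : bool :=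
  if j is m.+1 then x (included m).2%:Z < w m.+1 else false.

Definition introduced_below (j : nat) : bool :=
  if j is m.+1 then w m.+1 < x (- (included m).1%:Z) else false.

Definition Xseq (n : nat) : R :=
  if n is m.+1 then
    let: (l, u) := included m in
    if introduced_above n then x u.+1%:Z
    else if introduced_below n then x (- l.+1%:Z)
    else w n
  else x 0.

Definition is_running_max (j : nat) : bool :=
  [forall i : 'I_j.+1, Xseq i <= Xseq j].

Definition is_running_min (j : nat) : bool :=
  [forall i : 'I_j.+1, Xseq j <= Xseq i].

Definition in_initial_run (m : nat) : bool :=
  [forall i : 'I_m.+1, Xseq i == Xseq 0].

(* When both indices are in the initial run of repetitions, the later one, say
   j, is above all its predecessors if its initial rank is maximal, and below
   them if its initial rank is 1. *)
Definition Xorder (i j : nat) : bool :=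
  if in_initial_run (maxn i j) then
    ((i < j)%N && introduced_above j) || ((j < i)%N && introduced_below i)
  else
    [|| Xseq i < Xseq j,
        [&& (i < j)%N, Xseq i == Xseq j & is_running_max j]
      | [&& (j < i)%N, Xseq i == Xseq j & is_running_min i]].

Definition generated_perms : perm_array :=
  fun n => ranking_perm (fun i j : 'I_n => Xorder i j).

End Construction.

Section Probability.
Context (R : realType) (d : measure_display) (T : measurableType d).
Variable P : probability T R.

Definition mutually_independent (W : nat -> {RV P >-> R}) : Prop :=
  forall (s : seq nat) (B : nat -> set R),
    uniq s -> (forall i, measurable (B i)) ->
    P (\bigcap_(i in [set` s]) (W i @^-1` B i)) =
    (\prod_(i <- s) P (W i @^-1` B i))%E.

Definition iid_uniform (W : nat -> {RV P >-> R}) : Prop :=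
  (forall (n : nat) (B : set R), measurable B ->
     distribution P (W n) B = uniform_prob (@ltr01 R) B) /\
  mutually_independent W.

Definition random_element_with_law (d' : measure_display)
    (E : measurableType d') (f : T -> E) (mu : set E -> \bar R) : Prop :=
  measurable_fun [set: T] f /\
  forall B : set E, measurable B -> mu B = P (f @^-1` B).

(* [kappa] is a regular conditional distribution of [Y] given [Z]. *)
Definition conditional_law (d1 d2 : measure_display)
    (E1 : measurableType d1) (E2 : measurableType d2)
    (Z : {RV P >-> E1}) (Y : {RV P >-> E2}) (kappa : R.-pker E1 ~> E2) : Prop :=
  forall (A : set E1) (B : set E2), measurable A -> measurable B ->
    P (Z @^-1` A `&` Y @^-1` B) =
    (\int[P]_(t in Z @^-1` A) kappa (Z t) B)%E.

End Probability.

(* Main.v *)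
(* A coherent array is a strict total order on nat; the law of the array is
   invariant under every relabeling that preserves rec at all later levels, even
   jointly with a function of rho, since rho is determined by those values of
   rec. If two neighbours i and i + 1, with i >= n, are separated by one of the
   first n items, then exchanging them changes no set of records; hence the
   positions of the items n, n + 1, ... relative to the first n items are
   exchangeable. Consequently (second moments along a sparse subsequence, then
   interpolation) the relative ranks converge almost surely, and this gives rho.

   Among the records of the first n items, item i occupies a gap. Averaging over
   the exchangeable items, and letting their number go to infinity by dominated
   convergence, shows that given rho and the gaps of the earlier items, the next
   item falls into a gap with probability equal to its length. So a sequence of
   gaps has as its conditional probability the product of the lengths, as it has
   for (X_n), where each W_j must fall into a prescribed interval. Two
   permutations with the same sequence of gaps have the same rec, hence are
   equally likely under P jointly with rho; they are equally likely for (X_n)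
   since the W_j falling into the same interval are exchangeable. This identifies
   the conditional probabilities of all events {pi_n = s}, which determine the
   law on coherent arrays. *)
Require Import Defs.
From HB Require Import structures.
From mathcomp Require Import all_boot all_order all_algebra all_fingroup.
From mathcomp Require Import zify ring lra.
From mathcomp Require Import all_classical all_reals all_analysis measurable_realfun.

Set Implicit Arguments.
Unset Strict Implicit.
Unset Printing Implicit Defensive.

Import Order.TTheory GRing.Theory Num.Theory.
Import numFieldNormedType.Exports.

Local Open Scope classical_set_scope.
Local Open Scope ring_scope.

Local Open Scope nat_scope.

(** * Coherent arrays as strict total orders *)

(** Orders on [nat] make a relabeling a mere precomposition, valid at all levels at once. The
    obstacle is that uniformity is given at each level separately, while [rho] depends on infinitely
    many levels. Two devices remove it. [rho] is defined at every outcome, as an upper limit of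
    quantities read from rec, so a relabeling that preserves rec from some level on preserves [rho]
    exactly and without exceptional null sets. And on the event that level n shows a given
    permutation, the relabelled array is compared with the original one on the cylinders of all
    later levels, where uniformity applies to single permutations.

    A plain transposition of neighbours can create or destroy records. It is therefore performed
    only in the orders where the two items are separated. As this test is symmetric in them, the
    restricted exchange is still an involution of each symmetric group, and sums over permutations
    can be reindexed by it. *)

Definition strict_total (L : rel nat) : Prop :=
  [/\ irreflexive L, transitive L & forall i j, i != j -> L i j || L j i].

Definition array_of (L : rel nat) : perm_array :=
  fun n => ranking_perm (fun i j : 'I_n => L i j).

Definition rank (L : rel nat) (n j : nat) : nat := count (L^~ j) (iota 0 n).

Lemma card_ord_count n (P : pred nat) : #|[pred i : 'I_n | P i]| = count P (iota 0 n).
Proof. by rewrite -val_enum_ord count_map cardE enumT size_filter. Qed.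

(** Counts of smaller elements increase strictly along [lt], so they are injective and form a
    permutation; hence the [pick] in [ranking_perm] succeeds and its default is not reached. *)
Lemma ranking_permE n (lt : rel 'I_n) :
  irreflexive lt -> transitive lt -> (forall i j, i != j -> lt i j || lt j i) ->
  forall j, ranking_perm lt j = #|[pred i | lt i j]| :> nat.
Proof.
move=> irr tr tot j.
pose rk j := #|[pred i : 'I_n | lt i j]|.
have rk_lt k : rk k < n.
  rewrite -[X in _ < X]card_ord; apply: proper_card; apply/properP; split.
    by apply/fintype.subsetP => i.
  by exists k => //; rewrite !inE irr.
have rk_mono i k : lt i k -> rk i < rk k.
  move=> ik; apply: proper_card; apply/properP; split.
    by apply/fintype.subsetP => x; rewrite !inE => /tr; exact.
  by exists i; rewrite !inE ?irr.
have rk_inj : injective (fun k => Ordinal (rk_lt k)).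
  move=> i k /(congr1 val) /= e; apply/eqP; apply: contraT => /tot /orP[] /rk_mono;
  by rewrite e ltnn.
rewrite /ranking_perm; case: pickP => [s /forallP /(_ j) /eqP //|/(_ (perm rk_inj))].
by move=> /forallP h; exfalso; apply: h => k; rewrite permE.
Qed.

Section StrictTotal.
Variable L : rel nat.
Hypothesis stL : strict_total L.

Lemma strict_total_irr : irreflexive L. Proof. by case: stL. Qed.

Lemma strict_total_trans : transitive L. Proof. by case: stL. Qed.

Lemma strict_totalP i j : [\/ i = j, L i j | L j i].
Proof.
case: stL => _ _ tot; have [->|/tot /orP[]] := eqVneq i j.
- by apply: Or31.
- by move=> ?; apply: Or32.
- by move=> ?; apply: Or33.
Qed.

Lemma strict_totalN i j : i != j -> L j i = ~~ L i j.
Proof.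
move=> ij; have [/eqP e| h | h] := strict_totalP i j; first by rewrite e in ij.
  by rewrite h; apply/negbTE/negP => h'; move: (strict_total_trans h h'); rewrite strict_total_irr.
by rewrite h; symmetry; apply/negP => h'; move: (strict_total_trans h h'); rewrite strict_total_irr.
Qed.

Lemma strict_total_asym i j : L i j -> L j i = false.
Proof.
move=> h; apply/negP => h'; move: (strict_total_trans h h'); by rewrite strict_total_irr.
Qed.

Lemma ltn_rank n i j : i < n -> L i j -> rank L n i < rank L n j.
Proof.
move=> ltin ij; rewrite /rank -!size_filter.
have lin : i \in iota 0 n by rewrite mem_iota.
have -> : size [seq x <- iota 0 n | L x j] =
   count (L^~ i) [seq x <- iota 0 n | L x j] + count (predC (L^~ i)) [seq x <- iota 0 n | L x j].
  by rewrite count_predC.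
have -> : count (L^~ i) [seq x <- iota 0 n | L x j] = size [seq x <- iota 0 n | L x i].
  rewrite -size_filter -filter_predI; congr size; apply: eq_filter => x /=.
  by case h : (L x i) => //=; rewrite (strict_total_trans h ij).
rewrite -[X in X < _]addn0 ltn_add2l -has_count; apply/hasP; exists i => /=.
  by rewrite mem_filter ij.
by rewrite strict_total_irr.
Qed.

Lemma ltn_rankE n i j : i < n -> j < n -> (rank L n i < rank L n j) = L i j.
Proof.
move=> ilt jlt; have [->| h | h] := strict_totalP i j.
- by rewrite ltnn strict_total_irr.
- by rewrite h ltn_rank.
- by rewrite (strict_total_asym h) ltnNge ltnW // ltn_rank.
Qed.

Lemma rank_inj n : {in [pred i | i < n] &, injective (rank L n)}.
Proof.
move=> i j; rewrite !inE => ilt jlt e; have [//| h | h] := strict_totalP i j.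
  by have := ltn_rank ilt h; rewrite e ltnn.
by have := ltn_rank jlt h; rewrite e ltnn.
Qed.

Lemma rank_lt n i : i < n -> rank L n i < n.
Proof.
move=> ilt; rewrite -[X in _ < X](size_iota 0 n) -(count_predC (L^~ i) (iota 0 n)).
rewrite /rank -[X in X < _]addn0 ltn_add2l -has_count; apply/hasP.
by exists i; rewrite ?mem_iota //= strict_total_irr.
Qed.

Lemma strict_total_restr n :
  [/\ irreflexive (fun i j : 'I_n => L i j), transitive (fun i j : 'I_n => L i j)
    & forall i j : 'I_n, i != j -> L i j || L j i].
Proof.
split=> [i|i j k|i j ij]; [exact: strict_total_irr|exact: strict_total_trans|].
by case: stL => _ _; apply; apply: contra ij => /eqP /val_inj ->.
Qed.

Lemma array_ofE n (j : 'I_n) : array_of L n j = rank L n j :> nat.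
Proof.
have [irr tr tot] := strict_total_restr n.
by rewrite ranking_permE // (card_ord_count n (L^~ j)).
Qed.

Lemma ltn_array_of n (i j : 'I_n) : (array_of L n i < array_of L n j) = L i j.
Proof. by rewrite !array_ofE ltn_rankE. Qed.

End StrictTotal.

Lemma card_perm_lt n (s : 'S_n) j : #|[pred i | s i < s j]| = s j :> nat.
Proof.
rewrite -(fintype.card_image (@perm_inj _ s)).
have -> : #|[seq s x | x in [pred i | s i < s j]]| = #|[pred i : 'I_n | i < s j]|.
  apply: eq_card => i; apply/fintype.imageP/idP => [[k] + ->|]; first by rewrite !inE.
  by rewrite !inE => h; exists ((s^-1)%g i); rewrite ?inE permKV.
rewrite (card_ord_count n (fun i => i < s j)).
have le : s j <= n by exact: ltnW.
rewrite -[n in iota 0 n](subnKC le) iotaD count_cat add0n.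
rewrite (_ : count _ (iota 0 _) = s j).
  rewrite (_ : count _ _ = 0) ?addn0 //; apply/eqP; rewrite -leqn0 leqNgt -has_count.
  by apply/hasPn => i; rewrite mem_iota -leqNgt => /andP[].
rewrite -[RHS](size_iota 0); apply/eqP; rewrite -all_count; apply/allP => i.
by rewrite mem_iota.
Qed.

Lemma perm_ltn_inj n (s s' : 'S_n) :
  (forall i j, (s i < s j) = (s' i < s' j)) -> s = s'.
Proof.
move=> h; apply/permP => j; apply: val_inj => /=.
by rewrite -(card_perm_lt s) -(card_perm_lt s'); apply: eq_card => i; rewrite !inE h.
Qed.

Lemma perm_lt_strict n (s : 'S_n) :
  [/\ irreflexive (fun i j => s i < s j), transitive (fun i j => s i < s j)
    & forall i j, i != j -> (s i < s j) || (s j < s i)].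
Proof.
split=> [i|i j k|i j ij]; [exact: ltnn|exact: ltn_trans|].
by rewrite -neq_ltn; apply: contra ij => /eqP/val_inj/perm_inj ->.
Qed.

Lemma array_of_coherent L : strict_total L -> coherent (array_of L).
Proof.
move=> stL m n lemn; rewrite /array_of; congr ranking_perm.
by apply/funext => i; apply/funext => j; rewrite ltn_array_of.
Qed.

Lemma array_of_eq L L' n : strict_total L -> strict_total L' ->
  (array_of L n = array_of L' n) <-> (forall i j, i < n -> j < n -> L i j = L' i j).
Proof.
move=> stL stL'; split => [e i j ilt jlt|h].
  by rewrite -(ltn_array_of stL (Ordinal ilt) (Ordinal jlt)) e ltn_array_of.
by apply: perm_ltn_inj => i j; rewrite !ltn_array_of // h.
Qed.

(** The level [(maxn i j).+1] is the first one that contains both items; for a coherent array every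
    later level compares them in the same way ([array_orderE]). *)
Definition array_order (p : perm_array) : rel nat := fun i j =>
  p (maxn i j).+1 (inord i) < p (maxn i j).+1 (inord j).

Section OrdOf.
Variable p : perm_array.
Hypothesis cp : coherent p.

Lemma array_orderE n (i j : 'I_n) : array_order p i j = (p n i < p n j).
Proof.
rewrite /array_order; set m := (maxn i j).
have lemn : m.+1 <= n by rewrite gtn_max !ltn_ord.
rewrite (cp lemn); set lt := fun _ _ => _.
have wi : widen_ord lemn (inord i) = i.
  by apply: val_inj; rewrite /= inordK // ltnS leq_maxl.
have wj : widen_ord lemn (inord j) = j.
  by apply: val_inj; rewrite /= inordK // ltnS leq_maxr.
have [irr tr tot] : [/\ irreflexive lt, transitive lt & forall a b, a != b -> lt a b || lt b a].
  have [irr tr tot] := perm_lt_strict (p n); split => [a|a b c|a b ab].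
  - exact: irr.
  - exact: tr.
  - by apply: tot; apply: contra ab => /eqP /(congr1 val) /= /val_inj ->.
have key a b : (ranking_perm lt a < ranking_perm lt b) = lt a b.
  have mono c e : lt c e -> ranking_perm lt c < ranking_perm lt e.
    move=> h; rewrite !ranking_permE //; apply: proper_card; apply/properP; split.
      by apply/fintype.subsetP => x; rewrite !inE => /tr; exact.
    by exists c; rewrite !inE ?irr.
  have [->|/tot /orP[h|h]] := eqVneq a b; first by rewrite irr ltnn.
    by rewrite h mono.
  rewrite ltnNge ltnW ?mono //; symmetry; apply/negP => h'.
  by have := tr _ _ _ h h'; rewrite irr.
by rewrite key /lt wi wj.
Qed.

Lemma array_order_strict_total : strict_total (array_order p).
Proof.
split=> [i|j i k|i j ij].
- exact: ltnn.
- pose n := (maxn i (maxn j k)).+1.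
  have li : i < n by rewrite ltnS leq_maxl.
  have lj : j < n by rewrite ltnS leq_max leq_maxl orbT.
  have lk : k < n by rewrite ltnS !leq_max leqnn !orbT.
  rewrite (array_orderE (Ordinal li) (Ordinal lj)) (array_orderE (Ordinal lj) (Ordinal lk)).
  by rewrite (array_orderE (Ordinal li) (Ordinal lk)); exact: ltn_trans.
- pose n := (maxn i j).+1.
  have li : i < n by rewrite ltnS leq_maxl.
  have lj : j < n by rewrite ltnS leq_maxr.
  rewrite (array_orderE (Ordinal li) (Ordinal lj)) (array_orderE (Ordinal lj) (Ordinal li)).
  have [_ _ tot] := perm_lt_strict (p n); apply: tot.
  by apply: contra ij => /eqP [->].
Qed.

Lemma array_orderK : array_of (array_order p) = p.
Proof.
apply: functional_extensionality_dep => n; apply: perm_ltn_inj => i j.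
by rewrite (ltn_array_of array_order_strict_total) array_orderE.
Qed.

End OrdOf.

(* The items from n on are put above all others, in their natural order. *)
Definition perm_order n (s : 'S_n) : rel nat := fun i j =>
  match insub i, insub j with
  | Some i', Some j' => s i' < s j'
  | _, _ => i < j
  end.

Lemma perm_orderE n (s : 'S_n) (i j : 'I_n) : perm_order s i j = (s i < s j).
Proof. by rewrite /perm_order !insubT //= => ? ?; congr (_ < _); congr (_ (s _)); apply: val_inj. Qed.

Lemma perm_order_strict_total n (s : 'S_n) : strict_total (perm_order s).
Proof.
have inS k : n <= k -> insub k = None :> option 'I_n by move=> h; rewrite insubF // ltnNge h.
have inO k (h : k < n) : insub k = Some (Ordinal h) by rewrite insubT.
split=> [i|j i k|i j ij]; rewrite /perm_order.
- by case: insub => [a|]; rewrite ltnn.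
- have [hi|hi] := ltnP i n; have [hj|hj] := ltnP j n; have [hk|hk] := ltnP k n;
  rewrite ?(inO _ hi) ?(inO _ hj) ?(inO _ hk) ?(inS _ hi) ?(inS _ hj) ?(inS _ hk).
  all: try exact: ltn_trans.
  + by move=> _ _; apply: leq_trans hi hk.
  + by move=> _ /(leq_ltn_trans hj); rewrite ltnNge ltnW.
  + by move=> /(leq_ltn_trans hi); rewrite ltnNge ltnW.
- have [hi|hi] := ltnP i n; have [hj|hj] := ltnP j n;
  rewrite ?(inO _ hi) ?(inO _ hj) ?(inS _ hi) ?(inS _ hj) -?neq_ltn //.
  by apply: contra ij => /eqP/val_inj/perm_inj[->].
Qed.

Lemma perm_orderK n (s : 'S_n) : array_of (perm_order s) n = s.
Proof.
by apply: perm_ltn_inj => i j; rewrite (ltn_array_of (perm_order_strict_total s)) perm_orderE.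
Qed.

Lemma array_of_orderK L n i j : strict_total L -> i < n -> j < n ->
  perm_order (array_of L n) i j = L i j.
Proof.
by move=> stL hi hj; rewrite (perm_orderE (array_of L n) (Ordinal hi) (Ordinal hj)) ltn_array_of.
Qed.

(** * Records and relabelings *)

Definition is_up (L : rel nat) (j : nat) : bool := all (L^~ j) (iota 0 j).
Definition is_dn (L : rel nat) (j : nat) : bool := all (L j) (iota 0 j).
Definition is_rec (L : rel nat) (j : nat) : bool := is_up L j || is_dn L j.
Definition nup (L : rel nat) (n : nat) : nat := count (is_up L) (iota 1 n).
Definition ndn (L : rel nat) (n : nat) : nat := count (is_dn L) (iota 1 n).

(* Items are numbered from 0, so [recs L n] lists the records among items
   0, ..., n; its center, item 0, has index [ndn L n]. *)
Fixpoint recs (L : rel nat) (n : nat) : seq nat :=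
  if n is m.+1 then
    if is_up L n then rcons (recs L m) n
    else if is_dn L n then n :: recs L m else recs L m
  else [:: 0].

Lemma is_upP (L : rel nat) j : reflect (forall i, i < j -> L i j) (is_up L j).
Proof.
apply: (iffP allP) => h i; last by rewrite mem_iota => /h.
by move=> ij; apply: h; rewrite mem_iota.
Qed.

Lemma is_dnP (L : rel nat) j : reflect (forall i, i < j -> L j i) (is_dn L j).
Proof.
apply: (iffP allP) => h i; last by rewrite mem_iota => /h.
by move=> ij; apply: h; rewrite mem_iota.
Qed.

Section Records.
Variable L : rel nat.
Hypothesis stL : strict_total L.

Lemma upper_recordE n (j : 'I_n) : upper_record (array_of L n) j = is_up L j.
Proof.
apply/forallP/is_upP => [h i ij|h i].
  have := h (Ordinal (ltn_trans ij (ltn_ord j))).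
  rewrite /= (ltnW ij) /= !(array_ofE stL) /= leqNgt ltn_rankE // ?(ltn_trans ij) //.
  by rewrite (strict_totalN stL) ?negbK // neq_ltn ij.
apply/implyP; rewrite leq_eqVlt => /orP[/eqP/val_inj -> //|/h ij].
by rewrite ltnW // ltn_array_of.
Qed.

Lemma lower_recordE n (j : 'I_n) : lower_record (array_of L n) j = is_dn L j.
Proof.
apply/forallP/is_dnP => [h i ij|h i].
  have := h (Ordinal (ltn_trans ij (ltn_ord j))).
  rewrite /= (ltnW ij) /= !(array_ofE stL) /= leqNgt ltn_rankE // ?(ltn_trans ij) //.
  by rewrite (strict_totalN stL) ?negbK // neq_ltn ij orbT.
apply/implyP; rewrite leq_eqVlt => /orP[/eqP/val_inj -> //|/h ij].
by rewrite ltnW // ltn_array_of.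
Qed.

Lemma record_valuesE n : record_values (array_of L n) =
  sort leq [seq (rank L n j).+1 | j <- iota 0 n & is_rec L j].
Proof.
rewrite /record_values; congr sort.
rewrite -val_enum_ord filter_map -map_comp.
under eq_filter => j do rewrite lower_recordE upper_recordE orbC.
by apply: eq_map => j /=; rewrite array_ofE.
Qed.

Lemma card_pos_ord n (P : pred nat) :
  #|[pred j : 'I_n | (0 < j) && P j]| = count P (iota 1 n.-1).
Proof.
rewrite (card_ord_count n (fun j => (0 < j) && P j)).
case: n => [//|n] /=; rewrite add0n; apply: eq_in_count => i.
by rewrite mem_iota => /andP[->].
Qed.

Lemma num_lowerE n : num_lower (array_of L n) = ndn L n.-1.
Proof.
rewrite /ndn -card_pos_ord; apply: eq_card => j.
by rewrite !inE lower_recordE.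
Qed.

Lemma num_upperE n : num_upper (array_of L n) = nup L n.-1.
Proof.
rewrite /nup -card_pos_ord; apply: eq_card => j.
by rewrite !inE upper_recordE.
Qed.

Lemma mem_recs n j : (j \in recs L n) = (j <= n) && is_rec L j.
Proof.
elim: n j => [|n IH] j; first by rewrite inE leqn0; case: j.
rewrite /=; have [->|jn] := eqVneq j n.+1.
  rewrite leqnn /= /is_rec; have nin : n.+1 \in recs L n = false by rewrite IH ltnn.
  by case: is_up; case: is_dn; rewrite ?mem_rcons ?in_cons ?eqxx ?nin //=.
have -> : (j <= n.+1) = (j <= n) by rewrite leq_eqVlt (negbTE jn) /= ltnS.
case: ifP => _; [|case: ifP => _]; rewrite ?mem_rcons ?in_cons ?(negbTE jn) ?orFb;
  by rewrite IH.
Qed.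

Lemma recs_pairwise n : pairwise L (recs L n).
Proof.
elim: n => [//|n IH] /=.
have lt j : j \in recs L n -> j < n.+1 by rewrite mem_recs => /andP[].
case: is_upP => [h|_]; first by rewrite pairwise_rcons IH andbT; apply/allP => j /lt /h.
case: is_dnP => [h|//]; rewrite pairwise_cons IH andbT; apply/allP => j /lt /h //.
Qed.

Lemma recs_uniq n : uniq (recs L n).
Proof. by apply: (pairwise_uniq (strict_total_irr stL)); exact: recs_pairwise. Qed.

Lemma is_dn_up n : is_up L n.+1 -> is_dn L n.+1 = false.
Proof.
move=> /is_upP /(_ 0 isT) h; apply/is_dnP => /(_ 0 isT).
by rewrite (strict_total_asym stL h).
Qed.

Lemma iotaSr m n : iota m n.+1 = rcons (iota m n) (m + n).
Proof. by rewrite -addn1 iotaD cats1. Qed.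

Lemma ndnS n : ndn L n.+1 = ndn L n + is_dn L n.+1.
Proof. by rewrite /ndn iotaSr -cats1 count_cat /= addn0. Qed.

Lemma nupS n : nup L n.+1 = nup L n + is_up L n.+1.
Proof. by rewrite /nup iotaSr -cats1 count_cat /= addn0. Qed.

Lemma size_recs n : size (recs L n) = (ndn L n + nup L n).+1.
Proof.
elim: n => [//|n IH]; rewrite ndnS nupS /=.
case h : is_up; first by rewrite is_dn_up // size_rcons IH addn0 addn1 addnS.
by case: is_dn => /=; rewrite IH ?addn0 // addn1.
Qed.

Lemma perm_recs n : perm_eq (recs L n) [seq j <- iota 0 n.+1 | is_rec L j].
Proof.
apply: uniq_perm; rewrite ?recs_uniq ?filter_uniq ?iota_uniq // => j.
by rewrite mem_recs mem_filter mem_iota ltnS /= andbC.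
Qed.

Lemma record_values_recs n : record_values (array_of L n.+1) =
  [seq (rank L n.+1 j).+1 | j <- recs L n].
Proof.
rewrite record_valuesE.
apply: (sorted_eq leq_trans anti_leq).
- exact: sort_sorted leq_total _.
- apply: pairwise_sorted; rewrite pairwise_map.
  apply: (sub_in_pairwise (P := [pred j | j < n.+1]) (r := L)); last exact: recs_pairwise.
    by move=> i j ilt jlt ij; rewrite /= ltnS ltnW // ltn_rank.
  by apply/allP => j; rewrite mem_recs => /andP[].
- by rewrite perm_sort perm_sym; apply: perm_map; exact: perm_recs.
Qed.

Lemma recE n : rec (array_of L n.+1) =
  ([seq (rank L n.+1 j).+1 | j <- recs L n], ndn L n).
Proof. by rewrite /rec record_values_recs num_lowerE. Qed.

Lemma recs_cat n m : n <= m -> exists s1 s2,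
  [/\ recs L m = s1 ++ recs L n ++ s2, ndn L m = size s1 + ndn L n
    & nup L m = nup L n + size s2].
Proof.
elim: m => [|m IH].
  by rewrite leqn0 => /eqP ->; exists [::], [::]; rewrite cats0 addn0.
rewrite leq_eqVlt => /orP[/eqP ->|].
  by exists [::], [::]; rewrite cats0 addn0.
rewrite ltnS => /IH [s1] [s2] [e el eu]; rewrite ndnS nupS /= e el eu.
case h : is_up.
  exists s1, (rcons s2 m.+1); rewrite is_dn_up // size_rcons addn0 addnS addn1.
  by rewrite -!cats1 -!catA.
case: is_dn; last by exists s1, s2; rewrite !addn0.
by exists (m.+1 :: s1), s2; rewrite /= addn0 addn1.
Qed.

(* The gap of item i among the records of items 0, ..., n: gap 0 is below all of
   them, gap [(ndn L n + nup L n).+1] above all of them. *)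
Definition typ n i := count (L^~ i) (recs L n).

(** In a list increasing for [L], the elements below an outside item [i] form a prefix, so their
    number is the position at which [i] cuts the list. *)
Lemma pairwise_count s i a : pairwise L s -> a < size s ->
  i \notin s -> (a < count (L^~ i) s) = L (nth 0 s a) i.
Proof.
elim: s a => [//|x s IH] a /= /andP[/allP xs ps] alt; rewrite inE negb_or => /andP[ix is_].
case: a alt => [|a] alt /=.
  rewrite addn_gt0 lt0b; case h : (L x i) => //=; rewrite -has_count; apply/negP.
  move=> /hasP[y /xs xy yi]; move: h; by rewrite (strict_total_trans stL xy yi).
case h : (L x i); first by rewrite add1n ltnS IH.
rewrite add0n -IH //; have -> : count (L^~ i) s = 0; last by rewrite !ltn0.
apply/eqP; rewrite -leqn0 leqNgt -has_count; apply/negP.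
by move=> /hasP[y /xs xy yi]; move: h; rewrite (strict_total_trans stL xy yi).
Qed.

Lemma ltn_typ n i a : n < i -> a < size (recs L n) ->
  (a < typ n i) = L (nth 0 (recs L n) a) i.
Proof.
move=> ni alt; rewrite /typ pairwise_count ?recs_pairwise //.
by rewrite mem_recs leqNgt ni.
Qed.

Lemma typ_le n i : typ n i <= (ndn L n + nup L n).+1.
Proof. by rewrite -size_recs /typ count_size. Qed.

Lemma recs_above n i : i <= n -> L (head 0 (recs L n)) i || (i == head 0 (recs L n)).
Proof.
elim: n i => [|n IH] i; first by rewrite leqn0 => /eqP ->; rewrite eqxx orbT.
rewrite leq_eqVlt ltnS => /orP[/eqP ->|le] /=.
  have h0 : head 0 (recs L n) < n.+1.
    have : nth 0 (recs L n) 0 \in recs L n by rewrite mem_nth ?size_recs.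
    by rewrite nth0 mem_recs => /andP[].
  case: is_upP => [h|hu].
    by have := size_recs n; move: (h _ h0); case: (recs L n) => //= a s ->.
  case: is_dnP => [h|hd] /=; first by rewrite eqxx orbT.
  have [e|h|h] := strict_totalP stL n.+1 (head 0 (recs L n)).
  - by rewrite -e eqxx orbT.
  - exfalso; apply: hd => j jn; have /orP[|/eqP ->//] := IH _ jn.
    exact: (strict_total_trans stL).
  - by rewrite h.
case: is_upP => [h|hu]; first by have := IH _ le; case: (recs L n) (size_recs n).
case: is_dnP => [h|hd] /=; last exact: IH.
by rewrite h.
Qed.

Lemma recs_below n i : i <= n -> L i (last 0 (recs L n)) || (i == last 0 (recs L n)).
Proof.
elim: n i => [|n IH] i; first by rewrite leqn0 => /eqP ->; rewrite eqxx orbT.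
have h0 : last 0 (recs L n) < n.+1.
  have : nth 0 (recs L n) (size (recs L n)).-1 \in recs L n by rewrite mem_nth ?size_recs.
  by rewrite nth_last mem_recs => /andP[].
rewrite leq_eqVlt ltnS => /orP[/eqP ->|le] /=.
  case: is_upP => [h|hu]; first by rewrite last_rcons eqxx orbT.
  case: is_dnP => [h|hd].
    by have := size_recs n; move: (h _ h0); case: (recs L n) => //= a s ->.
  have [e|h|h] := strict_totalP stL n.+1 (last 0 (recs L n)).
  - by rewrite -e eqxx orbT.
  - by rewrite h.
  - exfalso; apply: hu => j jn; have /orP[|/eqP ->//] := IH _ jn.
    by move=> h1; exact: (strict_total_trans stL h1 h).
case: is_upP => [h|hu]; first by rewrite last_rcons h.
case: is_dnP => [h|hd] /=; last exact: IH.
by have := size_recs n; have := IH _ le; case: (recs L n) => //.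
Qed.

(** The first record in the list is the minimum of all earlier items. With [is_up_typ], the gap of a
    new item decides whether it is a record; this lets the sequence of gaps determine the records by
    induction. *)
Lemma is_dn_typ n : is_dn L n.+1 = (typ n n.+1 == 0).
Proof.
have sz : 0 < size (recs L n) by rewrite size_recs.
have h0 : nth 0 (recs L n) 0 < n.+1.
  by have := mem_nth 0 sz; rewrite mem_recs => /andP[].
rewrite -leqn0 leqNgt ltn_typ // -(strict_totalN stL) ?neq_ltn ?h0 //.
apply/is_dnP/idP => [h|h i lei]; first exact: h.
move: h; rewrite nth0 => h; have /orP[h1|/eqP ->//] := @recs_above n i lei.
exact: (strict_total_trans stL h h1).
Qed.

Lemma is_up_typ n : is_up L n.+1 = (typ n n.+1 == (ndn L n + nup L n).+1).
Proof.
have sz : 0 < size (recs L n) by rewrite size_recs.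
rewrite eqn_leq typ_le -size_recs /=.
have e : size (recs L n) = (size (recs L n)).-1.+1 by rewrite prednK.
rewrite [in RHS]e ltn_typ // ?prednK // nth_last.
apply/is_upP/idP => [h|h i lei].
  have : nth 0 (recs L n) (size (recs L n)).-1 \in recs L n by rewrite mem_nth // ltn_predL.
  by rewrite nth_last mem_recs => /andP[lei _]; exact: h.
have /orP[h1|/eqP ->//] := @recs_below n i lei.
exact: (strict_total_trans stL h1 h).
Qed.

End Records.

(** * Relabelings of finitely many items and their effect on rec *)

Section Perm.
Variables (L : rel nat) (f : nat -> nat) (n : nat).
Hypothesis stL : strict_total L.
Hypothesis f_inj : injective f.
Hypothesis f_lt : forall k, k < n -> f k < n.
Hypothesis f_id : forall k, n <= k -> f k = k.

Definition relabel : rel nat := fun i j => L (f i) (f j).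

Lemma relabel_strict_total : strict_total relabel.
Proof.
case: stL => irr tr tot; split=> [i|j i k|i j ij]; [exact: irr|exact: tr|].
by apply: tot; apply: contra ij => /eqP /f_inj ->.
Qed.

Lemma relabel_perm m : n <= m -> perm_eq (map f (iota 0 m)) (iota 0 m).
Proof.
move=> nm; apply: uniq_perm; rewrite ?(map_inj_uniq f_inj) ?iota_uniq //.
have sub : {subset map f (iota 0 m) <= iota 0 m}.
  move=> _ /mapP[k + ->]; rewrite !mem_iota /= !add0n => km.
  have [/f_lt h|/f_id -> //] := ltnP k n; exact: leq_trans nm.
have u : uniq (map f (iota 0 m)) by rewrite (map_inj_uniq f_inj) iota_uniq.
have le : size (iota 0 m) <= size (map f (iota 0 m)) by rewrite size_map.
by have [_ e] := uniq_min_size u sub le; move=> k; rewrite e.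
Qed.

Lemma relabel_rank m j : n <= m -> rank relabel m j = rank L m (f j).
Proof.
move=> nm; rewrite /rank /relabel.
by rewrite -[RHS](seq.permP (relabel_perm nm)) count_map.
Qed.

Lemma relabel_up k : n <= k -> is_up relabel k = is_up L k.
Proof.
move=> nk; rewrite /is_up /relabel -[RHS](perm_all _ (relabel_perm nk)) all_map.
by apply: eq_all => i /=; rewrite (f_id nk).
Qed.

Lemma relabel_dn k : n <= k -> is_dn relabel k = is_dn L k.
Proof.
move=> nk; rewrite /is_dn /relabel -[RHS](perm_all _ (relabel_perm nk)) all_map.
by apply: eq_all => i /=; rewrite (f_id nk).
Qed.

(** Ranks at level [m] travel with the items ([relabel_rank]). If [f] carries records to records,
    the two lists of record values agree up to order, and sorting makes them equal; the center is
    fixed by the count of lower records among the first [n] items. *)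
Lemma relabel_rec m : n <= m ->
  (forall k, k < n -> is_rec relabel k = is_rec L (f k)) ->
  count (is_dn relabel) (iota 0 n) = count (is_dn L) (iota 0 n) ->
  rec (array_of relabel m) = rec (array_of L m).
Proof.
move=> nm hrec hdn; have stL' := relabel_strict_total.
rewrite /rec !record_valuesE // !num_lowerE //; congr pair.
  apply/(perm_sortP leq_total leq_trans anti_leq).
  have hrec' k : is_rec relabel k = is_rec L (f k).
    have [/hrec //|h] := ltnP k n.
    by rewrite /is_rec relabel_up // relabel_dn // f_id.
  apply: (@perm_trans _ [seq (rank L m j).+1 | j <- [seq f j | j <- iota 0 m] & is_rec L j]).
    rewrite filter_map -map_comp.
    rewrite (@eq_filter _ (preim f (is_rec L)) (is_rec relabel)).
      by apply/seq.permP => P; congr count; apply: eq_map => j /=; rewrite relabel_rank.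
    by move=> k; rewrite /= hrec'.
  by apply: perm_map; apply: perm_filter; exact: relabel_perm.
have aux L0 : count (is_dn L0) (iota 0 m) = (0 < m) + ndn L0 m.-1.
  by rewrite /ndn; case: (m).
apply/eqP; rewrite -(eqn_add2l (0 < m)) -!aux -(subnKC nm) !iotaD !count_cat hdn.
rewrite eqn_add2l; apply/eqP; apply: eq_in_count => k; rewrite mem_iota => /andP[h _].
exact: relabel_dn.
Qed.

End Perm.

Definition lift_nat n (t : 'S_n) (k : nat) : nat :=
  if insub k is Some k' then t k' : nat else k.

Section LiftNat.
Variables (n : nat) (t : 'S_n).

Lemma lift_nat_ord (k : 'I_n) : lift_nat t k = t k.
Proof. by rewrite /lift_nat insubT //= => ?; congr (nat_of_ord (t _)); apply: val_inj. Qed.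

Lemma lift_nat_lt k : k < n -> lift_nat t k < n.
Proof. by move=> h; rewrite (lift_nat_ord (Ordinal h)). Qed.

Lemma lift_nat_id k : n <= k -> lift_nat t k = k.
Proof. by move=> h; rewrite /lift_nat insubF // ltnNge h. Qed.

Lemma lift_nat_inj : injective (lift_nat t).
Proof.
move=> i j; have [hi|hi] := ltnP i n; have [hj|hj] := ltnP j n.
- rewrite (lift_nat_ord (Ordinal hi)) (lift_nat_ord (Ordinal hj)).
  by move=> /val_inj/perm_inj[].
- by rewrite [in RHS]lift_nat_id // => e; have := lift_nat_lt hi; rewrite e ltnNge hj.
- by rewrite lift_nat_id // => e; have := lift_nat_lt hj; rewrite -e ltnNge hi.
- by rewrite !lift_nat_id.
Qed.

(** Distinct items have distinct ranks at level [n], so equality of rec there says that the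
    relabeling carries records to records and keeps the number of lower ones. This is a statement
    about items, and [relabel_rec] turns it into equality of rec at every later level. *)
Lemma relabel_lift_nat_rec L m : strict_total L -> n <= m ->
  rec (array_of (relabel L (lift_nat t)) n) = rec (array_of L n) ->
  rec (array_of (relabel L (lift_nat t)) m) = rec (array_of L m).
Proof.
move=> stL nm; have stL' := relabel_strict_total stL lift_nat_inj.
rewrite {1 2}/rec !record_valuesE // !num_lowerE // => -[/perm_sortP].
move=> /(_ leq_total leq_trans anti_leq)/perm_mem erec edn.
apply: (relabel_rec stL lift_nat_inj lift_nat_lt lift_nat_id nm).
  move=> k kn; set L' := relabel _ _.
  have aux L0 : strict_total L0 -> forall j, j < n ->
      ((rank L0 n j).+1 \in [seq (rank L0 n j).+1 | j <- iota 0 n & is_rec L0 j])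
      = is_rec L0 j.
    move=> st0 j jn; apply/mapP/idP => [[i]|h].
      rewrite mem_filter mem_iota => /andP[ri /andP[_ iltn]] [/(rank_inj st0)].
      by rewrite !inE => ->.
    by exists j => //; rewrite mem_filter h mem_iota.
  rewrite -(aux L' stL' k kn) -(aux L stL (lift_nat t k)) ?lift_nat_lt // erec.
  by rewrite (relabel_rank _ lift_nat_inj lift_nat_lt lift_nat_id).
have aux L0 k : count (is_dn L0) (iota 0 k) = (0 < k) + ndn L0 k.-1 by case: k.
by rewrite !aux edn.
Qed.

End LiftNat.

Definition swap_nat (i k : nat) : nat :=
  if k == i then i.+1 else if k == i.+1 then i else k.

Lemma swap_natK i : involutive (swap_nat i).
Proof.
move=> k; rewrite /swap_nat; have [->|ki] := eqVneq k i.
  by rewrite eqxx (gtn_eqF (ltnSn i)).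
by have [->|ki'] := eqVneq k i.+1; rewrite ?eqxx // (negbTE ki) (negbTE ki').
Qed.

Lemma swap_nat_inj i : injective (swap_nat i).
Proof. exact: inv_inj (swap_natK i). Qed.

Lemma swap_nat_lt i k : k < i.+2 -> swap_nat i k < i.+2.
Proof. by rewrite /swap_nat; case: ifP => // _; case: ifP. Qed.

Lemma swap_nat_id i k : i.+2 <= k -> swap_nat i k = k.
Proof. by move=> h; rewrite /swap_nat !gtn_eqF // ltnW. Qed.

Lemma swap_nat_small i k : k < i -> swap_nat i k = k.
Proof. by move=> h; rewrite /swap_nat !ltn_eqF // ltnW. Qed.

Lemma swap_nati i : swap_nat i i = i.+1.
Proof. by rewrite /swap_nat eqxx. Qed.

Lemma swap_natS i : swap_nat i i.+1 = i.
Proof. by rewrite -[in LHS]swap_nati swap_natK. Qed.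

(** If one of the two neighbours is an upper record, it lies above [j], so the other lies below [j]
    and comparison with it comes for free; likewise for lower records. Hence both can be tested
    against the items before [i] alone, and the exchange carries records to records. *)
Lemma relabel_swap_rec L i j m : strict_total L -> j < i ->
  L i j != L i.+1 j -> i.+2 <= m ->
  rec (array_of (relabel L (swap_nat i)) m) = rec (array_of L m).
Proof.
move=> stL ji; set L' := relabel _ _ => sep im.
have up k : k < i.+2 -> is_up L' k = is_up L (swap_nat i k).
  rewrite !ltnS leq_eqVlt => /orP[/eqP ->|].
    rewrite swap_natS.
    apply/is_upP/is_upP => h l.
      move=> ki; have := h _ (ltnW ki); by rewrite /L' /relabel swap_natS swap_nat_small.
    rewrite ltnS leq_eqVlt => /orP[/eqP ->|li]; rewrite /L' /relabel swap_natS ?swap_nati.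
      move: sep; rewrite (strict_total_asym stL (h _ ji)).
      rewrite eq_sym eqbF_neg negbK => h1.
      exact: (strict_total_trans stL h1 (h _ ji)).
    by rewrite swap_nat_small // h.
  rewrite ltnS leq_eqVlt => /orP[/eqP ->|ki]; last first.
    rewrite swap_nat_small //; apply/is_upP/is_upP => h l lk; have := h _ lk;
    by rewrite /L' /relabel !swap_nat_small // (ltn_trans lk ki).
  rewrite swap_nati; apply/is_upP/is_upP => h l.
    have h' k' : k' < i -> L k' i.+1.
      by move=> li; have := h _ li; rewrite /L' /relabel swap_nati swap_nat_small.
    rewrite ltnS leq_eqVlt => /orP[/eqP ->|/h' //].
    move: sep; rewrite (strict_total_asym stL (h' _ ji)) eqbF_neg negbK => h1.
    exact: (strict_total_trans stL h1 (h' _ ji)).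
  move=> ki; have := h _ (ltnW ki); by rewrite /L' /relabel swap_nati swap_nat_small.
have dn k : k < i.+2 -> is_dn L' k = is_dn L (swap_nat i k).
  rewrite !ltnS leq_eqVlt => /orP[/eqP ->|].
    rewrite swap_natS.
    apply/is_dnP/is_dnP => h l.
      move=> ki; have := h _ (ltnW ki); by rewrite /L' /relabel swap_natS swap_nat_small.
    rewrite ltnS leq_eqVlt => /orP[/eqP ->|li]; rewrite /L' /relabel swap_natS ?swap_nati.
      move: sep; rewrite (h _ ji).
      have ne : i.+1 != j by rewrite gtn_eqF // ltnW.
      rewrite eq_sym eqb_id -(strict_totalN stL ne) => h1.
      exact: (strict_total_trans stL (h _ ji) h1).
    by rewrite swap_nat_small // h.
  rewrite ltnS leq_eqVlt => /orP[/eqP ->|ki]; last first.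
    rewrite swap_nat_small //; apply/is_dnP/is_dnP => h l lk; have := h _ lk;
    by rewrite /L' /relabel !swap_nat_small // (ltn_trans lk ki).
  rewrite swap_nati; apply/is_dnP/is_dnP => h l.
    have h' k' : k' < i -> L i.+1 k'.
      by move=> li; have := h _ li; rewrite /L' /relabel swap_nati swap_nat_small.
    rewrite ltnS leq_eqVlt => /orP[/eqP ->|/h' //].
    move: sep; rewrite (h' _ ji) eqb_id => h1.
    have ne : i != j by rewrite gtn_eqF.
    by apply: (strict_total_trans stL (h' _ ji)); rewrite (strict_totalN stL ne).
  move=> ki; have := h _ (ltnW ki); by rewrite /L' /relabel swap_nati swap_nat_small.
apply: (relabel_rec stL (@swap_nat_inj i) (@swap_nat_lt i) (@swap_nat_id i) im).
  by move=> k ki; rewrite /is_rec up // dn.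
rewrite -[RHS](seq.permP (relabel_perm (@swap_nat_inj i) (@swap_nat_lt i) (@swap_nat_id i) (leqnn _))).
rewrite count_map; apply: eq_in_count => k; rewrite mem_iota => /andP[_ ki].
exact: dn.
Qed.

(** * What the sequence of gaps determines *)

Definition same_typ (L L' : rel nat) (n : nat) : Prop :=
  forall m, m < n -> typ L m m.+1 = typ L' m m.+1.

Section TypStable.
Variable L : rel nat.
Hypothesis stL : strict_total L.

Lemma nrec_typ m : ~~ is_rec L m.+1 -> 0 < typ L m m.+1 < size (recs L m).
Proof.
rewrite /is_rec is_up_typ // is_dn_typ // negb_or => /andP[h1 h2].
by rewrite lt0n h2 ltn_neqAle size_recs // h1 typ_le.
Qed.

(** A non-record lies between two records of its time. New lower records fall below it and new upper
    ones above it, so its gap index only shifts by the number of new lower records. *)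
Lemma typ_shift n m : m < n -> ~~ is_rec L m.+1 ->
  typ L n m.+1 = ndn L n - ndn L m + typ L m m.+1.
Proof.
move=> mn nr; have [s1 [s2 [e el _]]] := recs_cat stL (ltnW mn).
have /andP[h0 h1] := nrec_typ nr.
have := recs_pairwise L n; rewrite e !pairwise_cat !allrel_catr.
move=> /and3P[/andP[a1 _] p1 /and3P[a2 p p2]].
rewrite el addnK /typ e !count_cat.
have -> : count (L^~ m.+1) s1 = size s1.
  apply/eqP; rewrite -all_count; apply/allP => x xs.
  have /hasP[y ys ym] : has (L^~ m.+1) (recs L m) by rewrite has_count.
  by apply: (strict_total_trans stL _ ym); apply: (allrelP a1) => //; rewrite mem_cat ys.
have -> : count (L^~ m.+1) s2 = 0; last by rewrite addn0.
apply/eqP; rewrite -leqn0 leqNgt -has_count; apply/negP => /hasP[y ys ym].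
move: h1; rewrite ltnNge => /negP; apply; rewrite /typ.
have /eqP -> // : count (L^~ m.+1) (recs L m) == size (recs L m).
rewrite -all_count; apply/allP => x xs.
by apply: (strict_total_trans stL _ ym); exact: (allrelP a2).
Qed.

Lemma nth_recs_nrec n i b : i <= n -> ~~ is_rec L i -> b < size (recs L n) ->
  L (nth 0 (recs L n) b) i = (b < typ L n i).
Proof.
move=> ile nr bs; rewrite /typ pairwise_count ?recs_pairwise //.
by rewrite mem_recs // (negbTE nr) andbF.
Qed.

Lemma nth_recs_nth n a b : a < size (recs L n) -> b < size (recs L n) ->
  L (nth 0 (recs L n) a) (nth 0 (recs L n) b) = (a < b).
Proof.
move=> ha hb; have /(pairwiseP 0) p := recs_pairwise L n.
case: (ltngtP a b) => [ab|ba|->]; last exact: strict_total_irr.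
  exact: p.
by apply: strict_total_asym => //; exact: p.
Qed.

End TypStable.

Section Determined.
Variables (L L' : rel nat) (n : nat).
Hypotheses (stL : strict_total L) (stL' : strict_total L').
Hypothesis LL' : same_typ L L' n.

Lemma same_typ_recs m : m <= n ->
  [/\ recs L m = recs L' m, ndn L m = ndn L' m & nup L m = nup L' m].
Proof.
elim: m => [//|m IH mn]; have [e1 e2 e3] := IH (ltnW mn).
have eu : is_up L m.+1 = is_up L' m.+1 by rewrite !is_up_typ // LL' // e2 e3.
have ed : is_dn L m.+1 = is_dn L' m.+1 by rewrite !is_dn_typ // LL'.
by rewrite /= !ndnS !nupS eu ed e1 e2 e3.
Qed.

Lemma same_typ_is_rec i : i <= n -> is_rec L i = is_rec L' i.
Proof.
move=> ile; have [e _ _] := same_typ_recs (leqnn n).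
by have := mem_recs L n i; rewrite e mem_recs ile.
Qed.

Lemma same_typ_nrec i : i <= n -> ~~ is_rec L i -> typ L n i = typ L' n i.
Proof.
case: i => [|m] mn nr //; have nr' : ~~ is_rec L' m.+1 by rewrite -same_typ_is_rec.
have [_ e1 _] := same_typ_recs (leqnn n); have [_ e2 _] := same_typ_recs (ltnW mn).
by rewrite (typ_shift stL mn nr) (typ_shift stL' mn nr') e1 e2 LL'.
Qed.

(** Two records are compared by their positions in [recs], a record and a non-record by the gap of
    the latter; both are functions of the sequence of gaps. *)
Lemma same_typ_rec_l r i : r <= n -> i <= n -> is_rec L r -> L r i = L' r i.
Proof.
move=> rn iln rr; have [e _ _] := same_typ_recs (leqnn n).
have rin : r \in recs L n by rewrite mem_recs rn.
have bs := rin; rewrite -index_mem in bs.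
have er : r = nth 0 (recs L n) (index r (recs L n)) by rewrite nth_index.
have er' : r = nth 0 (recs L' n) (index r (recs L n)) by rewrite -e nth_index.
have [ri|nr] := boolP (is_rec L i); last first.
  rewrite {1}er {2}er' !nth_recs_nrec -?e // -?same_typ_is_rec //.
  by rewrite same_typ_nrec.
have iin : i \in recs L n by rewrite mem_recs iln.
have cs := iin; rewrite -index_mem in cs.
have := @nth_recs_nth L' stL' n (index r (recs L n)) (index i (recs L n)).
rewrite -e !nth_index // => -> //.
by rewrite -(nth_recs_nth stL bs cs) !nth_index.
Qed.

Lemma same_typ_rec_r r i : r <= n -> i <= n -> is_rec L r -> L i r = L' i r.
Proof.
move=> rn iln rr; have [->|ne] := eqVneq i r; first by rewrite !strict_total_irr.
by rewrite (strict_totalN stL (i := r)) 1?eq_sym // (strict_totalN stL' (i := r)) 1?eq_sym // same_typ_rec_l.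
Qed.

(** A record value counts the items below the record, and by [same_typ_rec_r] these are determined
    by the gaps. *)
Lemma same_typ_rec : rec (array_of L n.+1) = rec (array_of L' n.+1).
Proof.
have [e1 e2 _] := same_typ_recs (leqnn n).
rewrite !recE // e2; congr pair; rewrite e1; apply/eq_in_map => r.
rewrite mem_recs // => /andP[rn rr]; congr S.
apply: eq_in_count => i; rewrite mem_iota ltnS => /andP[_ iln].
by rewrite same_typ_rec_r // same_typ_is_rec.
Qed.

(** Items in different gaps are separated by a record, so the gaps leave free only the order of the
    non-records inside a common gap. *)
Lemma same_typ_eq :
  (forall i j, i <= n -> j <= n -> ~~ is_rec L i -> ~~ is_rec L j ->
    typ L n i = typ L n j -> L i j = L' i j) ->
  forall i j, i <= n -> j <= n -> L i j = L' i j.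
Proof.
move=> h i j ilen jlen.
have [ri|ri] := boolP (is_rec L i); first exact: same_typ_rec_l.
have [rj|rj] := boolP (is_rec L j); first exact: same_typ_rec_r.
(* The record of index [typ L0 n i0] is the lowest one above [i0], and it lies below [j0] when the
   gap of [j0] is higher. *)
have aux L0 : strict_total L0 -> forall i0 j0, i0 <= n -> j0 <= n -> ~~ is_rec L0 i0 -> ~~ is_rec L0 j0 ->
   typ L0 n i0 < typ L0 n j0 -> L0 i0 j0.
  move=> st0 i0 j0 hi hj ni nj lt.
  have bs : typ L0 n i0 < size (recs L0 n).
    by rewrite (leq_trans lt) // count_size.
  apply: (@strict_total_trans L0 st0 (nth 0 (recs L0 n) (typ L0 n i0))); last first.
    by rewrite nth_recs_nrec.
  rewrite (@strict_totalN L0 st0 (nth 0 (recs L0 n) (typ L0 n i0))) ?nth_recs_nrec ?ltnn //.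
  apply: contra ni => /eqP <-; have := mem_nth 0 bs.
  by rewrite mem_recs // => /andP[].
have nri : ~~ is_rec L' i by rewrite -same_typ_is_rec.
have nrj : ~~ is_rec L' j by rewrite -same_typ_is_rec.
have ei := same_typ_nrec ilen ri; have ej := same_typ_nrec jlen rj.
case: (ltngtP (typ L n i) (typ L n j)) => [lt|lt|]; last exact: h.
  rewrite (aux L stL i j ilen jlen ri rj lt).
  by rewrite (aux L' stL' i j ilen jlen nri nrj) // -ei -ej.
rewrite (strict_total_asym stL (aux L stL j i jlen ilen rj ri lt)).
by rewrite (strict_total_asym stL' (aux L' stL' j i jlen ilen nrj nri _)) // -ei -ej.
Qed.

End Determined.

(** * Padded record values as ranks of fixed items *)

Section Padded.

Lemma size_record_values n (s : 'S_n.+1) :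
  size (record_values s) = (num_lower s + num_upper s).+1.
Proof.
have stL := perm_order_strict_total s; rewrite -(perm_orderK s).
by rewrite record_values_recs // num_lowerE // num_upperE // size_map size_recs.
Qed.

Lemma padded_rec_eq n (s s' : 'S_n) : rec s = rec s' -> padded_rec s =1 padded_rec s'.
Proof.
case: n s s' => [|n] s s'.
  by move=> _; have -> : s = s' by apply/permP => -[].
move=> [ev el] k; rewrite /padded_rec.
(* The number of upper records is not a component of [rec]; it is recovered from the length of the
   list, which also counts the center and the lower records. *)
have eu : num_upper s = num_upper s'.
  have := size_record_values s; rewrite ev size_record_values el => /eqP.
  by rewrite eqSS eqn_add2l => /eqP.
by rewrite ev el eu.
Qed.

Lemma padded_recE L n k : strict_total L ->
  padded_rec (array_of L n.+1) k =
  if (k < - (ndn L n)%:Z)%R then 1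
  else if ((nup L n)%:Z < k)%R then n.+1
  else (rank L n.+1 (nth 0 (recs L n) (absz (k + (ndn L n)%:Z)%R))).+1.
Proof.
move=> stL; rewrite /padded_rec num_lowerE // num_upperE // record_values_recs //=.
case: ifP => // h1; case: ifP => // h2.
rewrite (nth_map 0) // size_recs //; move/negbT: h1; move/negbT: h2.
rewrite -!leNgt; lia.
Qed.

Lemma padded_rec_bound n (s : 'S_n.+1) k : 1 <= padded_rec s k <= n.+1.
Proof.
rewrite -(perm_orderK s) padded_recE; last exact: perm_order_strict_total.
case: ifP => [//|/negbT h1]; case: ifP => [|/negbT h2]; first by rewrite leqnn.
rewrite /= rank_lt //; first exact: perm_order_strict_total.
set a := absz _; have : a < size (recs (perm_order s) n).
  rewrite size_recs; last exact: perm_order_strict_total.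
  move: h1 h2; rewrite -!leNgt /a; lia.
by move=> /(mem_nth 0); rewrite mem_recs => /andP[].
Qed.

Lemma padded_rec_mono n (s : 'S_n.+1) k l : (k <= l)%R ->
  padded_rec s k <= padded_rec s l.
Proof.
move=> kl; have stL := perm_order_strict_total s.
have := padded_rec_bound s l; have := padded_rec_bound s k.
have ek := padded_recE n k stL; have el := padded_recE n l stL.
rewrite perm_orderK in ek el; rewrite ek el => /andP[k1 kn] /andP[l1 ln]; move: k1 kn l1 ln.
case: ifP => [_ _ _ -> //|/negbT h1]; case: ifP => [h2|/negbT h2] k1 kn.
  have -> : (l < - (ndn (perm_order s) n)%:Z)%R = false.
    by apply/negbTE; rewrite -leNgt (le_trans _ kl) // leNgt.
  by have -> : ((nup (perm_order s) n)%:Z < l)%R by exact: lt_le_trans kl.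
case: ifP => [h3|/negbT h3]; first by move: h1 h2 h3; rewrite -!leNgt; lia.
case: ifP => [h4|/negbT h4] _ _.
  rewrite rank_lt //.
  set a := absz _; have : a < size (recs (perm_order s) n).
    rewrite size_recs //; move: h1 h2; rewrite -!leNgt /a; lia.
  by move=> /(mem_nth 0); rewrite mem_recs => /andP[].
rewrite ltnS leqNgt ltn_rankE //.
- rewrite nth_recs_nth // ?size_recs //; move: h1 h2 h3 h4; rewrite -!leNgt; lia.
all: set a := absz _; have : a < size (recs (perm_order s) n) by
  rewrite size_recs //; move: h1 h2 h3 h4; rewrite -!leNgt /a; lia.
all: by move=> /(mem_nth 0); rewrite mem_recs => /andP[].
Qed.

(** By [recs_cat] the index of a record relative to the center never changes. So r_k follows the
    rank of one fixed item, and its convergence reduces to that of a relative rank. *)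
Lemma padded_rec_stable L n m a : strict_total L -> n <= m -> a < size (recs L n) ->
  padded_rec (array_of L m.+1) (a%:Z - (ndn L n)%:Z)%R =
  (rank L m.+1 (nth 0 (recs L n) a)).+1.
Proof.
move=> stL nm; rewrite size_recs // ltnS => ale.
have [s1 [s2 [e el eu]]] := recs_cat stL nm.
rewrite padded_recE // ifF; last by apply/negbTE; rewrite -leNgt el; lia.
rewrite ifF; last by apply/negbTE; rewrite -leNgt eu; lia.
congr (rank _ _ _).+1; rewrite el.
rewrite (_ : absz _ = size s1 + a); last by lia.
by rewrite e nth_cat ltnNge leq_addr /= addKn nth_cat size_recs // ltnS ale.
Qed.

End Padded.

Local Open Scope classical_set_scope.
Local Open Scope ring_scope.

Section PermArray.

(** * Measurability of arrays and of the limiting frequencies *)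

Definition cyl (n : nat) (E : set 'S_n) : set perm_array := [set p | E (p n)].

Lemma measurable_cyl n (E : set 'S_n) : measurable (cyl E).
Proof.
have -> : cyl E = \bigcup_(s in E) [set p | p n = s].
  apply/seteqP; split => [p Ep|p [s Es /= e]]; first by exists (p n).
  by rewrite /cyl /= e.
apply: fin_bigcup_measurable => [|s _]; first exact: finite_finset.
by apply: sub_sigma_algebra; exists n, s.
Qed.

Lemma measurable_fun_perm_array d (T : measurableType d) (f : T -> perm_array) :
  (forall n (s : 'S_n), measurable [set t | f t n = s]) -> measurable_fun setT f.
Proof.
move=> mf; apply: (measurability perm_array_cylinders) => //.
by move=> _ [_ [n [s ->]] <-]; rewrite setTI; exact: mf.
Qed.

(** Through [perm_order], coherence between two levels says that [p m] is a fixed function of [p n];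
    this is a finite union of intersections of two cylinders, hence measurable. *)
Lemma coherentE p :
  coherent p <-> forall m n, (m <= n)%N -> p m = array_of (perm_order (p n)) m.
Proof.
have e m n (lemn : (m <= n)%N) : array_of (perm_order (p n)) m = ranking_perm
    (fun i j : 'I_m => (p n (widen_ord lemn i) < p n (widen_ord lemn j))%N).
  congr ranking_perm; apply/funext => i; apply/funext => j.
  by rewrite -(perm_orderE _ (widen_ord lemn i) (widen_ord lemn j)).
by split=> h m n lemn; [rewrite (e _ _ lemn)|rewrite -(e _ _ lemn)]; exact: h.
Qed.

Lemma measurable_coherent : measurable [set p | coherent p].
Proof.
have -> : [set p | coherent p] = \bigcap_m \bigcap_n
    [set p : perm_array | (m <= n)%N -> p m = array_of (perm_order (p n)) m].
  apply/seteqP; split => [p cp m _ n _|p h]; first exact: ((coherentE p).1 cp).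
  by apply: (coherentE p).2 => m n; exact: (h m I n I).
apply: bigcap_measurable => [|m _]; first by exists 0%N.
apply: bigcap_measurable => [|n _]; first by exists 0%N.
have [lemn|] := boolP (m <= n)%N; last first.
  by move=> /negP h; rewrite [X in measurable X](_ : _ = setT) //; apply/seteqP; split => // p _ /h.
rewrite [X in measurable X](_ : _ =
   \bigcup_(s in [set: 'S_n]) (cyl [set s] `&` cyl [set array_of (perm_order s) m])).
  apply: fin_bigcup_measurable => [|s _]; first exact: finite_finset.
  by apply: measurableI; exact: measurable_cyl.
apply/seteqP; split => [p /(_ isT) h|p [s _ [/= -> ->]] //].
by exists (p n) => //; split.
Qed.

Definition same_on_coherent n (B : set perm_array) (E : set 'S_n) : Prop :=
  forall p, coherent p -> B p <-> E (p n).

(* A pi-system because coherent arrays are determined, up to a level, by any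
   higher level. *)
Definition coherent_system (n0 : nat) : set (set perm_array) :=
  [set B | measurable B /\ exists n E, (n0 <= n)%N /\ @same_on_coherent n B E].

Lemma same_on_coherentW m n (mn : (m <= n)%N) B (E : set 'S_m) :
  same_on_coherent B E -> exists E' : set 'S_n, same_on_coherent B E'.
Proof.
move=> h; exists [set s | E (array_of (perm_order s) m)] => p cp.
by rewrite /= -((coherentE p).1 cp) //; exact: h.
Qed.

Lemma coherent_systemE n0 : @measurable _ perm_array = <<s coherent_system n0 >>.
Proof.
apply/seteqP; split; last first.
  by apply: smallest_sub; [exact: sigma_algebra_measurable|move=> B []].
apply: smallest_sub; first exact: smallest_sigma_algebra.
move=> _ [n [s ->]]; apply: sub_sigma_algebra; split; first exact: (measurable_cyl [set s]).
have [E hE] := @same_on_coherentW n (maxn n0 n) (leq_maxr _ _) (cyl [set s]) [set s] (fun _ _ => iff_refl _).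
by exists (maxn n0 n), E; split => //; exact: leq_maxl.
Qed.

Lemma coherent_systemI n0 : setI_closed (coherent_system n0).
Proof.
move=> A B [mA [n [E [n0n hE]]]] [mB [m [F [n0m hF]]]].
split; first exact: measurableI.
have [E' hE'] := same_on_coherentW (leq_maxl n m) hE.
have [F' hF'] := same_on_coherentW (leq_maxr n m) hF.
exists (maxn n m), (E' `&` F'); split; first by rewrite leq_max n0n.
by move=> p cp; split => -[/hE' h1 /hF' h2]; split; by [exact: h1|exact: h2].
Qed.

(** On coherent arrays a low level is a function of any later one, so the levels from [n0] on
    suffice. The bound serves applications where two measures can be compared only from some level
    on. *)
Lemma perm_array_measure_unique (R : realType) (n0 : nat)
    (m1 m2 : {measure set perm_array -> \bar R}) :
  (m1 setT < +oo)%E ->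
  m1 (~` [set p | coherent p]) = 0%E -> m2 (~` [set p | coherent p]) = 0%E ->
  (forall n (s : 'S_n), (n0 <= n)%N -> m1 [set p | p n = s] = m2 [set p | p n = s]) ->
  forall B, measurable B -> m1 B = m2 B.
Proof.
move=> m1oo m1c m2c m12; apply: (measure_unique (coherent_system n0) (fun _ => setT)).
- exact: coherent_systemE.
- exact: coherent_systemI.
- by move=> _; split; [exact: measurableT|exists n0, setT].
- by apply/seteqP; split => // p _; exists 0%N.
- move=> A [mA [n [E [n0n hE]]]].
  have mE s : measurable [set p : perm_array | p n = s] := measurable_cyl [set s].
  have mC := measurable_coherent.
  have key (m : {measure set perm_array -> \bar R}) : m (~` [set p | coherent p]) = 0%E ->
      m A = (\sum_(s \in E) m [set p | p n = s])%E.
    move=> mc0; rewrite -measure_fin_bigcup; last 3 first.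
    - exact: finite_finset.
    - by move=> a b _ _ [p [/= <- <-]].
    - by move=> s _; exact: mE.
    have -> : \bigcup_(s in E) [set p | p n = s] = cyl E.
      by apply/seteqP; split => [p [s Es /= e]|p Ep]; [rewrite /cyl /= e|exists (p n)].
    have aux B : measurable B -> m B = m (B `&` [set p | coherent p]).
      move=> mB; rewrite -[in LHS](setIT B) -(setUv [set p | coherent p]) setIUr.
      rewrite measureU; last 3 first.
      - exact: measurableI.
      - by apply: measurableI => //; exact: measurableC.
      - by rewrite setIACA setICr setI0.
      rewrite [X in (_ + X)%E](_ : _ = 0%E) ?adde0 //; apply/eqP; rewrite eq_le measure_ge0 andbT.
      by rewrite -mc0 le_measure ?inE //; [apply: measurableI => //|]; exact: measurableC.
    rewrite aux // [RHS]aux; last exact: measurable_cyl.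
    by congr (m _); apply/seteqP; split => p [h1 h2]; split => //; apply/(hE p).
  rewrite !key //; apply: eq_fsbigr => s _; exact: m12.
- by move=> _.
Qed.

End PermArray.

Section Monoseq.
Variable R : realType.

Lemma measurable_fun_coord (k : int) : measurable_fun setT (fun x : monoseq R => x k).
Proof.
move=> _ B mB; rewrite setTI; apply: sub_sigma_algebra.
by exists k, B; split.
Qed.

Lemma measurable_fun_monoseq d (T : measurableType d) (f : T -> monoseq R) :
  (forall k, measurable_fun setT (fun t => f t k)) -> measurable_fun setT f.
Proof.
move=> mf; apply: (measurability (@monoseq_cylinders R)) => //.
by move=> _ [_ [k [B [mB ->]]] <-]; exact: (mf k measurableT B mB).
Qed.

Lemma monoseq_ext (x y : monoseq R) : (forall k, x k = y k) -> x = y.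
Proof.
case: x y => [x hx ix] [y hy iy] /= e.
have {}e : x = y by apply/funext.
by subst y; congr MonoSeq; exact: Prop_irrelevance.
Qed.

End Monoseq.

Section Freq.
Variable R : realType.

Lemma limn_sup_le (u v : R^nat) :
  has_ubound (range u) -> has_lbound (range u) ->
  has_ubound (range v) -> has_lbound (range v) ->
  (forall n, u n <= v n) -> limn_sup u <= limn_sup v.
Proof.
move=> uu ul vu vl uv; apply: ler_lim.
- by apply/cvg_ex; eexists; exact: cvg_sups_inf.
- by apply/cvg_ex; eexists; exact: cvg_sups_inf.
near=> n; apply: sup_le.
- by move=> _ [m /= nm <-]; apply/downP; exists (v m); [exists m|exact: uv].
- by exists (u n), n => /=.
- by split; [exists (v n), n => /=|exact: has_ubound_sdrop].
Unshelve. all: by end_near. Qed.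

Lemma limn_sup_eq_near (u v : R^nat) N : (forall n, (N <= n)%N -> u n = v n) ->
  limn_sup u = limn_sup v.
Proof.
move=> uv; have e : forall n, (N <= n)%N -> sups u n = sups v n.
  move=> n Nn; congr sup; apply/seteqP; split => _ [m /= nm <-]; exists m => //=;
  by rewrite uv // (leq_trans Nn).
rewrite /limn_sup; congr (lim _); apply/seteqP; split; apply: near_eq_cvg; exists N => // n /= Nn;
by rewrite e.
Qed.

Definition freq (p : perm_array) (k : int) : R^nat :=
  fun n => (padded_rec (p n) k)%:R / n%:R.

Lemma freq_itv p k n : 0 <= freq p k n <= 1.
Proof.
rewrite /freq; case: n => [|n]; first by rewrite invr0 mulr0 lexx ler01.
have /andP[_ le] := padded_rec_bound (p n.+1) k.
by rewrite divr_ge0 //= ler_pdivrMr ?ltr0n // mul1r ler_nat.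
Qed.

Lemma freq_ubound p k : has_ubound (range (freq p k)).
Proof. by exists 1 => _ [n _ <-]; case/andP: (freq_itv p k n). Qed.

Lemma freq_lbound p k : has_lbound (range (freq p k)).
Proof. by exists 0 => _ [n _ <-]; case/andP: (freq_itv p k n). Qed.

(* The upper limit exists everywhere and depends only on rec at late levels. *)
Definition lim_freq (p : perm_array) (k : int) : R := limn_sup (freq p k).

Lemma lim_freq_homo p : {homo lim_freq p : k l / k <= l}.
Proof.
move=> k l kl; apply: limn_sup_le; [exact: freq_ubound|exact: freq_lbound
 |exact: freq_ubound|exact: freq_lbound|].
case=> [|n]; first by rewrite /freq invr0 !mulr0.
by rewrite /freq ler_pM2r ?invr_gt0 ?ltr0n // ler_nat padded_rec_mono.
Qed.

Lemma lim_freq_itv p k : 0 <= lim_freq p k <= 1.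
Proof.
have c (a : R) : limn_sup (fun=> a) = a.
  by apply: (cvg_limn_inf_sup _).2; exact: cvg_cst.
have ub (a : R) : has_ubound (range (fun _ : nat => a)) by exists a => _ [n _ <-].
have lb (a : R) : has_lbound (range (fun _ : nat => a)) by exists a => _ [n _ <-].
apply/andP; split; [rewrite -[X in X <= _]c|rewrite -[X in _ <= X]c].
all: apply: limn_sup_le => //; try exact: freq_ubound; try exact: freq_lbound.
all: by move=> n; case/andP: (freq_itv p k n).
Qed.

Definition rho_of (p : perm_array) : monoseq R :=
  MonoSeq (@lim_freq_homo p) (lim_freq_itv p).

Lemma rho_of_eq p q N : (forall n, (N <= n)%N -> rec (p n) = rec (q n)) ->
  rho_of p = rho_of q.
Proof.
move=> h; apply: monoseq_ext => k; apply: (limn_sup_eq_near (N := N)) => n Nn.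
by rewrite /freq (padded_rec_eq (h n Nn)).
Qed.

Lemma measurable_fun_freq k n : measurable_fun setT (fun p => freq p k n).
Proof.
move=> _ B mB; rewrite setTI.
exact: (measurable_cyl [set s | B ((padded_rec s k)%:R / n%:R)]).
Qed.

Lemma measurable_fun_rho_of : measurable_fun setT rho_of.
Proof.
apply: measurable_fun_monoseq => k; apply: measurable_fun_limn_sup => [p _|p _|n].
- exact: freq_ubound.
- exact: freq_lbound.
- exact: measurable_fun_freq.
Qed.

End Freq.

(** * Exchangeability of neighbours *)

(** That the relabelled array shows [q] at level [m] is again an event about a single permutation of
    the original array, to which uniformity can be applied. *)
Lemma relabel_cancel (L : rel nat) (f g : nat -> nat) m (q : 'S_m) :
  strict_total L -> injective f -> injective g -> cancel f g -> cancel g f ->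
  (forall k, (k < m)%N -> (f k < m)%N) -> (forall k, (k < m)%N -> (g k < m)%N) ->
  array_of (relabel L f) m = q <-> array_of L m = array_of (relabel (perm_order q) g) m.
Proof.
move=> stL fi gi fK gK fm gm; have stf := relabel_strict_total stL fi.
have stg := relabel_strict_total (perm_order_strict_total q) gi.
split=> [e|e].
  apply/array_of_eq => // i j im jm; rewrite /relabel -e array_of_orderK ?gm //.
  by rewrite /relabel !gK.
rewrite -[RHS](perm_orderK q); apply/array_of_eq => //; first exact: perm_order_strict_total.
move=> i j im jm; have := (array_of_eq m stL stg).1 e (f i) (f j) (fm _ im) (fm _ jm).
by rewrite /relabel !fK.
Qed.

Lemma lift_natK n (t : 'S_n) : cancel (lift_nat t) (lift_nat t^-1).
Proof.
move=> k; have [h|h] := ltnP k n; last by rewrite !(lift_nat_id _ h).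
by rewrite (lift_nat_ord t (Ordinal h)) lift_nat_ord permK.
Qed.

Lemma lift_natVK n (t : 'S_n) : cancel (lift_nat t^-1) (lift_nat t).
Proof. by move=> k; rewrite -{1}[t]invgK lift_natK. Qed.

Lemma lift_nat_leq n (t : 'S_n) m k : (n <= m)%N -> (k < m)%N -> (lift_nat t k < m)%N.
Proof.
move=> nm km; have [/(lift_nat_lt t) h|h] := ltnP k n; last by rewrite lift_nat_id.
exact: leq_trans nm.
Qed.

Definition depends_on_first (m : nat) (Q : rel nat -> bool) : Prop :=
  forall L L' : rel nat,
    (forall a b, (a < m)%N -> (b < m)%N -> L a b = L' a b) -> Q L = Q L'.

Definition separated (n i : nat) (L : rel nat) : bool :=
  has (fun j => L i j != L i.+1 j) (iota 0 n).

(** When no item before [n] separates the neighbours, their comparisons with these items already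
    agree, so leaving the order alone acts on those comparisons as an exchange would
    ([swap_ord_l]). *)
Definition swap_ord (n i : nat) (L : rel nat) : rel nat :=
  if separated n i L then relabel L (swap_nat i) else L.

Section SwapOrd.
Variables (n i : nat).
Hypothesis ni : (n <= i)%N.

Lemma swap_ord_strict_total L : strict_total L -> strict_total (swap_ord n i L).
Proof.
move=> stL; rewrite /swap_ord; case: ifP => // _.
exact: relabel_strict_total (@swap_nat_inj i).
Qed.

Lemma swap_ord_rec L m : strict_total L -> (i.+2 <= m)%N ->
  rec (array_of (swap_ord n i L) m) = rec (array_of L m).
Proof.
move=> stL im; rewrite /swap_ord; case: ifP => // /hasP[j]; rewrite mem_iota => /andP[_ jn] sep.
by apply: (relabel_swap_rec stL (j := j)) => //; exact: leq_trans ni.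
Qed.

Lemma separated_swap L : separated n i (relabel L (swap_nat i)) = separated n i L.
Proof.
apply: eq_in_has => j; rewrite mem_iota => /andP[_ jn].
have ji : (j < i)%N by exact: leq_trans ni.
by rewrite /relabel swap_nati swap_natS (swap_nat_small ji) eq_sym.
Qed.

Lemma swap_ordK L : swap_ord n i (swap_ord n i L) = L.
Proof.
rewrite /swap_ord; case h : (separated n i L); rewrite ?separated_swap h //.
by apply/funext => a; apply/funext => b; rewrite /relabel !swap_natK.
Qed.

Lemma swap_ord_eq L L' m : (i.+2 <= m)%N ->
  (forall a b, (a < m)%N -> (b < m)%N -> L a b = L' a b) ->
  forall a b, (a < m)%N -> (b < m)%N -> swap_ord n i L a b = swap_ord n i L' a b.
Proof.
move=> im e a b am bm; rewrite /swap_ord.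
have -> : separated n i L = separated n i L'.
  apply: eq_in_has => j; rewrite mem_iota => /andP[_ jn].
  have [jm i1 i2] : [/\ (j < m)%N, (i < m)%N & (i.+1 < m)%N] by split; lia.
  by rewrite !e.
have sm k : (k < m)%N -> (swap_nat i k < m)%N.
  by rewrite /swap_nat; case: ifP => _; [|case: ifP => _]; lia.
by case: ifP => _; rewrite /relabel e ?sm.
Qed.

Lemma swap_ord_far L a b : (forall k, k \in [:: a; b] -> k != i /\ k != i.+1) ->
  swap_ord n i L a b = L a b.
Proof.
move=> h; rewrite /swap_ord; case: ifP => // _; rewrite /relabel.
have [ai ai'] : a != i /\ a != i.+1 by apply: h; rewrite !inE eqxx.
have [bi bi'] : b != i /\ b != i.+1 by apply: h; rewrite !inE eqxx orbT.
by rewrite /swap_nat (negbTE ai) (negbTE ai') (negbTE bi) (negbTE bi').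
Qed.

Lemma swap_ord_l L j : strict_total L -> (j < n)%N -> swap_ord n i L j i = L j i.+1.
Proof.
move=> stL jn; have ji : (j < i)%N by exact: leq_trans ni.
rewrite /swap_ord; case: ifP => [_|/negbT]; first by rewrite /relabel swap_nati swap_nat_small.
move=> /hasPn /(_ j); rewrite mem_iota jn => /(_ isT); rewrite negbK => /eqP e.
by rewrite (strict_totalN stL (i := i)) ?e -?(strict_totalN stL) // gtn_eqF // ltnW.
Qed.

End SwapOrd.

Section Exchange.
Context (R : realType) (d : measure_display) (T : measurableType d).
Variables (P : probability T R) (perms : {RV P >-> perm_array}).
Hypothesis coherent_perms : forall t : T, coherent (perms t).
Hypothesis uniform_given_rec : forall (n : nat) (s1 s2 : 'S_n), rec s1 = rec s2 ->
  P [set t | perms t n = s1] = P [set t | perms t n = s2].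

Local Notation Lp t := (array_order (perms t)).
Local Notation rho t := (rho_of R (perms t)).

Let stLp t : strict_total (Lp t) := array_order_strict_total (coherent_perms t).

Lemma measurable_perms n (E : set 'S_n) : measurable [set t | E (perms t n)].
Proof.
rewrite [X in measurable X](_ : _ = perms @^-1` cyl E) //.
by rewrite -[X in measurable X]setTI; apply: measurable_funP => //; exact: measurable_cyl.
Qed.

Lemma measurable_rho : measurable_fun setT (fun t => rho t).
Proof. exact: measurableT_comp (@measurable_fun_rho_of R) _. Qed.

Section Integral.
Variable h : monoseq R -> \bar R.
Hypothesis mh : measurable_fun setT h.
Hypothesis h0 : forall x, (0 <= h x)%E.

Lemma measurable_h_rho D : measurable_fun D (fun t => h (rho t)).
Proof.
apply: measurable_funTS; apply: measurableT_comp mh _; exact: measurable_rho.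
Qed.

(** Relabeling by [f] carries the event of [s] to that of [s']. It preserves rec from level [n] on,
    hence [rho]; and at each level m >= n it matches single permutations with equal rec, so by
    uniformity the relabelled array on the first event has the same law as the array on the
    second. *)
Lemma integral_rho_rec n (s s' : 'S_n) : rec s = rec s' ->
  (\int[P]_(t in [set t | perms t n = s]) h (rho t) =
   \int[P]_(t in [set t | perms t n = s']) h (rho t))%E.
Proof.
(* Products of permutations apply the left factor first, so [s (tau i) = s' i]: relabeling an order
   with ranks [s] gives ranks [s']. *)
move=> ess'; pose tau := (s' * s^-1)%g; pose f := lift_nat tau.
pose fV := lift_nat tau^-1.
have fi : injective f by exact: lift_nat_inj.
have fVi : injective fV by exact: lift_nat_inj.
have fK : cancel f fV by exact: lift_natK.
have fVK : cancel fV f by exact: lift_natVK.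
have flt m k : (n <= m)%N -> (k < m)%N -> (f k < m)%N by exact: lift_nat_leq.
have fVlt m k : (n <= m)%N -> (k < m)%N -> (fV k < m)%N by exact: lift_nat_leq.
have relab L : strict_total L -> (array_of L n = s <-> array_of (relabel L f) n = s').
  move=> stL; rewrite (relabel_cancel s' stL fi fVi fK fVK) //; last 2 first.
  - by move=> k; exact: flt.
  - by move=> k; exact: fVlt.
  suff -> : array_of (relabel (perm_order s') fV) n = s by [].
  apply: perm_ltn_inj => i j; rewrite (ltn_array_of (relabel_strict_total (perm_order_strict_total s') fVi)).
  rewrite /relabel /fV !lift_nat_ord perm_orderE /tau !invMg !invgK !permM.
  by rewrite !permKV.
pose phi t := array_of (relabel (Lp t) f).
have stphi t : strict_total (relabel (Lp t) f) by exact: relabel_strict_total.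
have phiE t m (q : 'S_m) : (n <= m)%N ->
    phi t m = q <-> perms t m = array_of (relabel (perm_order q) fV) m.
  move=> nm; rewrite -{1}(array_orderK (coherent_perms t)); apply: relabel_cancel => // k.
    exact: flt.
  exact: fVlt.
have mphi : measurable_fun setT phi.
  apply: measurable_fun_perm_array => m q.
  have [nm|mn] := leqP n m.
    rewrite [X in measurable X](_ : _ =
      [set t | [set array_of (relabel (perm_order q) fV) m] (perms t m)]); last first.
      by apply/seteqP; split => t /=; rewrite phiE.
    exact: measurable_perms.
  rewrite [X in measurable X](_ : _ =
      [set t | [set r : 'S_n | array_of (relabel (perm_order r) f) m = q] (perms t n)]).
    exact: measurable_perms.
  have e t : phi t m = array_of (relabel (perm_order (perms t n)) f) m.
    apply/array_of_eq => //; first exact: relabel_strict_total (perm_order_strict_total _) fi.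
    move=> i j im jm; rewrite /relabel -[in RHS](array_orderK (coherent_perms t)) array_of_orderK //.
    - by apply: flt => //; exact: ltn_trans mn.
    - by apply: flt => //; exact: ltn_trans mn.
  by apply/seteqP; split => t /=; rewrite e.
pose m1 := pushforward P phi; pose m2 := pushforward P perms.
pose D := cyl [set s'].
have mD : measurable D by exact: measurable_cyl.
pose h' p := h (rho_of R p).
have mh' : measurable_fun setT h'.
  by apply: measurableT_comp mh _; exact: measurable_fun_rho_of.
have e2 : (\int[P]_(t in [set t | perms t n = s']) h (rho t) = \int[m2]_(p in D) h' p)%E.
  by rewrite ge0_integral_pushforward //; [exact: measurable_funTS|move=> ? _; exact: h0].
have Dphi : phi @^-1` D = [set t | perms t n = s].
  apply/seteqP; split => t /=; rewrite /D /cyl /= /phi.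
    by move=> /(relab _ (stLp t)); rewrite array_orderK.
  by move=> e; apply/(relab _ (stLp t)); rewrite array_orderK.
have e1 : (\int[P]_(t in [set t | perms t n = s]) h (rho t) = \int[m1]_(p in D) h' p)%E.
  rewrite ge0_integral_pushforward //; [|exact: measurable_funTS|by move=> ? _; exact: h0].
  rewrite Dphi; apply: eq_integral => t /set_mem /= ets; congr h; symmetry.
  apply: (@rho_of_eq R _ _ n) => m nm; rewrite /phi -[in RHS](array_orderK (coherent_perms t)).
  apply: relabel_lift_nat_rec => //.
  have -> : array_of (relabel (Lp t) (lift_nat tau)) n = s'.
    by apply/(relab _ (stLp t)); rewrite array_orderK.
  by rewrite array_orderK // ets.
rewrite e1 e2; apply: eq_measure_integral => A mA AD.
have -> : A = A `&` D by apply/esym/setIidPl.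
pose n1 := mrestr m1 mD; pose n2 := mrestr m2 mD.
rewrite -[LHS]/(n1 A) -[RHS]/(n2 A).
have cph t : coherent (phi t) by exact: array_of_coherent.
apply: (perm_array_measure_unique (n0 := n)) => //.
- rewrite /n1 /= /mrestr /m1 /pushforward; apply: le_lt_trans (probability_le1 P _) _.
    by rewrite setTI Dphi; exact: (measurable_perms [set s]).
  by rewrite ltry.
- rewrite /n1 /= /mrestr /m1 /pushforward (_ : _ @^-1` _ = set0) ?measure0 //.
  by apply/seteqP; split => // t [/= /(_ (cph t))].
- rewrite /n2 /= /mrestr /m2 /pushforward (_ : _ @^-1` _ = set0) ?measure0 //.
  by apply/seteqP; split => // t [/= /(_ (coherent_perms t))].
move=> m q nm; rewrite /n1 /n2 /= /mrestr /m1 /m2 /pushforward.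
have res (p : perm_array) : coherent p -> p m = q -> p n = array_of (perm_order q) n.
  by move=> cp <-; exact: ((coherentE p).1 cp).
(* If [q] does not restrict to [s'] at level [n], coherent arrays showing [q] miss [D], and both
   measures vanish. *)
have [es|ns] := pselect (array_of (perm_order q) n = s'); last first.
  rewrite [X in P X](_ : _ = set0); last first.
    apply/seteqP; split => // t [/= em en]; apply: ns; rewrite -en.
    by rewrite (res _ (cph t) em).
  rewrite [X in _ = P X](_ : _ = set0) //.
  apply/seteqP; split => // t [/= em en]; apply: ns; rewrite -en.
  by rewrite (res _ (coherent_perms t) em).
rewrite [X in P X](_ : _ = [set t | perms t m = array_of (relabel (perm_order q) fV) m]); last first.
  apply/seteqP; split => t /=; first by move=> [/phiE ->].
  move=> /(phiE _ _ _ nm) e; split => //; rewrite /D /cyl /=.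
  by rewrite (res _ (cph t) e).
rewrite [X in _ = P X](_ : _ = [set t | perms t m = q]); last first.
  apply/seteqP; split => t /=; first by move=> [].
  move=> e; split => //; rewrite /D /cyl /=.
  by rewrite (res _ (coherent_perms t) e).
(* Both events now fix one permutation of level [m]. The two have equal rec at level [n], hence at
   level [m]. *)
apply: uniform_given_rec; rewrite -[in RHS](perm_orderK q).
apply: relabel_lift_nat_rec => //; first exact: perm_order_strict_total.
rewrite es -ess'; congr rec; apply/relab.
  exact: relabel_strict_total (perm_order_strict_total q) fVi.
rewrite -[RHS]es; congr (array_of _ n); apply/funext => a; apply/funext => b.
by congr (perm_order q _ _); exact: fK.
Qed.

Lemma integral_cyl_sum m (E : pred 'S_m) :
  (\int[P]_(t in [set t | E (perms t m)]) h (rho t) =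
   \sum_(s | E s) \int[P]_(t in [set t | perms t m = s]) h (rho t))%E.
Proof.
have -> : [set t | E (perms t m)] = \big[setU/set0]_(s <- enum E) [set t | perms t m = s].
  rewrite -bigcup_seq; apply/seteqP; split => [t Et|t [s /= Es e]].
    by exists (perms t m) => //=; rewrite mem_enum.
  by move: Es; rewrite -e mem_enum.
rewrite ge0_integral_bigsetU.
- by rewrite big_enum.
- by move=> s; exact: (measurable_perms [set s]).
- exact: enum_uniq.
- by move=> a b _ _ [t [/= <- <-]].
- exact: measurable_h_rho.
- by [].
Qed.

Lemma perm_order_perms t m a b : (a < m)%N -> (b < m)%N -> perm_order (perms t m) a b = Lp t a b.
Proof. by move=> am bm; rewrite -[in LHS](array_orderK (coherent_perms t)) array_of_orderK. Qed.

(** At level [m] the map [swap_ord] acts as an involution [F] of ['S_m] that preserves rec. Each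
    integral is a sum over permutations of level [m], and reindexing by [F] matches terms that are
    equal by [integral_rho_rec]. *)
Lemma integral_exchange n i m (Q : rel nat -> bool) :
  (n <= i)%N -> (i.+2 <= m)%N -> depends_on_first m Q ->
  (\int[P]_(t in [set t | Q (Lp t)]) h (rho t) =
   \int[P]_(t in [set t | Q (swap_ord n i (Lp t))]) h (rho t))%E.
Proof.
move=> ni im hQ; pose F (s : 'S_m) := array_of (swap_ord n i (perm_order s)) m.
have stF (s : 'S_m) := @swap_ord_strict_total n i _ (perm_order_strict_total s).
have FK : involutive F.
  move=> s; rewrite -[RHS]perm_orderK; apply/array_of_eq => //.
    exact: perm_order_strict_total.
  move=> a b am bm; rewrite -[in RHS](swap_ordK ni (perm_order s)).
  by apply: (swap_ord_eq ni im) => // a' b' am' bm'; rewrite array_of_orderK.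
have -> : [set t | Q (Lp t)] = [set t | [pred s | Q (perm_order s)] (perms t m)].
  by apply/seteqP; split => t /=; rewrite (hQ _ (Lp t)) // => a b; exact: perm_order_perms.
have -> : [set t | Q (swap_ord n i (Lp t))] =
    [set t | [pred s | Q (swap_ord n i (perm_order s))] (perms t m)].
  apply/seteqP; split => t /=; rewrite (hQ _ (swap_ord n i (Lp t))) //;
  by apply: (swap_ord_eq ni im) => a b; exact: perm_order_perms.
rewrite !integral_cyl_sum (reindex_inj (inv_inj FK)); apply: eq_big => s /=.
  by apply: hQ => a b am bm; rewrite array_of_orderK.
move=> _; apply: integral_rho_rec; rewrite -[in RHS](perm_orderK s).
by apply: swap_ord_rec => //; exact: perm_order_strict_total.
Qed.

End Integral.

End Exchange.

(** * Almost sure convergence of frequencies *)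

Section Average.
Variable R : realType.

(* Sparse enough for the variances 1 / sub_idx k to be summable with the weights
   (k + 1)(k + 2), and dense enough for consecutive ratios to tend to 1. *)
Definition sub_idx (k : nat) : nat := ((k.+1 * k.+2) ^ 2)%N.

Lemma sub_idx_lt k : (sub_idx k < sub_idx k.+1)%N.
Proof. by rewrite /sub_idx ltn_exp2r //; nia. Qed.

Lemma sub_idx_gt0 k : (0 < sub_idx k)%N.
Proof. by rewrite expn_gt0. Qed.

Lemma sub_idx_between K n : (sub_idx K <= n)%N ->
  exists2 k, (K <= k)%N & (sub_idx k <= n < sub_idx k.+1)%N.
Proof.
elim: n => [|n IH]; first by rewrite leqNgt sub_idx_gt0.
rewrite leq_eqVlt ltnS => /orP[/eqP e|/IH [k Kk /andP[h1 h2]]].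
  by exists K => //; rewrite -e leqnn sub_idx_lt.
have [h|h] := ltnP n.+1 (sub_idx k.+1).
  by exists k => //; rewrite h ltnW.
have e : n.+1 = sub_idx k.+1 by apply/eqP; rewrite eqn_leq h h2.
by exists k.+1; rewrite ?(leq_trans Kk) // e leqnn sub_idx_lt.
Qed.

(** With c = k + 1 the quotient equals (4c + 4) / c^2, and 4c + 4 <= 8c. *)
Lemma sub_idx_ratio k : ((sub_idx k.+1)%:R - (sub_idx k)%:R) / (sub_idx k)%:R <= 8 / k.+1%:R :> R.
Proof.
rewrite ler_pdivrMr ?ltr0n ?sub_idx_gt0 // mulrAC ler_pdivlMr ?ltr0n //.
have -> : (sub_idx k.+1)%:R = ((k.+1%:R + 1) * (k.+1%:R + 2)) ^+ 2 :> R.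
  by rewrite natrX natrM; congr ((_ * _) ^+ 2); rewrite ?natr1 -?natrD ?addn2.
have -> : (sub_idx k)%:R = (k.+1%:R * (k.+1%:R + 1)) ^+ 2 :> R.
  by rewrite natrX natrM; congr ((_ * _) ^+ 2); rewrite natr1.
have : 1 <= k.+1%:R :> R by rewrite ler1n.
set c := k.+1%:R => c1; rewrite -subr_ge0.
rewrite [X in 0 <= X](_ : _ = 4 * c * (c + 1) ^+ 2 * (c - 1)); last by ring.
by rewrite !mulr_ge0 // ?subr_ge0 // ?exprn_ge0 // ?addr_ge0 //; apply: le_trans c1.
Qed.

(** For consecutive sparse indices a <= N < b, steps of size at most 1 keep s(a)/a and s(N)/N within
    (N - a)/a <= (b - a)/a of each other, and this tends to 0 by [sub_idx_ratio]. *)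
Lemma avg_cvg (s : nat -> nat) (l : R) : s 0%N = 0%N ->
  (forall n, (s n <= s n.+1 <= (s n).+1)%N) ->
  (s (sub_idx k))%:R / (sub_idx k)%:R @[k --> \oo] --> l ->
  (s n)%:R / n%:R @[n --> \oo] --> l.
Proof.
move=> s0 hs cv.
have sle m n : (m <= n)%N -> (s m <= s n)%N /\ (s n <= s m + (n - m))%N.
  move=> /subnK <-; elim: (n - m)%N => [|i [h1 h2]]; first by rewrite subnn addn0.
  by have := hs (i + m)%N; rewrite addSn; lia.
have sn n : (s n <= n)%N by have := (sle _ _ (leq0n n)).2; rewrite s0; lia.
apply/cvgrPdist_le => e e0.
have e2 : 0 < e / 2 by rewrite divr_gt0.
have /cvgrPdist_le/(_ _ e2) [K1 _ h1] := cv.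
have [K2 hK2] : exists K2, 8 / K2.+1%:R <= e / 2.
  exists (Num.truncn (16 / e)); rewrite ler_pdivrMr ?ltr0n // mulrAC ler_pdivlMr //.
  have := truncnS_gt (16 / e); rewrite ltr_pdivrMr // => /ltW.
  by rewrite (mulrC e); apply: le_trans; rewrite -natrM.
pose K := maxn K1 K2.
exists (sub_idx K) => // n /= /sub_idx_between [k Kk /andP[k1 k2]].
have n0 : (0 < n)%N by apply: leq_trans k1; exact: sub_idx_gt0.
have hk1 := h1 k (leq_trans (leq_maxl _ _) Kk).
rewrite -(subrK ((s (sub_idx k))%:R / (sub_idx k)%:R) l) -addrA.
apply: (le_trans (ler_normD _ _)); rewrite (splitr e); apply: lerD => //.
apply: le_trans hK2; apply: (@le_trans _ _ (8 / k.+1%:R)); last first.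
  rewrite ler_pM2l // lef_pV2 ?posrE ?ltr0n // ler_nat ltnS.
  exact: leq_trans (leq_maxr _ _) Kk.
apply: le_trans (sub_idx_ratio k).
set a := (sub_idx k)%:R; set N := n%:R; set x := (s _)%:R; set y := (s n)%:R.
have a0 : 0 < a by rewrite ltr0n sub_idx_gt0.
have N0 : 0 < N by rewrite ltr0n.
have xa : x <= a by rewrite ler_nat.
have x0 : 0 <= x by rewrite ler0n.
have aN : a <= N by rewrite ler_nat.
have Nb : N <= (sub_idx k.+1)%:R by rewrite ler_nat ltnW.
have [xy yx] : x <= y /\ y <= x + (N - a).
  have [h2 h3] := sle _ _ k1; rewrite ler_nat h2; split => //.
  by rewrite /N /a -natrB // -natrD ler_nat.
apply: (@le_trans _ _ ((N - a) / a)); last by rewrite ler_pM2r ?invr_gt0 // lerB.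
have -> : x / a - y / N = (x * N - y * a) / (a * N).
  by field; rewrite !gt_eqF.
have aN0 : 0 <= (a * N)^-1 by rewrite invr_ge0 mulr_ge0 // ltW.
rewrite normrM (ger0_norm aN0).
rewrite ler_pdivrMr ?mulr_gt0 //.
have -> : (N - a) / a * (a * N) = (N - a) * N by field; rewrite gt_eqF.
rewrite ler_norml; apply/andP; split; nra.
Qed.

End Average.

(** * A law of large numbers from one- and two-point probabilities *)

Section LLN.
Context (R : realType) (d : measure_display) (T : measurableType d).
Variables (P : probability T R) (Y : nat -> T -> bool) (c1 c2 : R).
Hypothesis mY : forall i, measurable [set t | Y i t].
Hypothesis hY1 : forall i, P [set t | Y i t] = c1%:E.
Hypothesis hY2 : forall i j, (i < j)%N -> P [set t | Y i t && Y j t] = c2%:E.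

Definition hits (n : nat) (t : T) : nat := (\sum_(i < n) Y i t)%N.

Let mY2 a b : measurable [set t | Y a t && Y b t].
Proof.
rewrite [X in measurable X](_ : _ = [set t | Y a t] `&` [set t | Y b t]).
  exact: measurableI.
by apply/seteqP; split => t /= /andP.
Qed.

Let PY2 a b : P [set t | Y a t && Y b t] = (if a == b then c1 else c2)%:E.
Proof.
case: eqVneq => [->|]; first by under eq_set do rewrite andbb.
rewrite neq_ltn => /orP[/hY2 //|/hY2 <-].
by under eq_set do rewrite andbC.
Qed.

Lemma integral_hits2 n m : (n <= m)%N ->
  (\int[P]_t ((hits n t)%:R * (hits m t)%:R : R)%:E =
   (n%:R * (c1 + (m%:R - 1) * c2))%:E)%E.
Proof.
move=> nm.
have e t : ((hits n t)%:R * (hits m t)%:R : R)%:E =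
    (\sum_(a < n) \sum_(b < m) (\1_([set t | Y a t && Y b t]) t)%:E)%E.
  rewrite /hits !natr_sum mulr_suml -sumEFin; apply: eq_bigr => a _.
  rewrite mulr_sumr -sumEFin; apply: eq_bigr => b _.
  by rewrite indicE -natrM mulnb; congr ((nat_of_bool _)%:R%:E); apply/idP/idP; rewrite inE.
under eq_integral do rewrite e.
have mi a b : measurable_fun setT (fun t => (\1_([set t | Y a t && Y b t]) t)%:E : \bar R).
  by apply/measurable_EFinP; exact: measurable_indic.
have i0 a b t : (0 <= (\1_([set t | Y a t && Y b t]) t)%:E :> \bar R)%E.
  by rewrite lee_fin.
rewrite ge0_integral_sum //; last 2 first.
- by move=> a; apply: emeasurable_sum => b.
- by move=> a t _; apply: sume_ge0.
have -> : (\sum_(a < n) \int[P]_t \sum_(b < m) (\1_([set t | Y a t && Y b t]) t)%:E =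
    \sum_(a < n) (c1 + (m%:R - 1) * c2)%:E)%E.
  apply: eq_bigr => a _; rewrite ge0_integral_sum //.
  rewrite (eq_bigr (fun b : 'I_m => (if (a == b :> nat) then c1 else c2)%:E)); last first.
    by move=> b _; rewrite integral_indic // setIT; exact: PY2.
  rewrite sumEFin; congr EFin.
  have am : (a < m)%N by apply: leq_trans nm; exact: ltn_ord.
  rewrite (bigD1 (Ordinal am)) //= eqxx; congr (_ + _).
  rewrite (eq_bigr (fun=> c2)); last first.
    by move=> b; rewrite eq_sym -val_eqE /= => /negbTE ->.
  rewrite sumr_const cardC1 card_ord -[LHS]mulr_natl; congr (_ * _).
  by rewrite -subn1 natrB // (leq_ltn_trans (leq0n a) am).
by rewrite sumEFin sumr_const card_ord mulr_natl.
Qed.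

Lemma measurable_hits n : measurable_fun setT (fun t => (hits n t)%:R : R).
Proof.
rewrite [X in measurable_fun _ X](_ : _ = (fun t => \sum_(i < n) \1_([set t | Y i t]) t)).
  by apply: measurable_sum => i; exact: measurable_indic.
apply/funext => t; rewrite /hits natr_sum; apply: eq_bigr => i _.
by rewrite indicE; congr ((nat_of_bool _)%:R); apply/idP/idP; rewrite inE.
Qed.

(** The almost sure limit of the averages is random in general, so the second moment of the
    difference of two averages replaces a variance about the mean; it can be computed from [c1] and
    [c2] alone. *)
Lemma integral_hits_diff n m : (n <= m)%N ->
  (\int[P]_t ((m%:R * (hits n t)%:R - n%:R * (hits m t)%:R) ^+ 2 : R)%:E =
   (n%:R * m%:R * (m%:R - n%:R) * (c1 - c2))%:E)%E.
Proof.
move=> nm.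
pose V t : R := (m%:R * (hits n t)%:R - n%:R * (hits m t)%:R) ^+ 2.
pose F a b t : R := (hits a t)%:R * (hits b t)%:R.
have mF a b : measurable_fun setT (F a b).
  by apply: measurable_funM; exact: measurable_hits.
have mV : measurable_fun setT V.
  by apply: measurable_funX; apply: measurable_funB; apply: measurable_funM => //; exact: measurable_hits.
have F0 a b t : (0 <= (F a b t)%:E)%E by rewrite lee_fin mulr_ge0.
have V0 t : (0 <= (V t)%:E)%E by rewrite lee_fin sqr_ge0.
have intZ (k : R) a b : 0 <= k -> (\int[P]_t (k * F a b t)%:E = k%:E * \int[P]_t (F a b t)%:E)%E.
  move=> k0; under eq_integral do rewrite EFinM.
  by rewrite ge0_integralZl //; exact/measurable_EFinP.
have mkF (k : R) a b : measurable_fun setT (fun t => (k * F a b t)%:E).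
  by apply/measurable_EFinP; apply: measurable_funM.
have kF0 (k : R) a b t : 0 <= k -> (0 <= (k * F a b t)%:E)%E.
  by move=> k0; rewrite lee_fin mulr_ge0 // -lee_fin F0.
have n0 : 0 <= n%:R :> R by [].
have m0 : 0 <= m%:R :> R by [].
have k1 : 0 <= 2 * n%:R * m%:R :> R by rewrite !mulr_ge0.
have k2 : 0 <= m%:R ^+ 2 :> R by exact: sqr_ge0.
have k3 : 0 <= n%:R ^+ 2 :> R by exact: sqr_ge0.
(* The cross term is moved to the left, so that all integrands are nonnegative and the integrals
   split without integrability. *)
have : (\int[P]_t ((V t)%:E + (2 * n%:R * m%:R * F n m t)%:E) =
  \int[P]_t ((m%:R ^+ 2 * F n n t)%:E + (n%:R ^+ 2 * F m m t)%:E))%E.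
  by apply: eq_integral => t _; rewrite -!EFinD; congr EFin; rewrite /V /F; ring.
rewrite !ge0_integralD //; try by move=> t _; exact: kF0.
  rewrite !intZ // !integral_hits2 // -!EFinM -EFinD => /(congr1 (fun z => z - (2 * n%:R * m%:R * (n%:R * (c1 + (m%:R - 1) * c2)))%:E)%E).
  by rewrite addeK // -EFinB => ->; congr EFin; ring.
exact/measurable_EFinP.
Qed.

Lemma hits0 t : hits 0 t = 0%N.
Proof. by rewrite /hits big_ord0. Qed.

Lemma hitsS n t : hits n.+1 t = (hits n t + Y n t)%N.
Proof. by rewrite /hits big_ord_recr. Qed.

Let wt (k : nat) : R := (k.+1 * k.+2)%:R.
Let avg k t : R := (hits (sub_idx k) t)%:R / (sub_idx k)%:R.
Let inc k t : R := wt k * (avg k t - avg k.+1 t) ^+ 2.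

Let wt_gt0 k : 0 < wt k. Proof. by rewrite ltr0n. Qed.

(** The expected square of the difference of the two averages is (c1 - c2)(1/n - 1/m) <= 1/n, where
    n = [sub_idx k] is the square of [wt k]; the weight leaves the inverse of [wt k], whose sum
    telescopes. *)
Let integral_inc k : (\int[P]_t (inc k t)%:E <= ((wt k)^-1)%:E)%E.
Proof.
set n := sub_idx k; set m := sub_idx k.+1.
have n0 : 0 < n%:R :> R by rewrite ltr0n sub_idx_gt0.
have m0 : 0 < m%:R :> R by rewrite ltr0n sub_idx_gt0.
have nm : n%:R <= m%:R :> R by rewrite ler_nat ltnW // sub_idx_lt.
have en : n%:R = wt k ^+ 2 by rewrite /n /sub_idx /wt natrX.
have e t : inc k t = wt k / (n%:R * m%:R) ^+ 2 * (m%:R * (hits n t)%:R - n%:R * (hits m t)%:R) ^+ 2.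
  by rewrite /inc /avg -/n -/m; field; rewrite !gt_eqF.
under eq_integral do rewrite e EFinM.
have c0 : 0 <= wt k / (n%:R * m%:R) ^+ 2 by rewrite divr_ge0 ?sqr_ge0 // ltW.
rewrite ge0_integralZl //; last 2 first.
- apply/measurable_EFinP; apply: measurable_funX; apply: measurable_funB;
  apply: measurable_funM => //; exact: measurable_hits.
- by move=> t _; rewrite lee_fin sqr_ge0.
rewrite integral_hits_diff; last by rewrite ltnW // sub_idx_lt.
rewrite -EFinM lee_fin.
have c1le : c1 <= 1.
  by rewrite -lee_fin -(hY1 0); apply: probability_le1; exact: mY.
have c2ge : 0 <= c2 by rewrite -lee_fin -(@hY2 0 1) // measure_ge0.
have -> : wt k / (n%:R * m%:R) ^+ 2 * (n%:R * m%:R * (m%:R - n%:R) * (c1 - c2)) =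
   (wt k)^-1 * ((1 - n%:R / m%:R) * (c1 - c2)).
  by rewrite en; field; rewrite !gt_eqF.
rewrite -[X in _ <= X]mulr1 ler_pM2l ?invr_gt0 //.
have q1 : 0 <= n%:R / m%:R :> R by rewrite divr_ge0 // ltW.
have q2 : n%:R / m%:R <= 1 :> R by rewrite ler_pdivrMr // mul1r.
nra.
Qed.

Lemma wt_sum N : \sum_(0 <= k < N) (wt k)^-1 = 1 - N.+1%:R^-1.
Proof.
elim: N => [|N IH]; first by rewrite big_geq // invr1 subrr.
rewrite big_nat_recr //= IH /wt natrM.
have -> : N.+2%:R = N.+1%:R + 1 :> R by rewrite natr1.
have c0 : 0 < N.+1%:R :> R by rewrite ltr0n.
have c1' : 0 < N.+1%:R + 1 :> R by rewrite addr_gt0.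
by move: (N.+1%:R : R) c0 c1' => c c0 c1'; field; rewrite !gt_eqF.
Qed.

Let inc_ge0 k t : 0 <= inc k t.
Proof. by rewrite /inc mulr_ge0 ?sqr_ge0 // ltW. Qed.

Let measurable_inc k : measurable_fun setT (inc k).
Proof.
apply: measurable_funM => //; apply: measurable_funX; apply: measurable_funB;
apply: measurable_funM => //; exact: measurable_hits.
Qed.

Let ae_inc : {ae P, forall t, (\sum_(0 <= k <oo) (inc k t)%:E)%E \is a fin_num}.
Proof.
have mf : measurable_fun setT (fun t => (\sum_(0 <= k <oo) (inc k t)%:E)%E).
  apply: ge0_emeasurable_sum => k; first by move=> t _ _; rewrite lee_fin.
  by move=> _; exact/measurable_EFinP.
have : P.-integrable setT (fun t => (\sum_(0 <= k <oo) (inc k t)%:E)%E).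
  apply/integrableP; split => //.
  have f0 t : (0 <= \sum_(0 <= k <oo) (inc k t)%:E)%E.
    by apply: nneseries_ge0 => k _ _; rewrite lee_fin.
  under eq_integral do rewrite gee0_abs //.
  rewrite integral_nneseries //; last 2 first.
  - by move=> k; exact/measurable_EFinP.
  - by move=> k t _; rewrite lee_fin.
  apply: (@le_lt_trans _ _ 1%E); last by rewrite ltry.
  apply: lime_le; first by apply: is_cvg_nneseries => k _ _; apply: integral_ge0 => t _; rewrite lee_fin.
  apply: nearW => N.
  apply: (@le_trans _ _ (\sum_(0 <= k < N) ((wt k)^-1)%:E)%E).
    by apply: lee_sum => k _; exact: integral_inc.
  by rewrite sumEFin wt_sum lee_fin gerBl invr_ge0.
by move/(integrable_ae measurableT); apply: filterS => t; exact.
Qed.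

Lemma hits_ae_cvg : {ae P, forall t, cvgn (fun n => (hits n t)%:R / n%:R : R)}.
Proof.
have := ae_inc; apply: filterS => t ft.
suff [l cl] : exists l : R, avg k t @[k --> \oo] --> l.
  apply: (cvgP l); apply: (@avg_cvg R (fun n => hits n t) l) => //; first exact: hits0.
  by move=> n; rewrite hitsS leq_addr -addn1 leq_add2l leq_b1.
pose u k := avg k.+1 t - avg k t.
suff cu : cvgn (series u).
  exists (avg 0 t + limn (series u)).
  have -> : (fun k => avg k t) = (fun k => avg 0 t + series u k).
    by apply/funext => k; rewrite /series /= telescope_sumr // addrC subrK.
  by apply: cvgD; [exact: cvg_cst|].
apply: normed_cvg; apply: nondecreasing_is_cvgn.
  by apply: nondecreasing_series => k _ _; exact: normr_ge0.
exists (1 + fine (\sum_(0 <= k <oo) (inc k t)%:E)%E) => _ [N _ <-].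
rewrite /series /=.
apply: (@le_trans _ _ (\sum_(0 <= k < N) ((wt k)^-1 + inc k t))).
  (* AM-GM: |a - b| <= 1 / w + w |a - b|^2 *)
  apply: ler_sum => k _; rewrite /inc /u.
  have h : 0 < wt k by [].
  set a := avg k t; set b := avg k.+1 t; rewrite distrC.
  rewrite -(real_normK (x := a - b)) ?num_real //.
  set z := `|a - b|; have z0 : 0 <= z by exact: normr_ge0.
  move: (wt k) h => w h.
  have -> : w^-1 + w * z ^+ 2 = w^-1 * (1 + (w * z) ^+ 2).
    by field; rewrite gt_eqF.
  have {1}-> : z = w^-1 * (w * z) by rewrite mulKf ?gt_eqF.
  rewrite ler_pM2l ?invr_gt0 //.
  by have := sqr_ge0 (w * z - 1 / 2); nra.
rewrite big_split /= wt_sum lerD ?gerBl ?invr_ge0 // -lee_fin fineK // -sumEFin.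
by apply: nneseries_lim_ge => k _; rewrite lee_fin.
Qed.

End LLN.

Section DependsOnFirst.
Variables (L L' : rel nat) (n : nat).
Hypothesis LL' : forall a b, (a < n)%N -> (b < n)%N -> L a b = L' a b.

Lemma is_up_first i : (i < n)%N -> is_up L i = is_up L' i.
Proof.
move=> ilt; apply: eq_in_all => j; rewrite mem_iota => /andP[_ ji].
by rewrite LL' // (ltn_trans ji).
Qed.

Lemma is_dn_first i : (i < n)%N -> is_dn L i = is_dn L' i.
Proof.
move=> ilt; apply: eq_in_all => j; rewrite mem_iota => /andP[_ ji].
by rewrite LL' // (ltn_trans ji).
Qed.

Lemma recs_first i : (i < n)%N -> recs L i = recs L' i.
Proof.
elim: i => [//|i IH ilt] /=.
by rewrite is_up_first // is_dn_first // IH // ltnW.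
Qed.

Lemma typ_first m i : (m < n)%N -> (i < n)%N -> typ L m i = typ L' m i.
Proof.
move=> mn ilt; rewrite /typ -recs_first //; apply: eq_in_count => j.
by rewrite mem_recs => /andP[jm _]; rewrite LL' // (leq_ltn_trans jm).
Qed.

End DependsOnFirst.

Definition same_typb (L0 : rel nat) (n : nat) (L : rel nat) : bool :=
  all (fun m => typ L m m.+1 == typ L0 m m.+1) (iota 0 n).

Lemma same_typP L0 n L : reflect (same_typ L L0 n) (same_typb L0 n L).
Proof.
apply: (iffP allP) => [h m mn|h m].
  by apply/eqP/h; rewrite mem_iota.
by rewrite mem_iota => /andP[_ /h ->].
Qed.

Lemma same_typb_first L0 n m : (n < m)%N -> depends_on_first m (same_typb L0 n).
Proof.
move=> nm L L' LL'; apply: eq_in_all => k; rewrite mem_iota => /andP[_ kn].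
by rewrite (typ_first LL') // ?(ltn_trans kn) // (leq_ltn_trans kn).
Qed.

Section Harmonic.
Variable R : realType.

Lemma cvg_inv_shift (c : nat) : ((n + c.+1)%:R^-1 : R) @[n --> \oo] --> (0 : R).
Proof.
rewrite (_ : (fun n => _) = fun n => harmonic (n + c)%N).
  by rewrite cvg_shiftn; exact: cvg_harmonic.
by apply/funext => n; rewrite /harmonic /= addnS.
Qed.

Lemma cvg_ratio_shift (c : nat) : (n%:R / (n + c.+1)%:R : R) @[n --> \oo] --> (1 : R).
Proof.
rewrite [X in X @ \oo](_ : _ = fun n => 1 - c.+1%:R * (n + c.+1)%:R^-1 : R).
  rewrite -[X in _ --> X]subr0 -[X in _ --> _ - X](mulr0 c.+1%:R).
  by apply: cvgB; [exact: cvg_cst|apply: cvgM; [exact: cvg_cst|exact: cvg_inv_shift]].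
apply/funext => n; have h : (n + c.+1)%:R != 0 :> R by rewrite pnatr_eq0 addnS.
apply: (mulIf h); rewrite mulfVK // mulrBl mul1r mulfVK //.
by rewrite natrD addrK.
Qed.

Lemma rank_count (L : rel nat) c r n : strict_total L -> (r < c)%N ->
  (rank L (n + c) r = rank L c r + n - count (L r) (iota c n))%N.
Proof.
move=> stL rc; rewrite /rank addnC iotaD count_cat add0n.
have -> : count (L^~ r) (iota c n) = count (predC (L r)) (iota c n).
  apply: eq_in_count => i; rewrite mem_iota => /andP[ci _] /=.
  by rewrite (strict_totalN stL) // ltn_eqF // (leq_trans rc).
have := count_predC (L r) (iota c n); rewrite size_iota; lia.
Qed.

End Harmonic.

(** * Almost sure convergence of relative ranks *)

Section Frequencies.
Context (R : realType) (d : measure_display) (T : measurableType d).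
Variables (P : probability T R) (perms : {RV P >-> perm_array}).
Hypothesis coherent_perms : forall t : T, coherent (perms t).
Hypothesis uniform_given_rec : forall (n : nat) (s1 s2 : 'S_n), rec s1 = rec s2 ->
  P [set t | perms t n = s1] = P [set t | perms t n = s2].

Local Notation Lp t := (array_order (perms t)).
Local Notation rho t := (rho_of R (perms t)).

Let stLp t : strict_total (Lp t) := array_order_strict_total (coherent_perms t).

Lemma measurable_first m (Q : rel nat -> bool) : depends_on_first m Q ->
  measurable [set t | Q (Lp t)].
Proof.
move=> hQ; rewrite [X in measurable X](_ : _ = [set t | [set s : 'S_m | Q (perm_order s)] (perms t m)]).
  exact: measurable_perms.
by apply/seteqP; split => t /=; rewrite (hQ _ (Lp t)) // => a b; exact: perm_order_perms.
Qed.

Lemma prob_exchange n i m (Q : rel nat -> bool) :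
  (n <= i)%N -> (i.+2 <= m)%N -> depends_on_first m Q ->
  P [set t | Q (Lp t)] = P [set t | Q (swap_ord n i (Lp t))].
Proof.
move=> ni im hQ.
have m1 := measurable_first hQ.
have hQ' : depends_on_first m (fun L => Q (swap_ord n i L)).
  by move=> L L' LL'; apply: hQ; exact: swap_ord_eq.
have m2 := measurable_first hQ'.
have := @integral_exchange R d T P perms coherent_perms uniform_given_rec
   (fun=> 1%E) (measurable_cst _) (fun=> lee01) n i m Q ni im hQ.
by rewrite !integral_cst // !mul1e.
Qed.

Lemma prob_above j a : (j < a)%N ->
  P [set t | Lp t j a] = P [set t | Lp t j j.+1].
Proof.
elim: a => [//|a IH]; rewrite ltnS leq_eqVlt => /orP[/eqP <- //|ja].
rewrite -IH // (@prob_exchange j.+1 a a.+2 (fun L => L j a)) //.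
  by congr (P _); apply/seteqP; split => t /=; rewrite swap_ord_l.
by move=> L L' -> //; lia.
Qed.

(** The pair of indices is moved one index at a time. The larger one moves up alone; an adjacent
    pair (a, a + 1) passes through (a, a + 2), so that the two exchanged neighbours never both occur
    in the event. *)
Lemma prob_above2 j a b : (j < a)%N -> (a < b)%N ->
  P [set t | Lp t j a && Lp t j b] = P [set t | Lp t j j.+1 && Lp t j j.+2].
Proof.
move=> ja ab.
have dep m a' b' : (j < m)%N -> (a' < m)%N -> (b' < m)%N ->
    depends_on_first m (fun L => L j a' && L j b').
  by move=> jm am bm L L' LL'; rewrite !LL'.
have e1 a' b' : (j < a')%N -> (a' < b')%N ->
    P [set t | Lp t j a' && Lp t j b'] = P [set t | Lp t j a' && Lp t j b'.+1].
  move=> ja' ab'; rewrite (@prob_exchange j.+1 b' b'.+2 (fun L => L j a' && L j b')) //.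
  - congr (P _); apply/seteqP; split => t /=; rewrite swap_ord_l // ?swap_ord_far //.
    + by move=> k; rewrite !inE => /orP[] /eqP ->; split; lia.
    + lia.
    + by move=> k; rewrite !inE => /orP[] /eqP ->; split; lia.
    + lia.
  - lia.
  - by apply: dep; lia.
have e2 a' : (j < a')%N ->
    P [set t | Lp t j a' && Lp t j a'.+1] = P [set t | Lp t j a'.+1 && Lp t j a'.+2].
  move=> ja'; rewrite e1 // (@prob_exchange j.+1 a' a'.+3 (fun L => L j a' && L j a'.+2)) //.
  - congr (P _); apply/seteqP; split => t /=; rewrite swap_ord_l // ?swap_ord_far //.
    + by move=> k; rewrite !inE => /orP[] /eqP ->; split; lia.
    + by move=> k; rewrite !inE => /orP[] /eqP ->; split; lia.
  - by apply: dep; lia.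
have -> : P [set t | Lp t j a && Lp t j b] = P [set t | Lp t j a && Lp t j a.+1].
  elim: b ab => [//|b IH]; rewrite ltnS leq_eqVlt => /orP[/eqP <- //|ab].
  by rewrite -e1 // IH.
elim: a ja {ab} => [//|a IH]; rewrite ltnS leq_eqVlt => /orP[/eqP <- //|ja].
by rewrite -e2 // IH.
Qed.

Lemma rank_ae_cvg : {ae P, forall t, forall j,
  cvgn (fun n => (rank (Lp t) n j)%:R / n%:R : R)}.
Proof.
apply: ae_foralln => j.
pose Y (i : nat) t := Lp t j (i + j.+1)%N.
have dep m a : (j < m)%N -> (a < m)%N -> depends_on_first m (fun L => L j a).
  by move=> jm am L L' ->.
have mY i : measurable [set t | Y i t].
  by apply: (@measurable_first (i + j.+1).+1%N (fun L => L j (i + j.+1)%N)); apply: dep; lia.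
have mY2 a b : measurable [set t | Y a t && Y b t].
  rewrite [X in measurable X](_ : _ = [set t | Y a t] `&` [set t | Y b t]).
    exact: measurableI.
  by apply/seteqP; split => t /= /andP.
pose c1 := fine (P [set t | Lp t j j.+1]).
pose c2 := fine (P [set t | Lp t j j.+1 && Lp t j j.+2]).
have h1 i : P [set t | Y i t] = c1%:E.
  rewrite /Y prob_above ?addnS ?ltnS ?leq_addl // /c1 fineK //.
  by apply: fin_num_measure; exact: (mY 0%N).
have h2 a b : (a < b)%N -> P [set t | Y a t && Y b t] = c2%:E.
  move=> ab; rewrite /Y prob_above2 ?addnS ?ltnS ?leq_addl ?ltn_add2r // /c2 fineK //.
  by apply: fin_num_measure; exact: (mY2 0%N 1%N).
have := hits_ae_cvg mY h1 h2; apply: filterS => t cv.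
suff /cvg_ex[l cl] : cvgn (fun n => (rank (Lp t) (n + j.+1) j)%:R / (n + j.+1)%:R : R).
  by apply: (cvgP l); rewrite -(cvg_shiftn j.+1).
(* The rank of [j] is its rank among the first items, plus the number of later items, minus those of
   them above [j], which [hits] counts; the first term vanishes after division. *)
have e n : (rank (Lp t) (n + j.+1) j)%:R / (n + j.+1)%:R =
   (rank (Lp t) j.+1 j)%:R * (n + j.+1)%:R^-1 + n%:R / (n + j.+1)%:R
   - (hits Y n t)%:R / n%:R * (n%:R / (n + j.+1)%:R) :> R.
  rewrite rank_count //.
  have -> : count (Lp t j) (iota j.+1 n) = hits Y n t.
    rewrite /hits -sum1_count big_mkcond /= -[in iota _ _](addn0 j.+1) iotaDl big_map.
    rewrite -[in iota _ _](subn0 n) -/(index_iota 0 n) big_mkord.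
    by apply: eq_bigr => i _; rewrite /Y addnC; case: (Lp t _ _).
  have hle : (hits Y n t <= n)%N.
    rewrite /hits -[X in (_ <= X)%N](card_ord n) -sum1_card.
    by apply: leq_sum => i _; exact: leq_b1.
  rewrite natrB ?natrD; last exact: leq_trans hle (leq_addl _ _).
  rewrite mulrBl mulrDl; congr (_ - _).
  case: n hle => [|n] _; first by rewrite hits0 !mul0r.
  by rewrite mulrA mulfVK // pnatr_eq0.
under eq_fun do rewrite e.
apply: is_cvgB.
  apply: is_cvgD; last by apply/cvg_ex; eexists; exact: cvg_ratio_shift.
  apply: is_cvgM; first exact: is_cvg_cst.
  by apply/cvg_ex; eexists; exact: cvg_inv_shift.
apply: is_cvgM => //; by apply/cvg_ex; eexists; exact: cvg_ratio_shift.
Qed.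

End Frequencies.

(** * Frequencies of the gaps *)

Section Limits.
Variable R : realType.

Definition ranks_cvg (p : perm_array) : Prop :=
  forall j, cvgn (fun n => (rank (array_order p) n j)%:R / n%:R : R).

(* The records of an order with l lower and u upper proper ones delimit
   l + u + 2 gaps; gap a lies between x (a - 1 - l) and x (a - l), where the
   outermost bounds are replaced by 0 and 1. *)
Definition gap_len (x : int -> R) (l u a : nat) : R :=
  (if a == (l + u).+1 then 1 else x (a%:Z - l%:Z)) -
  (if a == 0%N then 0 else x (a.-1%:Z - l%:Z)).

Lemma measurable_gap_len l u a :
  measurable_fun setT (fun x : monoseq R => gap_len x l u a).
Proof.
rewrite /gap_len; case: (a == (l + u).+1); case: (a == 0%N);
by apply: measurable_funB => //; exact: measurable_fun_coord.
Qed.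

Lemma gap_len_itv (x : monoseq R) l u a : 0 <= gap_len x l u a <= 1.
Proof.
rewrite /gap_len; have h k := monoseq_itv x k.
have /andP[h1 h2] := h (a%:Z - l%:Z); have /andP[h3 h4] := h (a.-1%:Z - l%:Z).
have h5 : x (a.-1%:Z - l%:Z) <= x (a%:Z - l%:Z) by apply: monoseq_homo; lia.
by case: ifP => _; case: ifP => _; lra.
Qed.

Section Coherent.
Variable p : perm_array.
Hypotheses (cp : coherent p) (gp : ranks_cvg p).
Let L := array_order p.
Let stL : strict_total L := array_order_strict_total cp.

Lemma freq_rank n a : (a < size (recs L n))%N ->
  freq R p (a%:Z - (ndn L n)%:Z) @ \oo --> rho_of R p (a%:Z - (ndn L n)%:Z) /\
  (rank L m (nth 0%N (recs L n) a))%:R / m%:R @[m --> \oo] --> rho_of R p (a%:Z - (ndn L n)%:Z).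
Proof.
move=> alt; set k := _ - _; set r := nth _ _ _.
have /cvg_ex[l cl] : cvgn (fun m => (rank (array_order p) m r)%:R / m%:R : R) by exact: gp.
suff cf : freq R p k @ \oo --> l.
  have e : limn_sup (freq R p k) = l := (cvg_limn_inf_sup cf).2.
  by rewrite /rho_of /= /lim_freq e.
have : (rank L m r)%:R / m%:R + m%:R^-1 @[m --> \oo] --> l + 0.
  by apply: cvgD => //; rewrite -(cvg_shiftn 1); exact: cvg_inv_shift.
rewrite addr0; apply: cvg_trans; apply: near_eq_cvg.
exists n.+1 => // m /= nm; rewrite /freq -[in RHS](array_orderK cp).
case: m nm => // m nm.
rewrite padded_rec_stable // -/r.
by rewrite -[X in _ = X / _]natr1 mulrDl mul1r.
Qed.

(** If some level has enough records, [k] is attached to a fixed item and [freq_rank] applies.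
    Otherwise r_k is the padding value at every positive level, and the frequency is 1/n for
    negative [k] and 1 for positive [k]. *)
Lemma freq_cvg k : freq R p k @ \oo --> rho_of R p k.
Proof.
have [[n hn]|h] := pselect (exists n, (- (ndn L n)%:Z <= k <= (nup L n)%:Z)).
  have -> : k = (absz (k + (ndn L n)%:Z))%:Z - (ndn L n)%:Z by lia.
  by apply: (freq_rank _).1; rewrite size_recs //; lia.
have {}h n : k < - (ndn L n)%:Z \/ (nup L n)%:Z < k.
  by apply: contrapT => h'; apply: h; exists n; lia.
suff [l cl] : exists l : R, freq R p k @ \oo --> l.
  have e : limn_sup (freq R p k) = l := (cvg_limn_inf_sup cl).2.
  by rewrite /rho_of /= /lim_freq e.
case: (ltrP k 0) => k0.
  exists 0; rewrite -(cvg_shiftn 1).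
  rewrite (_ : (fun n => _) = fun n => (n + 1)%:R^-1); first exact: cvg_inv_shift.
  apply/funext => n; rewrite addn1 /freq -[in LHS](array_orderK cp) padded_recE // ifT ?mul1r //.
  by have [//|] := h n; lia.
exists 1; rewrite -(cvg_shiftn 1) (_ : (fun n => _) = fun=> 1); first exact: cvg_cst.
apply/funext => n; rewrite addn1 /freq -[in LHS](array_orderK cp) padded_recE //.
rewrite ifF; last by apply/negbTE; rewrite -leNgt; lia.
rewrite ifT; first by rewrite divff ?pnatr_eq0.
by have [|//] := h n; lia.
Qed.

Lemma count_above_cvg n a : (a < size (recs L n))%N ->
  (count (fun i => a < typ L n i)%N (iota n.+1 K))%:R / (K + n.+1)%:R @[K --> \oo] -->
  1 - rho_of R p (a%:Z - (ndn L n)%:Z).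
Proof.
move=> alt; have [_] := freq_rank alt; set r := nth _ _ _; set z := rho_of _ _ _.
rewrite -(cvg_shiftn n.+1) => cr.
have rn : (r < n.+1)%N by have := mem_nth 0%N alt; rewrite mem_recs => /andP[].
rewrite (_ : (fun K => _) = fun K => (rank L n.+1 r)%:R * (K + n.+1)%:R^-1 +
    K%:R / (K + n.+1)%:R - (rank L (K + n.+1) r)%:R / (K + n.+1)%:R).
  rewrite -[X in _ --> X - _]add0r -[X in _ --> X + _ - _](mulr0 (rank L n.+1 r)%:R).
  apply: cvgB => //; apply: cvgD; last exact: cvg_ratio_shift.
  by apply: cvgM; [exact: cvg_cst|exact: cvg_inv_shift].
apply/funext => K.
have -> : count (fun i => a < typ L n i)%N (iota n.+1 K) = count (L r) (iota n.+1 K).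
  by apply: eq_in_count => i; rewrite mem_iota => /andP[ni _]; rewrite ltn_typ.
rewrite rank_count //.
have hle : (count (L r) (iota n.+1 K) <= K)%N.
  by rewrite -[X in (_ <= X)%N](size_iota n.+1) count_size.
rewrite natrB ?natrD; last exact: leq_trans hle (leq_addl _ _).
by ring.
Qed.

(** The count for gap [a] is the number of items above its lower bound minus the number above its
    upper bound. Division by the level [K + n.+1], rather than by the number [K] of items, matches
    the relative ranks and gives the same limit. *)
Lemma count_typ_cvg n a : (a <= (ndn L n + nup L n).+1)%N ->
  (count (fun i => typ L n i == a) (iota n.+1 K))%:R / (K + n.+1)%:R @[K --> \oo] -->
  gap_len (rho_of R p) (ndn L n) (nup L n) a.
Proof.
move=> ale.
pose A K := count (fun i => a <= typ L n i)%N (iota n.+1 K).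
pose B K := count (fun i => a < typ L n i)%N (iota n.+1 K).
rewrite (_ : (fun K => _) = fun K => (A K)%:R / (K + n.+1)%:R - (B K)%:R / (K + n.+1)%:R); last first.
  apply/funext => K; rewrite -mulrBl; congr (_ / _).
  apply/eqP; rewrite eq_sym subr_eq -natrD; apply/eqP; congr (_%:R).
  rewrite /A /B -count_predUI [X in (_ + X)%N](_ : _ = 0%N) ?addn0.
    by apply: eq_count => i /=; rewrite leq_eqVlt eq_sym.
  apply/eqP; rewrite -leqn0 leqNgt -has_count; apply/hasPn => i _ /=.
  by case: eqP => [->|//]; rewrite ltnn.
have -> : gap_len (rho_of R p) (ndn L n) (nup L n) a =
   (if a == 0%N then 1 else 1 - rho_of R p (a.-1%:Z - (ndn L n)%:Z)) -
   (if a == (ndn L n + nup L n).+1 then 0 else 1 - rho_of R p (a%:Z - (ndn L n)%:Z)).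
  by rewrite /gap_len; case: ifP => _; case: ifP => _; ring.
apply: cvgB.
  case: eqP => [a0|/eqP a0].
    rewrite (_ : (fun K => _) = fun K => K%:R / (K + n.+1)%:R); first exact: cvg_ratio_shift.
    by apply/funext => K; rewrite /A a0 count_predT size_iota.
  have := @count_above_cvg n a.-1.
  rewrite size_recs // prednK ?lt0n // => /(_ ale).
  have e K : count (fun i => a.-1 < typ L n i)%N (iota n.+1 K) = A K.
    by apply: eq_count => i /=; lia.
  by rewrite (_ : (fun K => (A K)%:R / _) = fun K =>
    (count (fun i => a.-1 < typ L n i)%N (iota n.+1 K))%:R / (K + n.+1)%:R) //;
    apply/funext => K; rewrite e.
case: eqP => [e|/eqP e]; last first.
  by apply: count_above_cvg; rewrite size_recs // ltn_neqAle e.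
rewrite (_ : (fun K => _) = fun=> 0); first exact: cvg_cst.
apply/funext => K; rewrite /B (_ : count _ _ = 0%N) ?mul0r //.
apply/eqP; rewrite -leqn0 leqNgt -has_count; apply/hasPn => i _ /=.
by rewrite -leqNgt e typ_le.
Qed.

End Coherent.
End Limits.

(** * Conditional probability of a sequence of gaps *)

Fixpoint typ_prob (R : realType) (x : int -> R) (L0 : rel nat) (n : nat) : R :=
  if n is m.+1 then
    typ_prob x L0 m * gap_len x (ndn L0 m) (nup L0 m) (typ L0 m n)
  else 1.

Lemma same_typbS L0 n L :
  same_typb L0 n.+1 L = same_typb L0 n L && (typ L n n.+1 == typ L0 n n.+1).
Proof. by rewrite /same_typb iotaSr -cats1 all_cat /= add0n andbT. Qed.

Section GapStep.
Context (R : realType) (d : measure_display) (T : measurableType d).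
Variables (P : probability T R) (perms : {RV P >-> perm_array}).
Hypothesis coherent_perms : forall t : T, coherent (perms t).
Hypothesis uniform_given_rec : forall (n : nat) (s1 s2 : 'S_n), rec s1 = rec s2 ->
  P [set t | perms t n = s1] = P [set t | perms t n = s2].

Local Notation Lp t := (array_order (perms t)).
Local Notation rho t := (rho_of R (perms t)).

Let stLp t : strict_total (Lp t) := array_order_strict_total (coherent_perms t).

Variable L0 : rel nat.
Hypothesis stL0 : strict_total L0.

Definition typ_event (n : nat) : set T := [set t | same_typb L0 n (Lp t)].

Lemma measurable_typ_event n : measurable (typ_event n).
Proof. exact: measurable_first (same_typb_first L0 (ltnSn n)). Qed.

Section Step.
Variable h : monoseq R -> R.
Hypothesis mh : measurable_fun setT h.
Hypothesis h01 : forall x, 0 <= h x <= 1.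
Variable n : nat.

Let a := typ L0 n n.+1.
Let Q i (L : rel nat) := same_typb L0 n L && (typ L n i == a).
Let A i := [set t | Q i (Lp t)].

Let mhr : measurable_fun setT (fun t => h (rho t)).
Proof. by apply: measurableT_comp mh _; exact: measurable_rho. Qed.

Let Q_first i : (n < i)%N -> depends_on_first i.+2 (Q i).
Proof.
move=> ni L L' LL'; rewrite /Q (same_typb_first L0 (m := i.+2) _ LL') 1?ltnW ?ltnS 1?ltnW //.
by rewrite (typ_first LL') // ltnS ltnW // ltnS ltnW.
Qed.

Let mA i : (n < i)%N -> measurable (A i).
Proof. by move=> ni; exact: measurable_first (Q_first ni). Qed.

(** Exchanging items i and i + 1, both after item [n], leaves the gaps of the first items alone and
    swaps the gaps of the two among the records of items 0 to [n]. *)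
Let integral_A i : (n < i)%N ->
  (\int[P]_(t in A i) (h (rho t))%:E = \int[P]_(t in A n.+1) (h (rho t))%:E)%E.
Proof.
elim: i => [//|i IH]; rewrite ltnS leq_eqVlt => /orP[/eqP -> //|ni].
rewrite -IH //; have mhE : measurable_fun setT (fun x => (h x)%:E) by exact/measurable_EFinP.
have h0 x : (0 <= (h x)%:E)%E by rewrite lee_fin; case/andP: (h01 x).
rewrite [RHS](integral_exchange coherent_perms uniform_given_rec mhE h0 (n := n.+1) (i := i) _ (leqnn _) (Q_first ni)) //.
congr (\int[P]_(t in _) _)%E; apply/seteqP; split => t; rewrite /A /Q /=.
all: rewrite (same_typb_first L0 (ltnSn n) (L' := Lp t)); last by
  move=> x y xn yn; rewrite swap_ord_far // => k; rewrite !inE => /orP[] /eqP ->; split; lia.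
all: rewrite (_ : typ (swap_ord _ _ _) _ _ = typ (Lp t) n i.+1) //.
all: rewrite /typ (@recs_first _ (Lp t) n.+1) //; last by
  move=> x y xn yn; rewrite swap_ord_far // => k; rewrite !inE => /orP[] /eqP ->; split; lia.
all: by apply: eq_in_count => j; rewrite mem_recs => /andP[jn _]; rewrite swap_ord_l.
Qed.

Let f K t : R := h (rho t) *
  ((count (fun i => typ (Lp t) n i == a) (iota n.+1 K))%:R / (K + n.+1)%:R).

Let I := fine (\int[P]_(t in A n.+1) (h (rho t))%:E)%E.

Let integral_AE : (\int[P]_(t in A n.+1) (h (rho t))%:E = I%:E)%E.
Proof.
rewrite /I fineK // ge0_fin_numE; last first.
  by apply: integral_ge0 => t _; rewrite lee_fin; case/andP: (h01 (rho t)).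
apply: (@le_lt_trans _ _ (\int[P]_(t in A n.+1) cst 1 t)%E).
  apply: ge0_le_integral => //; first exact: mA.
  - by move=> t _; rewrite lee_fin; case/andP: (h01 (rho t)).
  - by apply/measurable_EFinP; exact: measurable_funTS.
  - by move=> t _; rewrite lee_fin; case/andP: (h01 (rho t)).
rewrite integral_cst ?mul1e; last exact: mA.
by apply: le_lt_trans (probability_le1 P (mA (ltnSn n))) _; rewrite ltry.
Qed.

Let integral_f K : (\int[P]_(t in typ_event n) (f K t)%:E =
  (K%:R / (K + n.+1)%:R * I)%:E)%E.
Proof.
have mD := measurable_typ_event n.
have c0 : 0 <= (K + n.+1)%:R^-1 :> R by rewrite invr_ge0.
(* The summation lemmas ask for measurability at every index, whereas [A i] is known to be
   measurable only for i > n. *)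
pose A' i := if (n < i)%N then A i else set0.
have mA' i : measurable (A' i).
  by rewrite /A'; case: ifP => [/mA //|_]; exact: measurable0.
pose F i t : \bar R := (h (rho t) * \1_(A' i) t)%:E.
have mF i : measurable_fun (typ_event n) (F i).
  apply/measurable_EFinP; apply: measurable_funM; first exact: measurable_funTS.
  exact: measurable_indic.
have F0 i t : (0 <= F i t)%E.
  by rewrite lee_fin mulr_ge0 //; case/andP: (h01 (rho t)).
have intF i : (n < i)%N -> (\int[P]_(t in typ_event n) F i t =
    \int[P]_(t in A n.+1) (h (rho t))%:E)%E.
  move=> ni; rewrite -(integral_A ni).
  have -> : A i = typ_event n `&` A i.
    by apply/esym/setIidPr => t; rewrite /A /Q /= => /andP[].
  rewrite integral_mkcondr; apply: eq_integral => t _.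
  rewrite /F /A' ni patchE indicE; case: (t \in A i); by rewrite ?mulr1 ?mulr0.
transitivity (\int[P]_(t in typ_event n) ((K + n.+1)%:R^-1%:E * \sum_(i <- iota n.+1 K) F i t))%E.
  apply: eq_integral => t /set_mem Dt.
  rewrite /F sumEFin -EFinM; congr EFin.
  rewrite -mulr_sumr /f [RHS]mulrCA; congr (_ * _); rewrite [RHS]mulrC; congr (_ / _).
  rewrite -sum1_count big_mkcond /= natr_sum big_seq [RHS]big_seq; apply: eq_bigr => i.
  rewrite mem_iota => /andP[ni _]; rewrite /A' ni indicE.
  have -> : (t \in A i) = (typ (Lp t) n i == a).
    by apply/idP/idP; rewrite inE /A /Q /= Dt.
  by case: eqP.
rewrite ge0_integralZl //; last 2 first.
- by apply: emeasurable_sum => i.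
- by move=> t _; apply: sume_ge0.
rewrite ge0_integral_sum // (eq_big_seq (fun=> I%:E)); last first.
  by move=> i; rewrite mem_iota => /andP[ni _]; rewrite intF // integral_AE.
rewrite sumEFin -EFinM; congr EFin.
rewrite big_const_seq count_predT size_iota iter_addr addr0 -[I *+ K]mulr_natl.
by rewrite mulrA (mulrC _^-1).
Qed.

Hypothesis ranks_perms : {ae P, forall t, ranks_cvg R (perms t)}.

Lemma integral_typ_step :
  (\int[P]_(t in typ_event n.+1) (h (rho t))%:E =
   \int[P]_(t in typ_event n)
     (h (rho t) * gap_len (rho t) (ndn L0 n) (nup L0 n) a)%:E)%E.
Proof.
have -> : typ_event n.+1 = A n.+1.
  by apply/seteqP; split => t; rewrite /typ_event /A /Q /= same_typbS.
have mD := measurable_typ_event n.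
have mgap : measurable_fun setT (fun t => gap_len (rho t) (ndn L0 n) (nup L0 n) a).
  have mgl := @measurable_gap_len R (ndn L0 n) (nup L0 n) a.
  by apply: measurableT_comp mgl _; exact: measurable_rho.
have mf K : measurable_fun (typ_event n) (fun t => (f K t)%:E).
  apply/measurable_EFinP; apply: measurable_funM; first exact: measurable_funTS.
  apply: measurable_funM => //; apply: measurable_funTS.
  (* Level [(n + K).+1] contains all the items counted, so each indicator is that of a cylinder. *)
  pose E i := [set s : 'S_(n + K).+1 | typ (perm_order s) n i == a].
  rewrite (_ : (fun t => _) = fun t => \sum_(i <- iota n.+1 K)
     (\1_([set t | E i (perms t (n + K).+1)]) t)).
    apply: measurable_sum => i; apply: measurable_indic.
    exact: (@measurable_perms R d T P perms _ (E i)).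
  apply/funext => t; rewrite -sum1_count big_mkcond /= natr_sum big_seq [RHS]big_seq.
  apply: eq_bigr => i; rewrite mem_iota => /andP[ni niK]; rewrite indicE.
  have e : typ (perm_order (perms t (n + K).+1)) n i = typ (Lp t) n i.
    by apply: (typ_first (n := (n + K).+1)) => [x y|//|//]; [exact: perm_order_perms|lia].
  have -> : (t \in [set t | E i (perms t (n + K).+1)]) = (typ (Lp t) n i == a).
    by apply/idP/idP; rewrite inE /E /= e.
  by case: eqP.
pose g t := h (rho t) * gap_len (rho t) (ndn L0 n) (nup L0 n) a.
have mg : measurable_fun (typ_event n) (fun t => (g t)%:E).
  by apply/measurable_EFinP; apply: measurable_funTS; exact: measurable_funM.
have cvf : {ae P, forall t, typ_event n t -> (f K t)%:E @[K --> \oo] --> (g t)%:E}.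
  apply: filterS ranks_perms => t gt Dt; apply: cvg_EFin; first exact: nearW.
  rewrite /f /g; apply: cvgM; first exact: cvg_cst.
  (* On this event the numbers of records are those of [L0], so the limiting gap length is a fixed
     function of [rho]. *)
  have /same_typP st := Dt.
  have [_ <- <-] := same_typ_recs (stLp t) stL0 st (leqnn n).
  apply: count_typ_cvg => //; have [_ -> ->] := same_typ_recs (stLp t) stL0 st (leqnn n).
  exact: typ_le.
have bf : {ae P, forall t K, typ_event n t -> (`|(f K t)%:E| <= (EFin \o cst (1:R)%R) t)%E}.
  apply: nearW => t K _; rewrite /f /= lee_fin.
  have /andP[h1 h2] := h01 (rho t).
  have c1 : (count (fun i => typ (Lp t) n i == a) (iota n.+1 K) <= K + n.+1)%N.
    by rewrite (leq_trans (count_size _ _)) // size_iota leq_addr.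
  have q0 : 0 <= (count (fun i => typ (Lp t) n i == a) (iota n.+1 K))%:R / (K + n.+1)%:R :> R.
    by rewrite divr_ge0.
  have q1 : (count (fun i => typ (Lp t) n i == a) (iota n.+1 K))%:R / (K + n.+1)%:R <= 1 :> R.
    by rewrite ler_pdivrMr ?mul1r ?ler_nat // ltr0n addnS.
  by rewrite ger0_norm ?mulr_ge0 // mulr_ile1.
have [_ _ cv] := dominated_convergence mD mf mg cvf (finite_measure_integrable_cst P 1 mD) bf.
rewrite integral_AE.
have cI : (K%:R / (K + n.+1)%:R * I)%:E @[K --> \oo] --> I%:E.
  apply: cvg_EFin; first exact: nearW.
  by rewrite -[X in _ --> X]mul1r; apply: cvgM; [exact: cvg_ratio_shift|exact: cvg_cst].
rewrite -(cvg_lim _ cI) // -(cvg_lim _ cv) //; congr (lim (_ @ \oo)).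
by apply/funext => K; rewrite -integral_f.
Qed.

End Step.

(** The induction needs an arbitrary test function [h]: the length of the last gap is a function of
    [rho] with values in [0, 1] and is absorbed into [h]. *)
Lemma integral_typ (h : monoseq R -> R) n :
  {ae P, forall t, ranks_cvg R (perms t)} ->
  measurable_fun setT h -> (forall x, 0 <= h x <= 1) ->
  (\int[P]_(t in typ_event n) (h (rho t))%:E =
   \int[P]_t (typ_prob (rho t) L0 n * h (rho t))%:E)%E.
Proof.
move=> ranks_perms; elim: n h => [|n IH] h mh h01.
  have -> : typ_event 0 = setT by apply/seteqP.
  by apply: eq_integral => t _; rewrite mul1r.
rewrite integral_typ_step //.
rewrite (IH (fun x => h x * gap_len x (ndn L0 n) (nup L0 n) (typ L0 n n.+1))).
- by apply: eq_integral => t _; rewrite /= mulrAC mulrA.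
- by apply: measurable_funM => //; exact: measurable_gap_len.
- move=> x; have /andP[h1 h2] := h01 x.
  have /andP[h3 h4] := gap_len_itv x (ndn L0 n) (nup L0 n) (typ L0 n n.+1).
  by rewrite mulr_ge0 //= mulr_ile1.
Qed.

End GapStep.

(** * The order generated by (X_n) *)

Section Generated.
Variables (R : realType) (x : monoseq R) (w : nat -> R).

(* Excludes a null set of ties; W_1, which is [w 0], plays no role. *)
Definition generic : Prop :=
  (forall m k, w m.+1 != x k) /\
  (forall i j, i != j -> w i.+1 != w j.+1).

Hypothesis gw : generic.

Local Notation X := (Xseq x w).
Local Notation inc := (included x w).
Local Notation L := (Xorder x w).

Lemma includedS m : inc m.+1 =
  if x (inc m).2%:Z < w m.+1 then ((inc m).1, (inc m).2.+1)
  else if w m.+1 < x (- (inc m).1%:Z) then ((inc m).1.+1, (inc m).2)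
  else inc m.
Proof. by rewrite /=; case: (inc m) => l u /=; case: ifP => // _; case: ifP. Qed.

Lemma XseqS m : X m.+1 =
  if x (inc m).2%:Z < w m.+1 then x (inc m).2.+1%:Z
  else if w m.+1 < x (- (inc m).1%:Z) then x (- (inc m).1.+1%:Z)
  else w m.+1.
Proof. by rewrite /=; case: (inc m). Qed.

Lemma Xseq_bounds n i : (i <= n)%N -> x (- (inc n).1%:Z) <= X i <= x (inc n).2%:Z.
Proof.
elim: n => [|n IH]; first by rewrite leqn0 => /eqP -> /=; rewrite oppr0 lexx.
have hm k l : k <= l -> x k <= x l by exact: monoseq_homo.
rewrite leq_eqVlt ltnS => /orP[/eqP ->|/IH /andP[h1 h2]].
  rewrite includedS XseqS; case: ltP => h1 /=.
    by rewrite lexx andbT hm //; lia.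
  by case: ltP => h2 /=; [rewrite lexx hm //; lia|rewrite h1 h2].
rewrite includedS; case: ltP => _ /=.
  by rewrite h1 (le_trans h2) // hm //; lia.
by case: ltP => _ /=; rewrite h2 ?h1 ?(le_trans _ h1) // hm //; lia.
Qed.

Lemma Xseq_max n : exists2 i, (i <= n)%N & X i = x (inc n).2%:Z.
Proof.
elim: n => [|n [i hi e]]; first by exists 0%N.
rewrite includedS; case: ltP => h1 /=.
  by exists n.+1 => //; rewrite XseqS ifT.
by exists i; [exact: ltnW|rewrite e; case: ifP].
Qed.

Lemma Xseq_min n : exists2 i, (i <= n)%N & X i = x (- (inc n).1%:Z).
Proof.
elim: n => [|n [i hi e]]; first by exists 0%N; rewrite //= oppr0.
rewrite includedS; case: ltP => h1 /=; first by exists i; [exact: ltnW|].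
case: ltP => h2 /=; last by exists i; [exact: ltnW|].
by exists n.+1 => //; rewrite XseqS ifF ?ifT //; apply/negbTE; rewrite -leNgt.
Qed.

Lemma Xseq_neq i j : (i < j)%N -> w j != X i.
Proof.
case: j => // j; case: gw => h1 h2; case: i => [_|i ij]; first exact: h1.
rewrite XseqS; case: ifP => _; first exact: h1.
case: ifP => _; first exact: h1.
by apply: h2; rewrite gtn_eqF.
Qed.

Lemma Xseq_le_max m : x (- (inc m).1%:Z) <= x (inc m).2%:Z.
Proof. by have /andP[h1 h2] := Xseq_bounds (leqnn m); exact: le_trans h2. Qed.

(** The rules for ties amount to comparing an earlier [X i] with the raw variable [w j] in place of
    [X j]: if [w j] exceeds the current maximum, item [j] goes on top even when the sequence [x]
    repeats that maximum, and symmetrically below. *)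
Lemma Xorder_lt i j : (i < j)%N -> L i j = (X i < w j) /\ L j i = (w j < X i).
Proof.
case: j => // m im; set j := m.+1.
have /andP[b1 b2] := Xseq_bounds (im : (i <= m)%N).
have eM : maxn i j = j by apply/maxn_idPr; exact: ltnW.
have eM' : maxn j i = j by rewrite maxnC.
have ji : (j < i)%N = false by apply/negbTE; rewrite -leqNgt ltnW.
have hm k l : k <= l -> x k <= x l by exact: monoseq_homo.
rewrite /Xorder eM eM' im ji !andTb !andFb !orbF !orFb.
(* An item that is both a running maximum and a running minimum has all values so far equal; hence
   outside the initial run the two rules for ties cannot conflict. *)
have run_eq : is_running_max x w j -> is_running_min x w j -> in_initial_run x w j.
  move=> /forallP h1 /forallP h2; apply/forallP => k; rewrite eq_le.
  rewrite (le_trans (h1 k) (h2 ord0)) /=.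
  exact: le_trans (h1 ord0) (h2 k).
have [up|up] := ltP (x (inc m).2%:Z) (w j).
  have wX : X i < w j by exact: le_lt_trans up.
  have Xj : X j = x (inc m).2.+1%:Z by rewrite XseqS ifT.
  have XX k : (k <= m)%N -> X k <= X j.
    by move=> /Xseq_bounds/andP[_ h]; rewrite Xj (le_trans h) // hm //; lia.
  have rm : is_running_max x w j.
    apply/forallP => k; have [->//|kj] := eqVneq (nat_of_ord k) j.
    by apply: XX; rewrite -ltnS ltn_neqAle kj /= -ltnS.
  rewrite wX (lt_gtF wX).
  have nb : introduced_below x w j = false.
    by apply/negbTE; rewrite /= -leNgt (le_trans (Xseq_le_max m)) // ltW.
  case: ifP => [_|nr]; first by rewrite nb; have -> : introduced_above x w j = true by exact: up.
  have hX := XX i im; rewrite rm andbT /=; split.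
    by move: hX; rewrite le_eqVlt orbC => ->.
  rewrite ltNge hX /=; apply/negbTE/negP => /andP[_ rmin].
  by move: nr; rewrite run_eq.
have [dn|dn] := ltP (w j) (x (- (inc m).1%:Z)).
  have wX : w j < X i by exact: lt_le_trans b1.
  have Xj : X j = x (- (inc m).1.+1%:Z) by rewrite XseqS ifF ?ifT //; apply/negbTE; rewrite -leNgt.
  have XX k : (k <= m)%N -> X j <= X k.
    by move=> /Xseq_bounds/andP[h _]; rewrite Xj (le_trans _ h) // hm //; lia.
  have rm : is_running_min x w j.
    apply/forallP => k; have [->//|kj] := eqVneq (nat_of_ord k) j.
    by apply: XX; rewrite -ltnS ltn_neqAle kj /= -ltnS.
  rewrite wX (lt_gtF wX).
  have na : introduced_above x w j = false by apply/negbTE; rewrite /= -leNgt.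
  case: ifP => [_|nr]; first by rewrite na; have -> : introduced_below x w j = true by exact: dn.
  have hX := XX i im; rewrite rm andbT /=; split.
    rewrite ltNge hX /=; apply/negbTE/negP => /andP[_ rmax].
    by move: nr; rewrite run_eq.
  by move: hX; rewrite le_eqVlt orbC => ->.
have Xj : X j = w j by rewrite XseqS !ifF //; apply/negbTE; rewrite -leNgt.
have ne : X i == w j = false by apply/negbTE; rewrite eq_sym Xseq_neq.
(* Here [X j] is the raw [w j], which genericity keeps apart from [x 0], so the initial run has
   ended. *)
have nr : in_initial_run x w j = false.
  apply/negbTE/negP => /forallP /(_ ord_max) /eqP h.
  have : X j = x 0 by exact: h.
  by rewrite Xj => e; case: gw => /(_ m 0) /eqP.
by rewrite nr Xj ne (eq_sym (w j)) ne !andFb !orbF.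
Qed.

Lemma Xorder_le i j : L i j -> X i <= X j.
Proof.
have hm k l : k <= l -> x k <= x l by exact: monoseq_homo.
have [ij|ji|->//] := ltngtP i j.
  rewrite (Xorder_lt ij).1; case: j ij => // m im.
  have /andP[b1 b2] := Xseq_bounds (im : (i <= m)%N).
  rewrite XseqS => h; case: ltP => h1; first by rewrite (le_trans b2) // hm //; lia.
  case: ltP => h2; last exact: ltW.
  by have := lt_trans h h2; rewrite ltNge b1.
rewrite (Xorder_lt ji).2; case: i ji => // m jm.
have /andP[b1 b2] := Xseq_bounds (jm : (j <= m)%N).
rewrite XseqS => h; case: ltP => h1; first by have := lt_trans h1 h; rewrite ltNge b2.
case: ltP => h2; last exact: ltW.
by rewrite (le_trans _ b1) // hm //; lia.
Qed.

Lemma Xorder_irr : irreflexive L.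
Proof. by move=> i; rewrite /Xorder ltnn ltxx /=; case: ifP. Qed.

Lemma Xorder_total i j : i != j -> L i j || L j i.
Proof.
wlog ij : i j / (i < j)%N.
  move=> h ne; have := ne; rewrite neq_ltn => /orP[/h|/h h']; first exact.
  by rewrite orbC h' // eq_sym.
by move=> _; have [-> ->] := Xorder_lt ij; rewrite -neq_lt eq_sym Xseq_neq.
Qed.

Lemma Xorder_strict_total : strict_total L.
Proof.
split; [exact: Xorder_irr| |exact: Xorder_total].
have asym i j : L i j -> L j i = false.
  have [ij|ji|->] := ltngtP i j; last by rewrite Xorder_irr.
    by have [-> ->] := Xorder_lt ij; exact: lt_gtF.
  by have [-> ->] := Xorder_lt ji; exact: lt_gtF.
have lt_ord i j : X i < X j -> L i j.
  move=> h; have ne : i != j by apply: contraTneq h => ->; rewrite ltxx.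
  have /orP[//|/Xorder_le] := Xorder_total ne.
  by rewrite leNgt h.
move=> b a c Lab Lbc.
have ab : a != b by apply: contraTneq Lab => ->; rewrite Xorder_irr.
have bc : b != c by apply: contraTneq Lbc => ->; rewrite Xorder_irr.
have ac : a != c by apply: contraTneq Lbc => <-; rewrite asym.
have Xab := Xorder_le Lab; have Xbc := Xorder_le Lbc.
(* The item of largest index is compared with the other two through its raw [w]. If this is the
   middle item [b], then [w b] lies strictly between [X a] and [X c]. *)
have [/andP[ac' bc']|/andP[ba' ca']|/andP[ab' cb']] :
    [\/ (a < c) && (b < c), (b < a) && (c < a) | (a < b) && (c < b)]%N.
  have [h|h|h] := ltngtP a c; last by rewrite h eqxx in ac.
  - have [h'|h'|h'] := ltngtP b c; last by rewrite h' eqxx in bc.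
      exact: Or31.
    by apply: Or33; rewrite (ltn_trans h).
  - have [h'|h'|h'] := ltngtP a b; last by rewrite h' eqxx in ab.
      by apply: Or33; rewrite (ltn_trans h).
    exact: Or32.
- rewrite (Xorder_lt ac').1; apply: le_lt_trans Xab _.
  by rewrite -(Xorder_lt bc').1.
- rewrite (Xorder_lt ca').2; apply: lt_le_trans Xbc.
  by rewrite -(Xorder_lt ba').2.
- apply: lt_ord; apply: (@lt_trans _ _ (w b)).
    by rewrite -(Xorder_lt ab').1.
  by rewrite -(Xorder_lt cb').2.
Qed.

Lemma Xorder_up m : is_up L m.+1 = (x (inc m).2%:Z < w m.+1).
Proof.
apply/is_upP/idP => [h|h i im].
  have [i im <-] := Xseq_max m.
  by rewrite -(Xorder_lt (im : (i < m.+1)%N)).1 h.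
have /andP[_ b2] := Xseq_bounds (im : (i <= m)%N).
by rewrite (Xorder_lt im).1 (le_lt_trans b2).
Qed.

Lemma Xorder_dn m : is_dn L m.+1 = (w m.+1 < x (- (inc m).1%:Z)).
Proof.
apply/is_dnP/idP => [h|h i im].
  have [i im <-] := Xseq_min m.
  by rewrite -(Xorder_lt (im : (i < m.+1)%N)).2 h.
have /andP[b1 _] := Xseq_bounds (im : (i <= m)%N).
by rewrite (Xorder_lt im).2 (lt_le_trans h).
Qed.

Lemma included_recs n : inc n = (ndn L n, nup L n).
Proof.
have stL := Xorder_strict_total.
elim: n => [//|n IH]; rewrite includedS ndnS nupS -Xorder_up -Xorder_dn.
case h : (is_up L n.+1); first by rewrite IH (is_dn_up stL h) addn0 addn1.
by case: (is_dn L n.+1); rewrite IH ?addn0 ?addn1.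
Qed.

Lemma Xseq_recs n a : (a < size (recs L n))%N ->
  X (nth 0%N (recs L n) a) = x (a%:Z - (ndn L n)%:Z).
Proof.
have stL := Xorder_strict_total.
elim: n a => [[]//|n IH] a; rewrite ndnS.
have -> : recs L n.+1 = if is_up L n.+1 then rcons (recs L n) n.+1
  else if is_dn L n.+1 then n.+1 :: recs L n else recs L n by [].
have := Xorder_up n; have := Xorder_dn n.
case hu : (is_up L n.+1) => hd hu'.
  rewrite (is_dn_up stL hu) addn0 size_rcons ltnS leq_eqVlt nth_rcons => /orP[/eqP ->|alt].
    rewrite ltnn eqxx XseqS -hu' included_recs size_recs //=; congr (x _); lia.
  by rewrite alt IH.
case hd' : (is_dn L n.+1); last by rewrite addn0; exact: IH.
case: a => [_|a].
  rewrite (_ : nth 0%N (n.+1 :: recs L n) 0 = n.+1) //.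
  by rewrite XseqS -hu' -hd hd' included_recs /=; congr (x _); lia.
by rewrite -[nth _ _ _]/(nth 0%N (recs L n) a) /= ltnS => /IH ->; congr (x _); lia.
Qed.

Lemma Xorder_ltn_typ m b : (b < size (recs L m))%N ->
  (b < typ L m m.+1)%N = (x (b%:Z - (ndn L m)%:Z) < w m.+1).
Proof.
have stL := Xorder_strict_total.
move=> bs; rewrite ltn_typ // (Xorder_lt _).1 ?Xseq_recs //.
by have := mem_nth 0%N bs; rewrite mem_recs => /andP[].
Qed.

Lemma Xseq_nrec i : ~~ is_rec L i -> X i = w i.
Proof.
case: i => // m; rewrite /is_rec negb_or Xorder_up Xorder_dn => /andP[h1 h2].
by rewrite XseqS (negbTE h1) (negbTE h2).
Qed.

Lemma Xorder_nrec i j : ~~ is_rec L i -> ~~ is_rec L j -> L i j = (w i < w j).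
Proof.
move=> ni nj; have [ij|ji|->] := ltngtP i j; last by rewrite Xorder_irr ltxx.
  by rewrite (Xorder_lt ij).1 Xseq_nrec.
by rewrite (Xorder_lt ji).2 Xseq_nrec.
Qed.

End Generated.

(** * Uniform variables and the lengths of gaps *)

Section UniformLaw.
Variable R : realType.
Local Notation U := (uniform_prob (@ltr01 R)).

Lemma uniform_prob01 (A : set R) : measurable A ->
  U A = lebesgue_measure (A `&` `[0, 1]).
Proof.
move=> mA; rewrite /uniform_prob integral_uniform_pdf.
have mI : measurable (A `&` `[0, 1]%classic) by exact: measurableI.
rewrite -[RHS]mul1e -integral_cst //; apply: eq_integral => y /set_mem [_ /=].
by rewrite in_itv /= /uniform_pdf => ->; rewrite subr0 invr1.
Qed.

Lemma uniform_prob_set1 a : U [set a] = 0%E.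
Proof.
rewrite uniform_prob01 //; apply/eqP; rewrite eq_le measure_ge0 andbT.
rewrite -(lebesgue_measure_set1 a) le_measure ?inE //; exact: measurableI.
Qed.

(** The outermost gaps are unbounded, as the construction makes a record of any value beyond the
    current extremes; under the uniform law this gives the same lengths as the bounds 0 and 1 in
    [gap_len]. *)
Definition in_gap (x : int -> R) (l u a : nat) (w : R) : bool :=
  ((a == 0%N) || (x (a.-1%:Z - l%:Z) < w)) &&
  ((a == (l + u).+1) || (w < x (a%:Z - l%:Z))).

Lemma measurable_in_gap x l u a : measurable [set w | in_gap x l u a w].
Proof.
rewrite [X in measurable X](_ : _ =
  (if a == 0%N then setT else `]x (a.-1%:Z - l%:Z), +oo[%classic) `&`
  (if a == (l + u).+1 then setT else `]-oo, x (a%:Z - l%:Z)[%classic)).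
  by apply: measurableI; case: ifP.
apply/seteqP; rewrite /in_gap; split => w /=.
  by move=> /andP[]; case: ifP => _; case: ifP => _ //= h1 h2; split => //=; rewrite in_itv /= ?h1 ?h2.
by case: ifP => _; case: ifP => _ //= -[] //; rewrite /= ?in_itv /= ?andbT // => -> ->.
Qed.

Lemma uniform_prob_gap (x : monoseq R) l u a : (a <= (l + u).+1)%N ->
  U [set w | in_gap x l u a w] = (gap_len x l u a)%:E.
Proof.
move=> ale; rewrite uniform_prob01; last exact: measurable_in_gap.
have h k := monoseq_itv x k; rewrite /in_gap /gap_len.
have /andP[h1 h2] := h (a%:Z - l%:Z); have /andP[h3 h4] := h (a.-1%:Z - l%:Z).
have h5 : x (a.-1%:Z - l%:Z) <= x (a%:Z - l%:Z) by apply: monoseq_homo; lia.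
set y := x (a.-1%:Z - l%:Z) in h3 h4 h5 *; set z := x (a%:Z - l%:Z) in h1 h2 h5 *.
have [a0|a0] := eqVneq a 0%N; have [a1|a1] := eqVneq a (l + u).+1.
- by rewrite a0 in a1.
- rewrite (_ : _ `&` _ = `[0, z[%classic); last first.
    apply/seteqP; split => w /=; rewrite !in_itv /=; first by move=> [-> /andP[-> _]].
    by move=> /andP[-> wz]; rewrite wz; split => //=; rewrite (le_trans (ltW wz)).
  rewrite lebesgue_measure_itv /= lte_fin subr0 sube0.
  by case: ltP => // z0; congr EFin; apply/eqP; rewrite eq_le h1 z0.
- rewrite (_ : _ `&` _ = `]y, 1]%classic); last first.
    apply/seteqP; split => w /=; rewrite !in_itv /=; first by rewrite andbT => -[-> /andP[_ ->]].
    by move=> /andP[yw ->]; rewrite yw; split => //=; rewrite (le_trans h3) // ltW.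
  rewrite lebesgue_measure_itv /= lte_fin -EFinB.
  by case: ltP => // y1; congr EFin; apply/eqP; rewrite eq_sym subr_eq0 eq_le h4 y1.
- rewrite (_ : _ `&` _ = `]y, z[%classic); last first.
    apply/seteqP; split => w /=; rewrite !in_itv /=; first by move=> [].
    move=> /andP[yw wz]; rewrite yw wz; split => //=.
    by rewrite (le_trans h3 (ltW yw)) (le_trans (ltW wz) h2).
  rewrite lebesgue_measure_itv /= lte_fin -EFinB.
  by case: ltP => // zy; congr EFin; apply/eqP; rewrite eq_sym subr_eq0 eq_le h5 zy.
Qed.

End UniformLaw.

Section IID.
Context (R : realType) (d : measure_display) (T : measurableType d).
Variables (P : probability T R) (W : nat -> {RV P >-> R}).
Hypothesis iidW : iid_uniform W.
Local Notation U := (uniform_prob (@ltr01 R)).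

Lemma prob_iid i (B : set R) : measurable B -> P (W i @^-1` B) = U B.
Proof. by move=> mB; have [h _] := iidW; rewrite -(h i B mB). Qed.

Lemma measurable_W i (B : set R) : measurable B -> measurable (W i @^-1` B).
Proof. by move=> mB; rewrite -[X in measurable X]setTI; apply: measurable_funP. Qed.

Lemma prob_iid_seq (s : seq nat) (B : nat -> set R) : uniq s ->
  (forall i, measurable (B i)) ->
  P [set t | forall i, i \in s -> B i (W i t)] = (\prod_(i <- s) U (B i))%E.
Proof.
move=> us mB; have [_ h] := iidW.
rewrite (eq_bigr (fun i => P (W i @^-1` B i))) => [|i _]; last by rewrite prob_iid.
by rewrite -h.
Qed.

(** Independence is a product rule for events, so the diagonal is covered by N + 1 squares of side
    1/(N + 1); their total probability is at most 1/(N + 1). *)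
Lemma prob_tie i j : i != j -> P [set t | W i t = W j t] = 0%E.
Proof.
move=> ij.
pose C (N k : nat) : set R := `[k%:R / N.+1%:R, k.+1%:R / N.+1%:R[%classic.
have mC N k : measurable (C N k) by rewrite /C; exact: measurable_itv.
have UC N k : (U (C N k) <= (N.+1%:R^-1)%:E)%E.
  rewrite uniform_prob01 //; apply: (@le_trans _ _ (lebesgue_measure (C N k))).
    by apply: measureIl; [exact: mC|exact: measurable_itv].
  rewrite /C lebesgue_measure_itv /= lte_fin; case: ltP => _; last by rewrite lee_fin invr_ge0.
  by rewrite -EFinB lee_fin -mulrBl -natr1 addrAC subrr add0r mul1r.
(* The cells are half-open, so the point 1 is left to [out]; it has probability 0. *)
pose out := `]-oo, 0[ `|` `[1, +oo[ : set R.
have mout : measurable out by apply: measurableU.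
have Uout : U out = 0%E.
  rewrite uniform_prob01 //; apply/eqP; rewrite eq_le measure_ge0 andbT.
  rewrite -(lebesgue_measure_set1 (1:R)) le_measure ?inE //; first exact: measurableI.
  move=> y [[] /=]; rewrite !in_itv /=.
    by move=> y0 /andP[]; rewrite leNgt y0.
  by rewrite andbT => y1 /andP[_ y1']; apply/eqP; rewrite eq_le y1 y1'.
have mtie : measurable [set t | W i t = W j t].
  rewrite [X in measurable X](_ : _ = [set t | (W i t == W j t) = true]).
    have := @measurable_fun_eqr _ _ _ setT (W i) (W j) (measurable_funP _) (measurable_funP _).
    by move=> /(_ measurableT [set true] I); rewrite setTI.
  by apply/seteqP; split => t /= /eqP.
have bound N : (P [set t | W i t = W j t] <= (N.+1%:R^-1)%:E)%E.
  pose F k := W i @^-1` C N k `&` W j @^-1` C N k.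
  have mF k : measurable (F k) by apply: measurableI; exact: measurable_W.
  have mFU : measurable (\big[setU/set0]_(k < N.+1) F k) by exact: bigsetU_measurable.
  apply: (@le_trans _ _ (P (W i @^-1` out `|` \big[setU/set0]_(k < N.+1) F k))).
    rewrite le_measure ?inE //; first by apply: measurableU => //; exact: measurable_W.
    move=> t /= e; have [h|h] := pselect (out (W i t)); [by left|right].
    have [y0 y1] : 0 <= W i t /\ W i t < 1.
      split; first by rewrite leNgt; apply/negP => h'; apply: h; left; rewrite /= in_itv.
      by rewrite ltNge; apply/negP => h'; apply: h; right; rewrite /= in_itv /= andbT.
    rewrite -bigcup_mkord; exists (Num.truncn (W i t * N.+1%:R)) => /=.
      rewrite truncn_lt_nat ?mulr_ge0 //; by rewrite -[X in _ < X]mul1r ltr_pM2r ?ltr0n.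
    suff hc : C N (Num.truncn (W i t * N.+1%:R)) (W i t) by split; rewrite /= -?e.
    rewrite /C /= in_itv /= ler_pdivrMr ?ltr0n // ltr_pdivlMr ?ltr0n //.
    by rewrite truncn_le ?truncnS_gt // mulr_ge0.
  have mo : measurable (W i @^-1` out) by exact: measurable_W.
  apply: (@le_trans _ _ (P (W i @^-1` out) + P (\big[setU/set0]_(k < N.+1) F k))%E).
    exact: measureU2.
  rewrite prob_iid // Uout add0e.
  apply: (@le_trans _ _ (\sum_(k < N.+1) P (F k))%E).
    by apply: (Boole_inequality P) => k _; exact: mF.
  apply: (@le_trans _ _ (\sum_(k < N.+1) (N.+1%:R^-1 * N.+1%:R^-1)%:E)%E).
    apply: lee_sum => k _.
    have -> : P (F k) = (U (C N k) * U (C N k))%E.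
      have := @prob_iid_seq [:: i; j] (fun=> C N k).
      rewrite !big_cons big_nil mule1 => <- //; last by rewrite /= inE ij.
      congr (P _); apply/seteqP; split => t /=.
        by move=> [h1 h2] l; rewrite !inE => /orP[] /eqP ->.
      by move=> h; split; apply: h; rewrite !inE eqxx ?orbT.
    by rewrite EFinM; apply: lee_pmul.
  rewrite sumEFin sumr_const card_ord lee_fin -[_ *+ _]mulr_natl mulrA divff ?pnatr_eq0 //.
  by rewrite mul1r.
apply/eqP; rewrite eq_le measure_ge0 andbT; apply/lee_addgt0Pr => e e0.
rewrite add0e; have [N hN] : exists N, (N.+1%:R^-1 : R) <= e.
  exists (Num.truncn e^-1); rewrite invf_ple ?posrE // ltW // truncnS_gt //.
exact: le_trans (bound N) _.
Qed.

End IID.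

(** * Generated permutations as events of the uniform variables *)

Section GapEvent.
Variable R : realType.

(* [in_gaps] prescribes the sequence of gaps of the generated order, and
   [gap_order] the order of the items inside each final gap. *)
Definition in_gaps (x : int -> R) (L0 : rel nat) (n : nat) (w : nat -> R) : Prop :=
  forall m, (m < n)%N -> in_gap x (ndn L0 m) (nup L0 m) (typ L0 m m.+1) (w m.+1).

Definition gap_order (L0 : rel nat) (n : nat) (w : nat -> R) : Prop :=
  forall i j, (i <= n)%N -> (j <= n)%N -> ~~ is_rec L0 i -> ~~ is_rec L0 j ->
    typ L0 n i = typ L0 n j -> (w i < w j) = L0 i j.

Section Fixed.
Variables (x : monoseq R) (w : nat -> R).
Hypothesis gw : generic x w.
Local Notation L := (Xorder x w).
Let stL : strict_total L := Xorder_strict_total gw.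

Lemma typ_in_gap m a : (a <= (ndn L m + nup L m).+1)%N ->
  (typ L m m.+1 == a) = in_gap x (ndn L m) (nup L m) a (w m.+1).
Proof.
move=> ale; rewrite eqn_leq andbC; congr (_ && _).
  have [->//|a0] := eqVneq a 0%N; rewrite /= -(Xorder_ltn_typ gw) ?size_recs ?prednK ?lt0n //.
have [->|a1] := eqVneq a _; first by rewrite typ_le.
rewrite /= leqNgt (Xorder_ltn_typ gw) ?size_recs // 1?ltn_neqAle ?a1 //.
rewrite -leNgt le_eqVlt; case: eqP => // e.
by have := gw.1 m (a%:Z - (ndn L m)%:Z); rewrite e eqxx.
Qed.

Lemma same_typ_in_gaps L0 n : strict_total L0 ->
  same_typ L L0 n <-> in_gaps x L0 n w.
Proof.
move=> stL0; elim: n => [|n [IH1 IH2]]; first by split.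
split=> h m; rewrite ltnS leq_eqVlt => /orP[/eqP ->|mn].
- have st : same_typ L L0 n by move=> k kn; apply: h; exact: ltnW.
  have [_ <- <-] := same_typ_recs stL stL0 st (leqnn n).
  by rewrite -typ_in_gap ?h //; have [_ -> ->] := same_typ_recs stL stL0 st (leqnn n); exact: typ_le.
- by apply: IH1 => // k kn; apply: h; exact: ltnW.
- have st : same_typ L L0 n by apply: IH2 => k kn; apply: h; exact: ltnW.
  apply/eqP; have := h n (leqnn _).
  have [_ <- <-] := same_typ_recs stL stL0 st (leqnn n).
  by rewrite -typ_in_gap //; have [_ -> ->] := same_typ_recs stL stL0 st (leqnn n); exact: typ_le.
- by apply: IH2 => // k kn; apply: h; exact: ltnW.
Qed.

(** By [same_typ_eq] a permutation amounts to its gaps and the order inside the gaps. For generic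
    [w] both become explicit inequalities on [w], since non-records carry their own [w]. *)
Lemma generated_gap L0 n : strict_total L0 ->
  generated_perms x w n.+1 = array_of L0 n.+1 <-> in_gaps x L0 n w /\ gap_order L0 n w.
Proof.
move=> stL0; rewrite -[generated_perms x w]/(array_of L); split.
  move=> /(array_of_eq _ stL stL0) e.
  have st : same_typ L L0 n.
    by move=> m mn; apply: (typ_first e) => //; exact: ltnW.
  split; first exact/same_typ_in_gaps.
  move=> i j ilen jlen ni nj _; rewrite -e //; symmetry.
  by apply: Xorder_nrec; rewrite // (same_typ_is_rec stL stL0 st).
move=> [/(same_typ_in_gaps _ stL0) st go]; apply/array_of_eq => // i j.
rewrite !ltnS; apply: (same_typ_eq stL stL0 st) => {}i {}j ilen jlen ni nj e.
have ni0 : ~~ is_rec L0 i by rewrite -(same_typ_is_rec stL stL0 st).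
have nj0 : ~~ is_rec L0 j by rewrite -(same_typ_is_rec stL stL0 st).
rewrite (Xorder_nrec gw) // go // -(same_typ_nrec stL stL0 st) // -?(same_typ_nrec stL stL0 st) //.
Qed.

End Fixed.

(** Records are added only at the two ends, so an inner gap keeps its bounding records. With indices
    counted from the center, its interval can be named by the gap at the final level. *)
Lemma in_gap_nrec (x : int -> R) L n m v : strict_total L -> (m < n)%N ->
  ~~ is_rec L m.+1 ->
  in_gap x (ndn L m) (nup L m) (typ L m m.+1) v =
  (x ((typ L n m.+1)%:Z - 1 - (ndn L n)%:Z) < v) && (v < x ((typ L n m.+1)%:Z - (ndn L n)%:Z)).
Proof.
move=> stL mn nr; have /andP[h1 h2] := nrec_typ stL nr.
have [s1 [s2 [_ el _]]] := recs_cat stL (ltnW mn).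
rewrite size_recs // in h2.
rewrite (typ_shift stL mn nr) /in_gap (gtn_eqF h1) (ltn_eqF h2) /=.
by congr ((x _ < _) && (_ < x _)); lia.
Qed.

Section Relabel.
Variables (L0 L1 : rel nat) (n : nat) (tau : 'S_n.+1).
Hypotheses (st0 : strict_total L0) (st1 : strict_total L1).
Hypothesis L01 : same_typ L0 L1 n.
Let f := lift_nat tau.
Let fV := lift_nat tau^-1.
Hypothesis L1f : forall i j, (i <= n)%N -> (j <= n)%N -> L1 i j = L0 (f i) (f j).

Let fle i : (i <= n)%N -> (f i <= n)%N.
Proof. by move=> h; rewrite -ltnS; apply: lift_nat_lt. Qed.

Let fVle i : (i <= n)%N -> (fV i <= n)%N.
Proof. by move=> h; rewrite -ltnS; apply: lift_nat_lt. Qed.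

Let fK : cancel f fV. Proof. exact: lift_natK. Qed.
Let fVK : cancel fV f. Proof. exact: lift_natVK. Qed.

(** The gaps determine all comparisons with a record, so [r] has the same rank in both orders. As
    the rank of [r] in [L1] is that of [f r] in [L0], injectivity of ranks gives the claim. *)
Lemma relabel_fix_rec r : (r <= n)%N -> is_rec L0 r -> f r = r.
Proof.
move=> rn rr; apply: (rank_inj st0 (n := n.+1)); rewrite ?inE ?ltnS ?fle //.
transitivity (rank L1 n.+1 r).
  rewrite -(relabel_rank L0 (@lift_nat_inj _ tau) (@lift_nat_lt _ tau) (@lift_nat_id _ tau)) //.
  by apply: eq_in_count => i; rewrite mem_iota => /andP[_ ilt]; rewrite L1f // -ltnS.
apply: eq_in_count => i; rewrite mem_iota => /andP[_ ilt].
by rewrite (same_typ_rec_r st0 st1 L01).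
Qed.

Lemma relabel_is_rec i : (i <= n)%N -> is_rec L0 (f i) = is_rec L0 i.
Proof.
move=> ilen; apply/idP/idP => h; last by rewrite relabel_fix_rec.
have := relabel_fix_rec (fle ilen) h => /(@lift_nat_inj _ tau) e.
by rewrite e in h.
Qed.

Lemma relabel_typ i : (i <= n)%N -> ~~ is_rec L0 i -> typ L0 n (f i) = typ L0 n i.
Proof.
move=> ilen nr; rewrite [RHS](same_typ_nrec st0 st1 L01) //.
have [e _ _] := same_typ_recs st0 st1 L01 (leqnn n).
rewrite /typ e; apply: eq_in_count => r; rewrite -e mem_recs => /andP[rn rr].
by rewrite L1f // (relabel_fix_rec rn).
Qed.

(** Only non-records are moved, and only inside their final gaps. By [in_gap_nrec] the interval
    prescribed for a non-record depends on that gap and not on the time of its arrival. *)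
Lemma in_gaps_relabel (x : int -> R) w :
  in_gaps x L0 n (w \o fV) <-> in_gaps x L1 n w.
Proof.
have same m : (m < n)%N -> in_gap x (ndn L1 m) (nup L1 m) (typ L1 m m.+1) =1
    in_gap x (ndn L0 m) (nup L0 m) (typ L0 m m.+1).
  by move=> mn v; have [_ -> ->] := same_typ_recs st0 st1 L01 (ltnW mn); rewrite L01.
have f0 : f 0%N = 0%N by exact: relabel_fix_rec.
have key k : (k < n)%N -> exists2 m, f k.+1 = m.+1 & (m < n)%N /\
    in_gap x (ndn L0 m) (nup L0 m) (typ L0 m m.+1) =1
    in_gap x (ndn L0 k) (nup L0 k) (typ L0 k k.+1).
  move=> kn; case e : (f k.+1) => [|m].
    have : f k.+1 = f 0%N by rewrite e f0.
    by move/(@lift_nat_inj _ tau).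
  exists m => //; have mn : (m < n)%N by rewrite -e fle.
  split=> // v; have [r|nr] := boolP (is_rec L0 k.+1).
    by move: e; rewrite relabel_fix_rec // => -[->].
  have nr' : ~~ is_rec L0 m.+1 by rewrite -e relabel_is_rec.
  by rewrite !(in_gap_nrec _ _ (n := n)) // -e relabel_typ.
split=> h k kn.
  rewrite same //; have [m e [mn <-]] := key k kn.
  by have := h m mn; rewrite /= -e fK.
have e1 : (fV k.+1 <= n)%N by exact: fVle.
case e : (fV k.+1) e1 => [|k'] k'n.
  by have := fVK k.+1; rewrite e f0.
have [m em [mn g]] := key k' k'n.
have emk : m = k by move: em; rewrite -e fVK => -[].
by subst m; rewrite g -same //= e; exact: h.
Qed.

Lemma gap_order_relabel w : gap_order L0 n (w \o fV) <-> gap_order L1 n w.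
Proof.
have r01 i : (i <= n)%N -> is_rec L1 i = is_rec L0 i.
  by move=> h; rewrite (same_typ_is_rec st0 st1 L01).
have t01 i : (i <= n)%N -> ~~ is_rec L0 i -> typ L1 n i = typ L0 n i.
  by move=> h nr; rewrite (same_typ_nrec st0 st1 L01).
split=> h i j ilen jlen.
  rewrite !r01 // => ni nj; rewrite !t01 // => e.
  have := h (f i) (f j) (fle ilen) (fle jlen).
  by rewrite /= !fK !relabel_is_rec // !relabel_typ // -L1f //; apply.
move=> ni nj e.
have ri : ~~ is_rec L0 (fV i) by rewrite -relabel_is_rec ?fVle // fVK.
have rj : ~~ is_rec L0 (fV j) by rewrite -relabel_is_rec ?fVle // fVK.
have := h (fV i) (fV j) (fVle ilen) (fVle jlen).
have iV := fVle ilen; have jV := fVle jlen.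
rewrite (r01 _ iV) (r01 _ jV) (t01 _ iV) // (t01 _ jV) //.
rewrite -(relabel_typ iV ri) -(relabel_typ jV rj) (L1f iV jV) /= !fVK.
by apply.
Qed.

End Relabel.

End GapEvent.

(** * The joint law of the uniform variables, on an alias of [nat -> R] that carries the product
    sigma-algebra *)

Definition rseq (R : realType) : Type := nat -> R.

Section RSeq.
Variable R : realType.

HB.instance Definition _ := gen_eqMixin (rseq R).
HB.instance Definition _ := gen_choiceMixin (rseq R).
HB.instance Definition _ := isPointed.Build (rseq R) (fun=> 0).

Definition rseq_cylinders : set (set (rseq R)) :=
  [set A | exists (i : nat) (B : set R), measurable B /\ A = [set w : rseq R | B (w i)]].

HB.instance Definition _ :=
  @isMeasurable.Build (sigma_display rseq_cylinders)
    (rseq R) <<s rseq_cylinders >>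
    (@sigma_algebra0 _ setT _) (@sigma_algebraC _ _)
    (@sigma_algebra_bigcup _ setT _).

Lemma measurable_rseq_coord i : measurable_fun setT (fun w : rseq R => w i).
Proof.
move=> _ B mB; rewrite setTI; apply: sub_sigma_algebra.
by exists i, B; split.
Qed.

Lemma measurable_fun_rseq d (T : measurableType d) (f : T -> rseq R) :
  (forall i, measurable_fun setT (fun t => f t i)) -> measurable_fun setT f.
Proof.
move=> mf; apply: (measurability rseq_cylinders) => //.
by move=> _ [_ [i [B [mB ->]]] <-]; exact: (mf i measurableT B mB).
Qed.

Definition rseq_boxes : set (set (rseq R)) :=
  [set A | exists (n : nat) (B : nat -> set R), (forall i, measurable (B i)) /\
    A = [set w : rseq R | forall i, (i < n)%N -> B i (w i)]].

Lemma rseq_boxes_measurable : rseq_boxes `<=` measurable.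
Proof.
move=> _ [n [B [mB ->]]].
rewrite [X in measurable X](_ : _ = \bigcap_i
   (if (i < n)%N then [set w : rseq R | B i (w i)] else setT)).
  apply: bigcap_measurable => [|i _]; first by exists 0%N.
  case: ifP => _ //; have := measurable_rseq_coord i measurableT (mB i).
  by rewrite setTI.
apply/seteqP; split => [w h i _|w h i ilt] /=; first by case: ifP => // /h.
by have := h i I; rewrite ilt.
Qed.

Lemma rseq_boxesE : @measurable _ (rseq R) = <<s rseq_boxes >>.
Proof.
apply/seteqP; split; last first.
  by apply: smallest_sub; [exact: sigma_algebra_measurable|exact: rseq_boxes_measurable].
apply: smallest_sub; first exact: smallest_sigma_algebra.
move=> _ [i [B [mB ->]]]; apply: sub_sigma_algebra.
exists i.+1, (fun j => if j == i then B else setT); split => [j|]; first by case: ifP.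
apply/seteqP; split => w /= h; last by have := h i (ltnSn i); rewrite eqxx.
by move=> j _; case: eqP => [->|].
Qed.

Lemma rseq_boxesI : setI_closed rseq_boxes.
Proof.
move=> _ _ [n [B [mB ->]]] [m [C [mC ->]]]; exists (maxn n m).
exists (fun i => (if (i < n)%N then B i else setT) `&` (if (i < m)%N then C i else setT)).
split=> [i|]; first by apply: measurableI; case: ifP.
apply/seteqP; split => w /=.
  by move=> [h1 h2] i _; split; case: ifP => // ?; first [exact: h1|exact: h2].
by move=> h; split => i ilt; have := h i; rewrite leq_max ilt ?orbT => /(_ isT) [].
Qed.

End RSeq.

Section Law.
Context (R : realType) (d : measure_display) (T : measurableType d).
Variables (P : probability T R) (W : nat -> {RV P >-> R}).
Hypothesis iidW : iid_uniform W.

Definition rseq_of (t : T) : rseq R := fun n => W n t.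

Lemma measurable_rseq_of : measurable_fun setT rseq_of.
Proof. by apply: measurable_fun_rseq => i; exact: measurable_funP. Qed.

HB.instance Definition _ := isMeasurableFun.Build _ _ _ _ rseq_of measurable_rseq_of.

Lemma law_permuted (f fV : nat -> nat) (B : set (rseq R)) :
  cancel f fV -> cancel fV f -> measurable B ->
  P [set t | B (rseq_of t \o fV)] = P [set t | B (rseq_of t)].
Proof.
move=> fK fVK mB; pose g t : rseq R := rseq_of t \o fV.
have mg : measurable_fun setT g.
  by apply: measurable_fun_rseq => i; exact: measurable_funP.
pose mixin := isMeasurableFun.Build _ _ _ _ g mg.
pose gm : {mfun T >-> rseq R} := HB.pack g mixin.
pose m1 : {measure set (rseq R) -> \bar R} := distribution P gm.
pose m2 : {measure set (rseq R) -> \bar R} := distribution P rseq_of.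
rewrite -[LHS]/(m1 B) -[RHS]/(m2 B).
apply: (measure_unique (@rseq_boxes R) (fun=> setT)) => //.
- exact: rseq_boxesE.
- exact: rseq_boxesI.
- by move=> _; exists 0%N, (fun=> setT); split => //; apply/seteqP.
- by apply/seteqP; split => // w _; exists 0%N.
- move=> _ [n [C [mC ->]]].
  rewrite /m1 /m2 /= /distribution /pushforward.
  have u : uniq (iota 0 n) by exact: iota_uniq.
  have e1 : g @^-1` [set w | forall i, (i < n)%N -> C i (w i)] =
      [set t | forall i, i \in map fV (iota 0 n) -> C (f i) (W i t)].
    apply/seteqP; split => t /= h i.
      by move=> /mapP[k + ->]; rewrite mem_iota fVK => /andP[_ /h].
    by move=> ilt; rewrite -[i in C i]fVK; apply: h; apply: map_f; rewrite mem_iota.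
  have e2 : rseq_of @^-1` [set w | forall i, (i < n)%N -> C i (w i)] =
      [set t | forall i, i \in iota 0 n -> C i (W i t)].
    apply/seteqP; split => t /= h i; first by rewrite mem_iota => /h.
    by move=> ilt; apply: h; rewrite mem_iota.
  have u' : uniq (map fV (iota 0 n)) by rewrite (map_inj_uniq (can_inj fVK)).
  rewrite e1 e2 (prob_iid_seq iidW u' (fun i => mC (f i))) (prob_iid_seq iidW u mC).
  by rewrite big_map; apply: eq_bigr => i _; rewrite fVK.
- by move=> _; rewrite /m1 /= /distribution /pushforward preimage_setT probability_setT ltry.
Qed.

Lemma generic_ae (x : monoseq R) : {ae P, forall t, generic x (rseq_of t)}.
Proof.
have aeC (Q : T -> Prop) : measurable [set t | Q t] -> P [set t | Q t] = 0%E ->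
    {ae P, forall t, ~ Q t}.
  move=> mQ PQ; exists [set t | Q t]; split => //.
  by move=> t /= h; apply: contrapT.
have h1 m (k : int) : {ae P, forall t, W m.+1 t != x k}.
  have : {ae P, forall t, ~ (W m.+1 @^-1` [set x k]) t}.
    apply: aeC; first by apply: measurable_W; exact: measurable_set1.
    by rewrite -[LHS]/(P (W m.+1 @^-1` [set x k])) prob_iid // uniform_prob_set1.
  by apply: filterS => t /= h; apply/eqP.
have h2 i j : i != j -> {ae P, forall t, W i.+1 t != W j.+1 t}.
  move=> ij; have : {ae P, forall t, ~ (W i.+1 t = W j.+1 t)}.
    apply: (aeC (fun t => W i.+1 t = W j.+1 t)); last exact: prob_tie.
    rewrite [X in measurable X](_ : _ = [set t | (W i.+1 t == W j.+1 t) = true]).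
      have := @measurable_fun_eqr _ _ _ setT (W i.+1) (W j.+1) (measurable_funP _) (measurable_funP _).
      by move=> /(_ measurableT [set true] I); rewrite setTI.
    by apply/seteqP; split => t /= /eqP.
  by apply: filterS => t /= h; apply/eqP.
(* [ae_foralln] ranges over [nat], so the integer index is split into its two constructors. *)
have h1' : {ae P, forall t, forall m n, W m.+1 t != x (Posz n) /\ W m.+1 t != x (Negz n)}.
  apply: ae_foralln => m; apply: ae_foralln => n.
  by move: (h1 m (Posz n)) (h1 m (Negz n)); apply: filterS2 => t a b; split.
have h2' : {ae P, forall t, forall i j, i != j -> W i.+1 t != W j.+1 t}.
  apply: ae_foralln => i; apply: ae_foralln => j.
  have [->|ij] := eqVneq i j; first by apply: nearW => t; rewrite eqxx.
  by have := h2 i j ij; apply: filterS => t h _.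
move: h1' h2'; apply: filterS2 => t g1 g2; split=> // m [] n.
  by case: (g1 m n).
by case: (g1 m n).
Qed.

Lemma prob_in_gaps (x : monoseq R) (L0 : rel nat) n : strict_total L0 ->
  P [set t | in_gaps x L0 n (rseq_of t)] = (typ_prob x L0 n)%:E.
Proof.
move=> st0.
pose B i := [set v | in_gap x (ndn L0 i.-1) (nup L0 i.-1) (typ L0 i.-1 i) v].
have -> : [set t | in_gaps x L0 n (rseq_of t)] =
    [set t | forall i, i \in iota 1 n -> B i (W i t)].
  apply/seteqP; split => t /= h; last by move=> m mn; apply: (h m.+1); rewrite mem_iota.
  by move=> i; rewrite mem_iota; case: i => // m /andP[_]; rewrite add1n ltnS => /h.
rewrite prob_iid_seq ?iota_uniq //; last by move=> i; exact: measurable_in_gap.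
elim: n => [|n IH]; first by rewrite big_nil.
rewrite iotaSr big_rcons /= IH EFinM; congr (_ * _)%E.
by rewrite uniform_prob_gap // typ_le.
Qed.

End Law.

(** * Joint measurability of the construction in [x] and [w] *)

Section JointMeasurability.
Variable R : realType.
Local Notation Z := (monoseq R * rseq R)%type.
Implicit Type z : Z.

Lemma measurable_fun_nat (d : measure_display) (T : measurableType d)
    (g : T -> nat) (F : nat -> nat) :
  measurable_fun setT g -> measurable_fun setT (fun t => F (g t)).
Proof. by move=> mg; apply: (measurableT_comp (f := F)). Qed.

(** The coordinate that is read is itself random; the preimage is split over its countably many
    values. *)
Lemma measurable_fun_index (g : Z -> nat) (F : nat -> int) :
  measurable_fun setT g -> measurable_fun setT (fun z => z.1 (F (g z))).
Proof.
move=> mg _ B mB; rewrite setTI.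
rewrite [X in measurable X](_ : _ = \bigcup_k (g @^-1` [set k] `&`
    (fun z : Z => z.1 (F k)) @^-1` B)).
  apply: bigcup_measurable => k _; apply: measurableI.
    by have := mg measurableT [set k] I; rewrite setTI.
  have : measurable_fun setT (fun z : Z => z.1 (F k)).
    by apply: measurableT_comp (measurable_fun_coord (F k)) _; exact: measurable_fst.
  by move=> /(_ measurableT B mB); rewrite setTI.
apply/seteqP; split => [z Bz|z [k _ [/= <-]] //].
by exists (g z).
Qed.

Lemma measurable_snd_coord i : measurable_fun setT (fun z => z.2 i : R).
Proof. by apply: measurableT_comp (@measurable_rseq_coord R i) _; exact: measurable_snd. Qed.

Lemma measurable_included n :
  measurable_fun setT (fun z => (included z.1 z.2 n).1) /\
  measurable_fun setT (fun z => (included z.1 z.2 n).2).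
Proof.
elim: n => [|n [IH1 IH2]]; first by split; exact: measurable_cst.
have c1 : measurable_fun setT (fun z => z.1 (included z.1 z.2 n).2%:Z < z.2 n.+1).
  apply: measurable_fun_ltr; last exact: measurable_snd_coord.
  exact: (@measurable_fun_index _ (fun k => k%:Z) IH2).
have c2 : measurable_fun setT (fun z => z.2 n.+1 < z.1 (- (included z.1 z.2 n).1%:Z)).
  apply: measurable_fun_ltr; first exact: measurable_snd_coord.
  exact: (@measurable_fun_index _ (fun k => - k%:Z) IH1).
split.
- rewrite (_ : (fun z => _) = fun z =>
    if z.1 (included z.1 z.2 n).2%:Z < z.2 n.+1 then (included z.1 z.2 n).1
    else if z.2 n.+1 < z.1 (- (included z.1 z.2 n).1%:Z) then (included z.1 z.2 n).1.+1
    else (included z.1 z.2 n).1); last first.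
    by apply/funext => z; rewrite includedS; case: ifP => // _; case: ifP.
  apply: measurable_fun_if => //; first exact: measurable_funTS.
  apply: measurable_funTS; apply: measurable_fun_if => //; apply: measurable_funTS => //.
  exact: measurable_fun_nat.
- rewrite (_ : (fun z => _) = fun z =>
    if z.1 (included z.1 z.2 n).2%:Z < z.2 n.+1 then (included z.1 z.2 n).2.+1
    else (included z.1 z.2 n).2); last first.
    by apply/funext => z; rewrite includedS; case: ifP => // _; case: ifP.
  apply: measurable_fun_if => //; apply: measurable_funTS => //.
  exact: measurable_fun_nat.
Qed.

Lemma measurable_introduced_above j : measurable_fun setT (fun z => introduced_above z.1 z.2 j).
Proof.
case: j => [|n] /=; first exact: measurable_cst.
apply: measurable_fun_ltr; last exact: measurable_snd_coord.
exact: (@measurable_fun_index _ (fun k => k%:Z) (measurable_included n).2).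
Qed.

Lemma measurable_introduced_below j : measurable_fun setT (fun z => introduced_below z.1 z.2 j).
Proof.
case: j => [|n] /=; first exact: measurable_cst.
apply: measurable_fun_ltr; first exact: measurable_snd_coord.
exact: (@measurable_fun_index _ (fun k => - k%:Z) (measurable_included n).1).
Qed.

Lemma measurable_Xseq n : measurable_fun setT (fun z => Xseq z.1 z.2 n).
Proof.
case: n => [|n].
  by apply: measurableT_comp (measurable_fun_coord 0) _; exact: measurable_fst.
have [i1 i2] := measurable_included n.
rewrite (_ : (fun z => _) = fun z =>
  if introduced_above z.1 z.2 n.+1 then z.1 (included z.1 z.2 n).2.+1%:Z
  else if introduced_below z.1 z.2 n.+1 then z.1 (- (included z.1 z.2 n).1.+1%:Z)
  else z.2 n.+1); last by apply/funext => z; rewrite XseqS.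
apply: measurable_fun_if => //; first exact: measurable_introduced_above.
  by apply: measurable_funTS; exact: (@measurable_fun_index _ (fun k => k.+1%:Z) i2).
apply: measurable_funTS; apply: measurable_fun_if => //; first exact: measurable_introduced_below.
  by apply: measurable_funTS; exact: (@measurable_fun_index _ (fun k => - k.+1%:Z) i1).
by apply: measurable_funTS; exact: measurable_snd_coord.
Qed.

Lemma measurable_fun_forall (d : measure_display) (T : measurableType d) m
    (f : 'I_m -> T -> bool) : (forall k, measurable_fun setT (f k)) ->
  measurable_fun setT (fun t => [forall k, f k t]).
Proof.
move=> mf; apply: (measurable_fun_bool true); rewrite setTI.
rewrite [X in measurable X](_ : _ = \bigcap_(k in [set: 'I_m]) (f k @^-1` [set true])).
  apply: fin_bigcap_measurable => [|k _]; first exact: finite_finset.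
  by have := mf k measurableT [set true] I; rewrite setTI.
apply/seteqP; split => t /=.
  by move=> /forallP h k _; exact: h.
by move=> h; apply/forallP => k; exact: (h k I).
Qed.

Lemma measurable_Xorder i j : measurable_fun setT (fun z => Xorder z.1 z.2 i j).
Proof.
rewrite /Xorder; apply: measurable_fun_if => //.
- apply: measurable_fun_forall => k; apply: measurable_fun_eqr; exact: measurable_Xseq.
- apply: measurable_funTS; apply: measurable_or; apply: measurable_and => //.
    exact: measurable_introduced_above.
  exact: measurable_introduced_below.
- apply: measurable_funTS; apply: measurable_or; first by
    apply: measurable_fun_ltr; exact: measurable_Xseq.
  apply: measurable_or; apply: measurable_and => //; apply: measurable_and.
  + by apply: measurable_fun_eqr; exact: measurable_Xseq.
  + by apply: measurable_fun_forall => k; apply: measurable_fun_ler; exact: measurable_Xseq.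
  + by apply: measurable_fun_eqr; exact: measurable_Xseq.
  + by apply: measurable_fun_forall => k; apply: measurable_fun_ler; exact: measurable_Xseq.
Qed.

Lemma measurable_generated : measurable_fun setT (fun z => generated_perms z.1 z.2).
Proof.
apply: measurable_fun_perm_array => n s.
(* The permutation depends on the order through a finite table of comparisons, so the event is a
   finite union over the tables that yield [s]. *)
pose G (b : {ffun 'I_n * 'I_n -> bool}) := ranking_perm (fun i j => b (i, j)).
rewrite [X in measurable X](_ : _ = \bigcup_(b in [set b | G b = s])
  \bigcap_(ij in [set: 'I_n * 'I_n]) [set z : Z | Xorder z.1 z.2 ij.1 ij.2 = b ij]).
  apply: fin_bigcup_measurable => [|b _]; first exact: finite_finset.
  apply: fin_bigcap_measurable => [|ij _]; first exact: finite_finset.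
  by have := measurable_Xorder ij.1 ij.2; move=> /(_ measurableT [set b ij] I); rewrite setTI.
apply/seteqP; split => [z /= e|z [b /= <- h] /=].
  exists [ffun ij => Xorder z.1 z.2 (ij.1 : 'I_n) (ij.2 : 'I_n)] => /=; last first.
    by move=> ij _ /=; rewrite ffunE.
  rewrite -e; congr ranking_perm; apply/funext => i; apply/funext => j.
  by rewrite ffunE.
congr ranking_perm; apply/funext => i; apply/funext => j.
exact: (h (i, j) I).
Qed.

End JointMeasurability.

(** * The kernel of laws of generated permutations *)

Section GeneratedLaw.
Context (R : realType) (d : measure_display) (T : measurableType d).
Variables (P : probability T R) (W : nat -> {RV P >-> R}).
Hypothesis iidW : iid_uniform W.

Definition gen_fun (x : monoseq R) (t : T) : perm_array := generated_perms x (rseq_of W t).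

Lemma measurable_gen_fun x : measurable_fun setT (gen_fun x).
Proof.
have mp : measurable_fun setT (fun t => (x, rseq_of W t)).
  by apply/measurable_fun_pairP; split; [exact: measurable_cst|exact: measurable_rseq_of].
exact: measurableT_comp (@measurable_generated R) mp.
Qed.

HB.instance Definition _ x :=
  isMeasurableFun.Build _ _ _ _ (gen_fun x) (measurable_gen_fun x).

Definition gen_law (x : monoseq R) : {measure set perm_array -> \bar R} :=
  distribution P (gen_fun x).

Lemma gen_lawE x B : gen_law x B = P [set t | B (gen_fun x t)].
Proof. by []. Qed.

(** The law of the uniform sequence is evaluated on the [x]-sections of a jointly measurable set. *)
Lemma measurable_gen_law B : measurable B -> measurable_fun setT (gen_law ^~ B).
Proof.
move=> mB; pose A := (fun z : monoseq R * rseq R => generated_perms z.1 z.2) @^-1` B.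
have mA : measurable A.
  by rewrite -[A]setTI; exact: measurable_generated.
rewrite (_ : (fun x => _) = distribution P (rseq_of W) \o xsection A).
  exact: measurable_fun_xsection.
apply/funext => x; rewrite gen_lawE /= /distribution /pushforward; congr (P _).
by apply/seteqP; split => t; rewrite /= /xsection /= inE.
Qed.

HB.instance Definition _ := isKernel.Build _ _ _ _ R gen_law measurable_gen_law.

Lemma gen_law_setT x : gen_law x setT = 1%E.
Proof. by rewrite gen_lawE probability_setT. Qed.

HB.instance Definition _ := Kernel_isProbability.Build _ _ _ _ R gen_law gen_law_setT.

(** Coherence is derived for generic [w] only: with ties among interior values, [Xorder] need not be
    total. *)
Lemma gen_law_coherent x : gen_law x (~` [set p | coherent p]) = 0%E.
Proof.
rewrite gen_lawE; have [N [mN PN sub]] := generic_ae iidW x.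
apply/eqP; rewrite eq_le measure_ge0 andbT -PN le_measure ?inE //.
  rewrite -[X in measurable X]setTI; apply: (measurable_gen_fun x) => //.
  by apply: measurableC; exact: measurable_coherent.
move=> t /= nc; apply: sub => /= g; apply: nc.
by apply: array_of_coherent; exact: Xorder_strict_total.
Qed.

Lemma prob_eq_ae (A B : set T) : measurable A -> measurable B ->
  {ae P, forall t, A t <-> B t} -> P A = P B.
Proof.
move=> mA mB [N [mN PN sub]].
have aux (A' B' : set T) : measurable A' -> measurable B' ->
    (forall t, ~ N t -> A' t -> B' t) -> (P A' <= P B')%E.
  move=> mA' mB' h; apply: (@le_trans _ _ (P (B' `|` N))).
    rewrite le_measure ?inE //; first exact: measurableU.
    by move=> t At; have [|/h] := pselect (N t); [right|move=> /(_ At); left].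
  have := measureU2 P mB' mN; by rewrite [X in (_ <= _ + X)%E](_ : _ = 0%E) ?adde0.
have key t : ~ N t -> A t <-> B t by move=> nt; apply: contrapT => h; apply/nt/sub.
by apply/eqP; rewrite eq_le !aux // => t /key [].
Qed.

Definition gap_set (x : int -> R) (L0 : rel nat) n : set (rseq R) :=
  [set w | in_gaps x L0 n w /\ gap_order L0 n w].

Lemma measurable_gap_set x L0 n : measurable (gap_set x L0 n).
Proof.
have mc i (B : set R) : measurable B -> measurable [set w : rseq R | B (w i)].
  by move=> mB; have := measurable_rseq_coord i measurableT mB; rewrite setTI.
rewrite (_ : gap_set x L0 n =
  (\bigcap_m [set w : rseq R | (m < n)%N ->
     in_gap x (ndn L0 m) (nup L0 m) (typ L0 m m.+1) (w m.+1)]) `&`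
  (\bigcap_i \bigcap_j [set w : rseq R | [&& i <= n, j <= n, ~~ is_rec L0 i, ~~ is_rec L0 j
     & typ L0 n i == typ L0 n j]%N -> (w i < w j) = L0 i j])).
  apply: measurableI.
    apply: bigcap_measurable => [|m _]; first by exists 0%N.
    have [mn|nm] := ltnP m n.
      rewrite [X in measurable X](_ : _ = [set w : rseq R | [set v | in_gap x (ndn L0 m) (nup L0 m) (typ L0 m m.+1) v] (w m.+1)]).
        by apply: mc; exact: measurable_in_gap.
      by apply/seteqP; split => w /= h //; exact: h.
    by rewrite [X in measurable X](_ : _ = setT) //; apply/seteqP.
  apply: bigcap_measurable => [|i _]; first by exists 0%N.
  apply: bigcap_measurable => [|j _]; first by exists 0%N.
  case: [&& _, _, _, _ & _].
    rewrite [X in measurable X](_ : _ = [set w : rseq R | (w i < w j) = L0 i j]).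
      have := @measurable_fun_ltr _ _ R setT (fun w : rseq R => w i) (fun w => w j)
         (measurable_rseq_coord i) (measurable_rseq_coord j).
      by move=> /(_ measurableT [set L0 i j] I); rewrite setTI.
    by apply/seteqP; split => w /= h //; exact: h.
  by rewrite [X in measurable X](_ : _ = setT) //; apply/seteqP.
apply/seteqP; split => w.
  move=> [h1 h2]; split; first by move=> m _; exact: h1.
  by move=> i _ j _ /= /and5P[a b c e /eqP]; exact: h2.
move=> [h1 h2]; split; first by move=> m mn; exact: (h1 m I mn).
move=> i j a b c e /eqP f; apply: (h2 i I j I).
by rewrite /= a b c e f.
Qed.

Lemma measurable_rseq_event (B : set (rseq R)) : measurable B ->
  measurable [set t | B (rseq_of W t)].
Proof.
by move=> mB; rewrite -[X in measurable X]setTI; exact: (measurable_rseq_of W).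
Qed.

Lemma gen_law_array_of (x : monoseq R) L0 n : strict_total L0 ->
  gen_law x [set p | p n.+1 = array_of L0 n.+1] = P [set t | gap_set x L0 n (rseq_of W t)].
Proof.
move=> st0; rewrite gen_lawE; apply: prob_eq_ae.
- rewrite -[X in measurable X]setTI.
  by apply: (measurable_gen_fun x) => //; exact: (measurable_cyl [set array_of L0 n.+1]).
- exact: (measurable_rseq_event (measurable_gap_set x L0 n)).
- have := generic_ae iidW x; apply: filterS => t g.
  exact: generated_gap.
Qed.

(** The permutation [tau] turns [L0] into [L1] by moving items inside their final gaps. The event
    for [L1] is the event for [L0] with the uniform variables permuted accordingly, which does not
    change their joint law. *)
Lemma gen_law_same_typ (x : monoseq R) L0 L1 n :
  strict_total L0 -> strict_total L1 -> same_typ L0 L1 n ->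
  gen_law x [set p | p n.+1 = array_of L0 n.+1] = gen_law x [set p | p n.+1 = array_of L1 n.+1].
Proof.
move=> st0 st1 L01; rewrite !gen_law_array_of //.
pose tau := (array_of L1 n.+1 * (array_of L0 n.+1)^-1)%g.
have L1f i j : (i <= n)%N -> (j <= n)%N -> L1 i j = L0 (lift_nat tau i) (lift_nat tau j).
  move=> ilen jlen.
  rewrite (lift_nat_ord tau (Ordinal (ilen : (i < n.+1)%N))).
  rewrite (lift_nat_ord tau (Ordinal (jlen : (j < n.+1)%N))).
  by rewrite -(ltn_array_of st0) !permM !permKV ltn_array_of.
rewrite -(law_permuted iidW (lift_natK tau) (lift_natVK tau) (measurable_gap_set x L0 n)).
congr (P _); apply/seteqP; split => t; rewrite /gap_set /=.
  by move=> [/(in_gaps_relabel st0 st1 L01 L1f) h1 /(gap_order_relabel st0 st1 L01 L1f) h2].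
by move=> [/(in_gaps_relabel st0 st1 L01 L1f) h1 /(gap_order_relabel st0 st1 L01 L1f) h2].
Qed.

End GeneratedLaw.

Lemma measure_cyl_sum (R : realType) (m : {measure set perm_array -> \bar R}) n
    (E : pred 'S_n) :
  m (cyl [set s | E s]) = (\sum_(s | E s) m [set p | p n = s])%E.
Proof.
have mc s : measurable [set p : perm_array | p n = s] := measurable_cyl [set s].
have e : cyl [set s | E s] = \big[setU/set0]_(s <- enum E) [set p : perm_array | p n = s].
  rewrite -bigcup_seq; apply/seteqP; split => [p Ep|p [s /= Es eps]].
    by exists (p n) => //=; rewrite mem_enum.
  by rewrite /cyl /= eps; move: Es; rewrite mem_enum.
have mE : measurable (cyl [set s | E s]) by exact: measurable_cyl.
rewrite -[LHS]mul1e -integral_cst // e ge0_integral_bigsetU //.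
- by rewrite big_enum /=; apply: eq_bigr => s _; rewrite integral_cst ?mul1e.
- exact: enum_uniq.
- by move=> a b _ _ [p [/= <- <-]].
Qed.

(** * Disintegration *)

Section MixtureMeasure.
Context (R : realType) (d d1 d2 : measure_display) (T : measurableType d)
  (E1 : measurableType d1) (E2 : measurableType d2).
Variables (P : probability T R) (Z : {mfun T >-> E1}) (k : R.-ker E1 ~> E2).
Variables (D : set T) (mD : measurable D).

(** Carrying the proof [mD'] as an argument makes the measurability of [D] available when the
    measure structure is inferred. *)
Definition mixture (mD' : measurable D) (B : set E2) : \bar R := (\int[P]_(t in D) k (Z t) B)%E.

Let mixture0 : mixture mD set0 = 0%E.
Proof. by rewrite /mixture; under eq_integral do rewrite measure0; rewrite integral0. Qed.

Let mixture_ge0 B : (0 <= mixture mD B)%E.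
Proof. by apply: integral_ge0 => t _; exact: measure_ge0. Qed.

Let mixture_sigma_additive : semi_sigma_additive (mixture mD).
Proof.
move=> F mF tF mUF.
have mk n : measurable_fun D (fun t => k (Z t) (F n)).
  apply: measurable_funTS; apply: measurableT_comp (measurable_kernel k _ (mF n)) _.
  exact: measurable_funP.
have -> : mixture mD (\bigcup_n F n) = (\sum_(0 <= n <oo) mixture mD (F n))%E.
  rewrite /mixture -integral_nneseries //; apply: eq_integral => t _.
  exact: measure_semi_bigcup.
by apply: is_cvg_nneseries => n _ _; exact: mixture_ge0.
Qed.

HB.instance Definition _ := isMeasure.Build _ _ _ (mixture mD)
  mixture0 mixture_ge0 mixture_sigma_additive.

End MixtureMeasure.

Section Disintegration.
Context (R : realType) (d : measure_display) (T : measurableType d).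
Variables (P : probability T R) (perms : {RV P >-> perm_array}).
Hypothesis coherent_perms : forall t : T, coherent (perms t).
Hypothesis uniform_given_rec : forall (n : nat) (s1 s2 : 'S_n), rec s1 = rec s2 ->
  P [set t | perms t n = s1] = P [set t | perms t n = s2].
Context (d' : measure_display) (T' : measurableType d') (P' : probability T' R).
Variable W : nat -> {RV P' >-> R}.
Hypothesis iidW : iid_uniform W.

Local Notation rho t := (rho_of R (perms t)).

Lemma gen_law_class (x : monoseq R) L0 n : strict_total L0 ->
  (\sum_(s : 'S_n.+1 | same_typb L0 n (perm_order s)) gen_law W x [set p | p n.+1 = s] =
   (typ_prob x L0 n)%:E)%E.
Proof.
move=> st0; rewrite -(measure_cyl_sum (gen_law W x) (fun s : 'S_n.+1 => same_typb L0 n (perm_order s))).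
rewrite -(prob_in_gaps iidW x n st0) gen_lawE; apply: prob_eq_ae.
- rewrite -[X in measurable X]setTI; apply: (measurable_gen_fun W x) => //.
  exact: measurable_cyl.
- rewrite (_ : [set t | _] = [set t | (\bigcap_m [set w : rseq R | (m < n)%N ->
     in_gap x (ndn L0 m) (nup L0 m) (typ L0 m m.+1) (w m.+1)]) (rseq_of W t)]).
    apply: measurable_rseq_event; apply: bigcap_measurable => [|m _]; first by exists 0%N.
    have [mn|nm] := ltnP m n; last first.
      by rewrite [X in measurable X](_ : _ = setT) //; apply/seteqP.
    have := measurable_rseq_coord m.+1 measurableT
       (measurable_in_gap x (ndn L0 m) (nup L0 m) (typ L0 m m.+1)); rewrite setTI.
    by rewrite [X in _ -> measurable X](_ : _ = [set w : rseq R |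
       in_gap x (ndn L0 m) (nup L0 m) (typ L0 m m.+1) (w m.+1)]) //;
    apply/seteqP; split => w /= h //; exact: h.
  by apply/seteqP; split => t /= h m; [move=> _; exact: h|move=> mn; exact: (h m I mn)].
- have := generic_ae iidW x; apply: filterS => t g.
  have stX := Xorder_strict_total g.
  have [iff1 iff2] := same_typ_in_gaps g n st0.
  rewrite /cyl /= /gen_fun.
  rewrite (same_typb_first L0 (ltnSn n) (L' := Xorder x (rseq_of W t))).
    by split=> [/same_typP/iff1|/iff2 ?] //; exact/same_typP.
  by move=> a b an bn; exact: array_of_orderK.
Qed.

(** By [gen_law_same_typ] the permutations with the gaps of [s] are equally likely, and together
    they have probability [typ_prob]. *)
Lemma gen_law_cyl (x : monoseq R) n (s : 'S_n.+1) :
  ((#|[pred s' : 'S_n.+1 | same_typb (perm_order s) n (perm_order s')]|%:R : R)%:E *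
   gen_law W x [set p | p n.+1 = s] = (typ_prob x (perm_order s) n)%:E)%E.
Proof.
have st := perm_order_strict_total s.
rewrite -(gen_law_class x n st) (eq_bigr (fun=> gen_law W x [set p | p n.+1 = s])).
  have : gen_law W x [set p | p n.+1 = s] \is a fin_num.
    by apply: fin_num_measure; exact: (measurable_cyl [set s]).
  by move/fineK => <-; rewrite sumEFin sumr_const -EFinM mulr_natl.
move=> s' /same_typP ss'; rewrite -[in LHS](perm_orderK s') -[in RHS](perm_orderK s).
apply: (gen_law_same_typ iidW) => //; exact: perm_order_strict_total.
Qed.

(** After multiplication by the size of the class of permutations with the gaps of [s], both sides
    are the same integral of [typ_prob]: the left one by [integral_typ], as members of the class
    have equal rec, the right one by [gen_law_cyl]. The class contains [s], so its size cancels. *)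
Lemma disintegration_cyl (A : set (monoseq R)) n (s : 'S_n.+1) : measurable A ->
  {ae P, forall t, ranks_cvg R (perms t)} ->
  P ([set t | perms t n.+1 = s] `&` (fun t => rho t) @^-1` A) =
  (\int[P]_(t in (fun t => rho t) @^-1` A) gen_law W (rho t) [set p | p n.+1 = s])%E.
Proof.
move=> mA ranks_perms; pose h : monoseq R -> R := \1_A.
have st := perm_order_strict_total s.
have mh : measurable_fun setT h by exact: measurable_indic.
have h01 x : 0 <= h x <= 1 by rewrite /h indicE; case: (_ \in _); rewrite ?lexx ?ler01.
have mrA : measurable ((fun t => rho t) @^-1` A).
  by rewrite -[X in measurable X]setTI; exact: (@measurable_rho R d T P perms).
have ms (s' : 'S_n.+1) : measurable [set t | perms t n.+1 = s'].
  exact: (measurable_perms perms [set s']).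
have hE t : (h (rho t))%:E = (\1_((fun t => rho t) @^-1` A) t)%:E by [].
pose C := [pred s' : 'S_n.+1 | same_typb (perm_order s) n (perm_order s')].
have C0 : (#|C|%:R : R) != 0.
  rewrite pnatr_eq0 -lt0n; apply/card_gt0P; exists s; rewrite inE.
  by apply/same_typP.
have mhE : measurable_fun setT (fun x => (h x)%:E) by exact/measurable_EFinP.
have h0 x : (0 <= (h x)%:E)%E by rewrite lee_fin; case/andP: (h01 x).
have eL : ((#|C|%:R : R)%:E * P ([set t | perms t n.+1 = s] `&` (fun t => rho t) @^-1` A) =
    \int[P]_t (typ_prob (rho t) (perm_order s) n * h (rho t))%:E)%E.
  rewrite -(integral_typ coherent_perms uniform_given_rec st n ranks_perms mh h01).
  have -> : typ_event perms (perm_order s) n = [set t | C (perms t n.+1)].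
    apply/seteqP; split => t; rewrite /typ_event /C /=;
    rewrite (same_typb_first (perm_order s) (ltnSn n) (L' := perm_order (perms t n.+1))) //;
    by move=> a b an bn; rewrite (perm_order_perms coherent_perms).
  rewrite (integral_cyl_sum perms mhE h0).
  rewrite (eq_bigr (fun=> P ([set t | perms t n.+1 = s] `&` (fun t => rho t) @^-1` A))).
    have : P ([set t | perms t n.+1 = s] `&` (fun t => rho t) @^-1` A) \is a fin_num.
      by apply: fin_num_measure; exact: measurableI.
    by move/fineK => <-; rewrite sumEFin sumr_const -EFinM mulr_natl.
  move=> s' /same_typP ss'.
  have -> : (\int[P]_(t in [set t | perms t n.+1 = s']) (h (rho t))%:E =
     \int[P]_(t in [set t | perms t n.+1 = s]) (h (rho t))%:E)%E.
    apply: (integral_rho_rec coherent_perms uniform_given_rec mhE h0).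
    rewrite -(perm_orderK s') -(perm_orderK s).
    by apply: same_typ_rec => //; exact: perm_order_strict_total.
  by under eq_integral do rewrite hE; rewrite integral_indic // setIC.
have eR : ((#|C|%:R : R)%:E * \int[P]_(t in (fun t => rho t) @^-1` A)
     gen_law W (rho t) [set p | p n.+1 = s] =
    \int[P]_t (typ_prob (rho t) (perm_order s) n * h (rho t))%:E)%E.
  rewrite -ge0_integralZl //; last first.
    apply: measurable_funTS; apply: measurableT_comp (measurable_gen_law W _) _.
      exact: (measurable_cyl [set s]).
    exact: measurable_rho.
  under eq_integral do rewrite gen_law_cyl.
  rewrite integral_mkcond; apply: eq_integral => t _; rewrite patchE.
  rewrite /h indicE; have -> : (t \in (fun t => rho t) @^-1` A) = (rho t \in A).
    by apply/idP/idP; rewrite !inE.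
  by case: ifP; rewrite ?mulr1 ?mulr0.
have := etrans eL (esym eR) => /(congr1 (mule (#|C|%:R^-1)%:E)).
by rewrite !muleA -EFinM mulVf // !mul1e.
Qed.

End Disintegration.

Theorem proposition9 (R : realType) (d : measure_display) (T : measurableType d)
    (P : probability T R) (perms : {RV P >-> perm_array})
    (coherent_perms : forall t : T, coherent (perms t))
    (uniform_given_rec : forall (n : nat) (s1 s2 : 'S_n), rec s1 = rec s2 ->
       P [set t | perms t n = s1] = P [set t | perms t n = s2]) :
  exists rho : {RV P >-> monoseq R},
    (forall k : int, {ae P, forall t : T,
       (padded_rec (perms t n) k)%:R / n%:R @[n --> \oo] --> (rho t k : R)}) /\
    (forall (d' : measure_display) (T' : measurableType d')
        (P' : probability T' R) (W : nat -> {RV P' >-> R}),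
      iid_uniform W ->
      exists kappa : R.-pker (monoseq R) ~> perm_array,
        conditional_law rho perms kappa /\
        (forall x : monoseq R,
          random_element_with_law P'
            (fun t' : T' => generated_perms x (fun n : nat => W n t'))
            (kappa x))).
Proof.
pose rho0 t := rho_of R (perms t).
have mrho : measurable_fun setT rho0 by exact: measurable_rho.
pose mixin := isMeasurableFun.Build _ _ _ _ rho0 mrho.
pose rho : {RV P >-> monoseq R} := HB.pack rho0 mixin.
have ranks_perms : {ae P, forall t, ranks_cvg R (perms t)}.
  exact: rank_ae_cvg.
exists rho; split.
  move=> k; apply: filterS ranks_perms => t gt.
  exact: freq_cvg.
move=> d' T' P' W iidW; exists (gen_law W); split; last first.
  move=> x; split; first exact: (measurable_gen_fun W x).
  by move=> B mB; rewrite gen_lawE.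
move=> A B mA mB.
have mrA : measurable (rho @^-1` A) by have := mrho measurableT A mA; rewrite setTI.
(* For fixed [A] both sides are measures in [B] concentrated on coherent arrays, so single
   permutations suffice. Starting at level 1 ensures that there is an item 0 from which gaps can be
   counted. *)
pose m1 := pushforward (mrestr P mrA) perms.
pose m2 := mixture P rho (gen_law W) mrA.
rewrite setIC -[LHS]/(m1 B) -[RHS]/(m2 B).
apply: (perm_array_measure_unique (n0 := 1)) => //.
- rewrite -[X in (X < _)%E]/(P (perms @^-1` setT `&` rho @^-1` A)) preimage_setT setTI.
  by apply: le_lt_trans (probability_le1 P mrA) _; rewrite ltry.
- rewrite -[LHS]/(P (perms @^-1` (~` [set p | coherent p]) `&` rho @^-1` A)).
  rewrite (_ : perms @^-1` _ = set0) ?set0I ?measure0 //.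
  by apply/seteqP; split => // t /= /(_ (coherent_perms t)).
- rewrite -[LHS]/(\int[P]_(t in rho @^-1` A) gen_law W (rho t) (~` [set p | coherent p]))%E.
  by under eq_integral do rewrite (gen_law_coherent iidW); rewrite integral0.
- case=> // n s _.
  exact: (disintegration_cyl coherent_perms uniform_given_rec iidW).
Qed.
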